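(* Let $n\ge 3$ and let $m>1$ be a real constant. Let $(M^n,g,u,\lambda=0)$ be a complete (without boundary) asymptotically flat $m$-quasi-Einstein manifold. Then $(M^n,g)$ is Ricci flat.
   Context: For constants $\lambda\in\mathbb{R}$ and $0<m<\infty$, an $m$-quasi-Einstein manifold without boundary $(M^n,g,u,\lambda)$ is a complete Riemannian manifold $(M^n,g)$ together with a smooth function $u>0$ on $M$ satisfying $\nabla^2u=\frac{u}{m}(Ric-\lambda g)$, where $\nabla^2 u$ is the Hessian of $u$ and $Ric$ is the Ricci tensor of $g$. A Riemannian $n$-manifold $(M,g)$, $n\ge3$, is asymptotically flat if there is a compact subset $K\subset M$ such that $M\setminus K$ is a disjoint union of finitely many connected components $E_1,\dots,E_k$ (the ends), each end $E_i$ is diffeomorphic to $\mathbb{R}^n$ minus a ball, and under such a diffeomorphism the metric satisfies $g_{ij}=\delta_{ij}+b_{ij}$ with $b_{ij}=O_2(|x|^{-\tau})$ for some constant $\tau$ with $\frac{n-2}{2}<\tau\le n-2$, where $x=(x_1,\dots,x_n)$ are the standard coordinates of $\mathbb{R}^n$. Here $\phi=O_l(|x|^{-\tau})$ means that for some constant $C>0$, $|\partial^i\phi(x)|\le C|x|^{-\tau-i}$ for $0\le i\le l$. *)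

(* Defs.v *)
(* MathComp / MathComp-Analysis *)
From mathcomp Require Export all_boot all_order all_algebra.
From mathcomp Require Export all_classical all_reals all_analysis.
Export Order.TTheory GRing.Theory Num.Theory.
Export numFieldNormedType.Exports.

Set Implicit Arguments.
Unset Strict Implicit.
Unset Printing Implicit Defensive.

Local Open Scope classical_set_scope.
Local Open Scope ring_scope.

Section Euclidean.
Context {R : realType} {n : nat}.
Implicit Types (U : set 'rV[R]_n) (f : 'rV[R]_n -> R) (x : 'rV[R]_n).

(* The library norm on row vectors is the sup norm. *)
Definition enorm x : R := Num.sqrt (\sum_(i < n) x 0 i ^+ 2).

Definition partial (k : 'I_n) f : 'rV[R]_n -> R :=
  fun x => 'D_(delta_mx 0 k) f x.

Definition partials (s : seq 'I_n) f : 'rV[R]_n -> R := foldr partial f s.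

(* C^oo on an open set U; the values of f outside U are irrelevant. *)
Definition smooth_on U f : Prop :=
  forall (s : seq 'I_n) x, U x ->
    {for x, continuous (partials s f)} /\
    forall k : 'I_n, derivable (partials s f) x (delta_mx 0 k).

(* phi = O_l(|x|^-tau) on U *)
Definition bigO_derivs (l : nat) (tau : R) U f : Prop :=
  exists2 C : R, 0 < C &
    forall s : seq 'I_n, (size s <= l)%N ->
      forall x, U x ->
        `|partials s f x| <= C * enorm x `^ (- tau - (size s)%:R).

End Euclidean.

Section LocalGeometry.
Context {R : realType} {n : nat}.
(* the components g_ij(x) of a metric in one coordinate system *)
Implicit Types (G : 'rV[R]_n -> 'M[R]_n) (f : 'rV[R]_n -> R) (x : 'rV[R]_n).

(* Gamma^k_ij *)
Definition christoffel G (k i j : 'I_n) x : R :=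
  2^-1 * \sum_(l < n) invmx (G x) k l *
    (partial i (fun y => G y j l) x + partial j (fun y => G y i l) x
     - partial l (fun y => G y i j) x).

(* R^l_kij, normalized by R(d_i, d_j) d_k = R^l_kij d_l, where
   R(X, Y) = [nabla_X, nabla_Y] - nabla_[X, Y] *)
Definition riemann G (l k i j : 'I_n) x : R :=
  partial i (christoffel G l j k) x - partial j (christoffel G l i k) x
  + \sum_(p < n) (christoffel G l i p x * christoffel G p j k x
                  - christoffel G l j p x * christoffel G p i k x).

(* Ric(Y, Z) = tr (X |-> R(X, Y) Z); positive on round spheres *)
Definition ricci G (i j : 'I_n) x : R := \sum_(l < n) riemann G l j l i x.

Definition hessian G f (i j : 'I_n) x : R :=
  partial i (partial j f) x - \sum_(k < n) christoffel G k i j x * partial k f x.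

End LocalGeometry.

(* A chart is a pair of mutually inverse maps between cdom, an open subset of M,
   and cphi @` cdom, an open subset of R^n; cphi and cpsi are total functions
   whose values outside these sets are irrelevant. *)
Record chart (R : realType) (n : nat) (M : topologicalType) := Chart {
  cdom : set M;
  cphi : M -> 'rV[R]_n;
  cpsi : 'rV[R]_n -> M
}.

Section Manifold.
Context {R : realType} {n : nat} {M : topologicalType}.
Implicit Types (c d : chart R n M) (A : set (chart R n M)).

Definition cimg c : set 'rV[R]_n := cphi c @` cdom c.

Definition is_chart c : Prop :=
  [/\ open (cdom c), open (cimg c),
      forall p, cdom c p -> cpsi c (cphi c p) = p,
      {within cdom c, continuous (cphi c)} &
      {within cimg c, continuous (cpsi c)}].

Definition overlap c d : set 'rV[R]_n := cphi c @` (cdom c `&` cdom d).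

Definition transition c d (a : 'I_n) (x : 'rV[R]_n) : R :=
  cphi d (cpsi c x) 0 a.

Definition compatible c d : Prop :=
  forall a, smooth_on (overlap c d) (transition c d a) /\
            smooth_on (overlap d c) (transition d c a).

(* A is a maximal smooth atlas, so that a diffeomorphism from an open subset of M
   onto an open subset of R^n is the same thing as a member of A. *)
Definition smooth_structure A : Prop :=
  (forall p, exists2 c, A c & cdom c p) /\
  (forall c, A c <-> is_chart c /\ forall d, A d -> compatible c d).

Definition smooth_manifold A : Prop :=
  [/\ hausdorff_space M, @second_countable M & smooth_structure A].

Definition smooth_function A (u : M -> R) : Prop :=
  forall c, A c -> smooth_on (cimg c) (u \o cpsi c).

(* A tensor of type (0,2) is given by its components in all charts of A. *)
Definition tensor2 : Type := chart R n M -> 'rV[R]_n -> 'M[R]_n.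
Implicit Types g : tensor2.

Definition riemannian_metric A g : Prop :=
  [/\ forall c, A c -> forall i j, smooth_on (cimg c) (fun x => g c x i j),
      forall c, A c -> forall x, cimg c x -> (g c x)^T = g c x,
      forall c, A c -> forall x, cimg c x -> forall v : 'rV[R]_n, v != 0 ->
        0 < \sum_(i < n) \sum_(j < n) g c x i j * v 0 i * v 0 j &
      forall c d, A c -> A d -> forall x, overlap c d x -> forall i j,
        g c x i j = \sum_(a < n) \sum_(b < n)
          g d (cphi d (cpsi c x)) a b *
          partial i (transition c d a) x * partial j (transition c d b) x].

Definition coord c (gamma : R -> M) (a : 'I_n) : R -> R :=
  fun t => cphi c (gamma t) 0 a.

(* gamma is differentiable near [0, 1], with gamma' continuous at each point of
   [0, 1]; gamma plays the role of its restriction to [0, 1]. *)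
Definition C1_curve A (gamma : R -> M) : Prop :=
  forall t : R, 0 <= t <= 1 ->
    {for t, continuous gamma} /\
    forall c, A c -> cdom c (gamma t) -> forall a,
      (\forall s \near t, derivable (coord c gamma a) s 1) /\
      {for t, continuous (derive1 (coord c gamma a))}.

(* v t is the g-norm of gamma' t, computed in any chart around gamma t *)
Definition is_speed A g (gamma : R -> M) (v : R -> R) : Prop :=
  forall t : R, 0 <= t <= 1 -> forall c, A c -> cdom c (gamma t) ->
    v t = Num.sqrt (\sum_(i < n) \sum_(j < n)
            g c (cphi c (gamma t)) i j *
            derive1 (coord c gamma i) t * derive1 (coord c gamma j) t).

(* piecewise_C1_length A g p q L: some piecewise C^1 curve (a finite chain of C^1
   curves parametrized by [0, 1]) from p to q has g-length L *)
Inductive piecewise_C1_length A g : M -> M -> R -> Prop :=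
| Length_nil p : piecewise_C1_length A g p p 0
| Length_cons gamma v q L :
    C1_curve A gamma -> is_speed A g gamma v ->
    piecewise_C1_length A g (gamma 1) q L ->
    piecewise_C1_length A g (gamma 0) q
      (Rintegral lebesgue_measure `[0, 1] v + L).

(* +oo between different components *)
Definition riemannian_dist A g (p q : M) : \bar R :=
  ereal_inf [set L%:E | L in piecewise_C1_length A g p q].

(* Convergence is taken in the topology of M, which is the one induced by the
   Riemannian distance. *)
Definition complete_metric A g : Prop :=
  forall x : nat -> M,
    (forall e : R, 0 < e -> exists N : nat, forall i j : nat,
       (N <= i)%N -> (N <= j)%N -> (riemannian_dist A g (x i) (x j) < e%:E)%E) ->
    exists p : M, x @ \oo --> p.

Definition quasi_einstein A g (u : M -> R) (m lambda : R) : Prop :=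
  [/\ complete_metric A g, 0 < m, smooth_function A u, forall p, 0 < u p &
      forall c, A c -> forall x, cimg c x -> forall i j,
        hessian (g c) (u \o cpsi c) i j x =
        u (cpsi c x) / m * (ricci (g c) i j x - lambda * g c x i j)].

(* The chart c is a diffeomorphism from the end E onto the complement of a closed
   ball, in which g is asymptotic to the Euclidean metric. *)
Definition asymptotically_flat_end A g (E : set M) : Prop :=
  exists c (rho tau : R),
    [/\ A c, cdom c = E,
        0 < rho /\ cimg c = [set x | rho < enorm x],
        (n%:R - 2) / 2 < tau <= n%:R - 2 &
        forall i j, bigO_derivs 2 tau (cimg c)
                      (fun x => g c x i j - (i == j)%:R)].

Definition asymptotically_flat A g : Prop :=
  exists (K : set M) (k : nat) (E : 'I_k -> set M),
    [/\ compact K,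
        ~` K = \bigcup_i E i,
        forall i j p, E i p -> E j p -> i = j,
        forall i p, E i p -> E i = connected_component (~` K) p &
        forall i, asymptotically_flat_end A g (E i)].

Definition ricci_flat A g : Prop :=
  forall c, A c -> forall x, cimg c x -> forall i j, ricci (g c) i j x = 0.

End Manifold.

Arguments tensor2 : clear implicits.

(* Main.v *)
(* On an m-quasi-Einstein manifold with lambda = 0 the function
   Q = u Lap u + (m - 1) |grad u|^2 is locally constant (Kim and Kim): this combines the contracted
   Bianchi identity with the commutation formula for the third derivatives of u.
   On an asymptotically flat end, u Lap u = u^2 scal / m with scal = O(r^(-2 - tau)), so that the
   constancy of Q bounds |grad u| and gives u = O(r); then Hess u = u Ric / m = O(r^(-1 - tau)), so
   that grad u has a limit along rays, which vanishes because u > 0. Hence Q = 0 far out in the ends.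
   If Q > 0 somewhere, then u attains its maximum over the clopen set {Q > 0}, which is bounded in
   the ends, whereas Q <= 0 at a maximum of u; symmetrically for Q < 0. So Q = 0 everywhere.
   Finally |grad u|^2, which tends to 0 in the ends, attains its maximum unless it vanishes; with
   Q = 0 the Bochner formula excludes a positive maximum. So u is locally constant and Ric = 0.
   Completeness is used to prevent maximizing sequences from escaping through the inner sphere of
   the coordinate chart of an end. *)

Require Import Defs.
From mathcomp Require Import ring lra.
From HB Require Import structures.
Set Implicit Arguments.
Unset Strict Implicit.
Unset Printing Implicit Defensive.
Local Open Scope classical_set_scope.
Local Open Scope ring_scope.
Local Notation "''e_' k" := (delta_mx (0 : 'I_1) k)
  (at level 8, k at level 2, format "''e_' k").

(** * Calculus in several variables *)

(** For an integer m, the equation with lambda = 0 says that the warped product of M with a suitable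
    Einstein fibre of dimension m and warping function u is Ricci flat. Q is the Einstein constant
    that the fibre must have, which is where the expression u Lap u + (m - 1) |grad u|^2 comes from.
    The sign of m - 1 matters twice: it turns the constancy of Q into an upper bound for |grad u|^2,
    and it gives the last term of the Bochner formula the sign that forbids a positive maximum.
    Tensors are handled in one chart at a time, as matrix-valued functions, so that the curvature
    identities reduce to polynomial identities between noncommuting matrices. Passing to M requires
    that |grad u|^2 and Lap u do not depend on the chart. For Lap u this is read off from a Koszul
    formula, which expresses Hess u by inner products of gradients; second derivatives of transition
    maps are never expanded. *)

Lemma continuous_for_sum (R : realType) (T : topologicalType) (I : Type) (r : seq I)
    (P : pred I) (F : I -> T -> R) x :
  (forall i, {for x, continuous (F i)}) ->
  {for x, continuous (fun y => \sum_(i <- r | P i) F i y)}.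
Proof.
move=> cF; rewrite /prop_for /continuous_at.
apply: (@cvg_big R I +%R 0 P (@add_continuous R) T (nbhs x) r F (F ^~ x)) => i _; exact: cF.
Qed.

Section Calculus.
Context {R : realType} {n : nat}.
Implicit Types (U : set 'rV[R]_n) (f g : 'rV[R]_n -> R) (x v : 'rV[R]_n).

Lemma is_derive_line (f : 'rV[R]_n -> R) x v (s : R) :
  derivable f (x + s *: v) v ->
  is_derive s 1 (fun t : R => f (x + t *: v)) ('D_v f (x + s *: v)).
Proof.
move=> df.
have E : (fun h : R => h^-1 *: (((fun t : R => f (x + t *: v)) \o shift s) (h *: (1:R))
     - f (x + s *: v))) = (fun h => h^-1 *: ((f \o shift (x + s *: v)) (h *: v) - f (x + s *: v))).
  apply/funext => h /=; congr (_ *: (f _ - _)).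
  by rewrite [h *: 1]mulr1 scalerDl addrCA.
apply: DeriveDef; first by rewrite /derivable E.
by rewrite /derive E.
Qed.

Lemma MVT_line f x v (a : R) :
  (forall s : R, `|s| <= `|a| -> derivable f (x + s *: v) v) ->
  exists2 s, `|s| <= `|a| & f (x + a *: v) - f x = a * 'D_v f (x + s *: v).
Proof.
move=> df.
pose h (t : R) := f (x + t *: v).
have dh (s : R) : `|s| <= `|a| -> is_derive s 1 h ('D_v f (x + s *: v)).
  by move=> /df; exact: is_derive_line.
have ch (b c : R) : (forall s : R, s \in `[b, c] -> `|s| <= `|a|) ->
    {within `[b, c], continuous h}.
  move=> bc; apply: derivable_within_continuous => s /bc /dh ds.
  exact: ex_derive.
have h0 : h 0 = f x by rewrite /h scale0r addr0.
case: (lerP 0 a) => a0.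
  have sa (s : R) : s \in `[0, a] -> `|s| <= `|a|.
    by rewrite in_itv /= => /andP[s0 sa]; rewrite !ger0_norm.
  have [s|s /sa sa' E] := MVT_segment (df := fun s => 'D_v f (x + s *: v)) a0 _ (ch 0 a sa).
    by move=> sI; apply/dh/sa; apply: subset_itv_oo_cc.
  by exists s => //; rewrite -h0 -/(h a) E subr0 mulrC.
have sa (s : R) : s \in `[a, 0] -> `|s| <= `|a|.
  by rewrite in_itv /= => /andP[s0 sa]; rewrite (ltr0_norm a0) ler0_norm// lerN2.
have [s|s /sa sa' E] := MVT_segment (df := fun s => 'D_v f (x + s *: v)) (ltW a0) _ (ch a 0 sa).
  by move=> sI; apply/dh/sa; apply: subset_itv_oo_cc.
exists s => //; rewrite -h0 -/(h a) -[LHS]opprB E sub0r mulrN opprK mulrC //.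
Qed.

Lemma coord_le_norm x k : `|x 0 k| <= `|x|.
Proof.
rewrite [leRHS]/Num.Def.normr /= mx_normrE.
exact: (le_bigmax _ (fun ij => `|x ij.1 ij.2|) (0, k)).
Qed.

Lemma norm_le_coord x (r : R) : 0 <= r -> (forall k, `|x 0 k| <= r) -> `|x| <= r.
Proof.
move=> r0 H; rewrite /Num.Def.normr /= mx_normrE; apply: bigmax_le => // -[i j] _.
by rewrite (ord1 i).
Qed.

(** Vertices of an axis-parallel path from 0 to [x], along which an increment splits into increments
    in one variable. *)
Definition trunc (k : nat) x : 'rV[R]_n := \row_j (if (j < k)%N then x 0 j else 0).

Lemma truncS (k : 'I_n) x : trunc k.+1 x = trunc k x + x 0 k *: 'e_k.
Proof.
apply/rowP => j; rewrite !mxE eqxx /=; have [->|nk] := eqVneq j k.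
  by rewrite ltnSn ltnn mulr1 add0r.
by rewrite ltnS leq_eqVlt val_eqE (negbTE nk) mulr0 addr0.
Qed.

Lemma trunc_full x : trunc n x = x.
Proof. by apply/rowP => j; rewrite !mxE ltn_ord. Qed.

Lemma trunc0 x : trunc 0 x = 0.
Proof. by apply/rowP => j; rewrite !mxE ltn0. Qed.

(** The increment telescopes along the path of truncations, and the mean value theorem applies on
    each edge. The edges stay in the [d]-ball because truncation does not increase the sup norm. *)
Lemma C1_increment f x (e d : R) : 0 < d ->
  (forall k y, `|y - x| < d -> derivable f y 'e_k) ->
  (forall k y, `|y - x| < d -> `|partial k f y - partial k f x| <= e) ->
  forall h, `|h| < d ->
  `|f (x + h) - f x - \sum_k h 0 k * partial k f x| <= n%:R * e * `|h|.
Proof.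
move=> d0 df dc h hd.
have -> : f (x + h) - f x = \sum_(k < n) (f (x + trunc k.+1 h) - f (x + trunc k h)).
  rewrite -(big_mkord predT (fun k => f (x + trunc k.+1 h) - f (x + trunc k h))).
  by rewrite telescope_sumr // trunc_full trunc0 addr0.
rewrite -sumrB.
have <- : \sum_(k < n) (e * `|h|) = n%:R * e * `|h|.
  by rewrite sumr_const card_ord -mulrA mulr_natl.
apply: (le_trans (ler_norm_sum _ _ _)); apply: ler_sum => k _.
have near s : `|s| <= `|h 0 k| -> `|(x + trunc k h + s *: 'e_k) - x| < d.
  move=> sh; apply: le_lt_trans hd; rewrite addrAC [x + _]addrC addrK.
  apply: norm_le_coord => // j; rewrite !mxE eqxx /=.
  case: ltnP => jk.
    rewrite -val_eqE /= (ltn_eqF jk) mulr0 addr0; exact: coord_le_norm.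
  rewrite add0r; case: eqP => [_|_]; last by rewrite mulr0 normr0.
  by rewrite mulr1 (le_trans sh) // coord_le_norm.
have [|s sh] := @MVT_line f (x + trunc k h) 'e_k (h 0 k).
  by move=> s sh; apply/df/near.
rewrite truncS addrA => ->; rewrite -mulrBr normrM mulrC.
by apply: ler_pM => //; [exact/dc/near | exact: coord_le_norm].
Qed.

Definition lincomb (c : 'I_n -> R) : 'rV[R]_n -> R := fun v => \sum_k v 0 k * c k.

Lemma lincomb_is_linear c : linear (lincomb c).
Proof.
move=> a u v; rewrite /lincomb scaler_sumr -big_split /=; apply: eq_bigr => k _.
by rewrite !mxE mulrDl [a *: _]mulrA.
Qed.
HB.instance Definition _ c := GRing.isLinear.Build _ _ _ _ _ (lincomb_is_linear c).

Lemma continuous_lincomb c : continuous (lincomb c).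
Proof.
move=> x; apply: continuous_for_sum => k.
apply: (@continuousM R _ (fun v : 'rV[R]_n => v 0 k) (fun=> c k)).
  exact: (@coord_continuous R 1 n 0 k x).
exact: (@cst_continuous _ _ (c k) x).
Qed.

Lemma C1_differentiable f x :
  (forall k, \forall y \near x, derivable f y 'e_k) ->
  (forall k, {for x, continuous (partial k f)}) ->
  differentiable f x /\ forall v, 'd f x v = \sum_k v 0 k * partial k f x.
Proof.
move=> df dc.
have oE : f \o shift x = cst (f x) + lincomb (partial^~ f ^~ x) +o_ (0 : 'rV[R]_n) id.
  apply/eqaddoP => e e0.
  (* This absorbs the factor [n] of [C1_increment]; the [+ 1] covers [n = 0]. *)
  pose e' := e / (n%:R + 1).
  have e'0 : 0 < e' by rewrite divr_gt0 // ltr_wpDl.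
  have : forall k, \forall y \near x, derivable f y 'e_k /\
      `|partial k f y - partial k f x| <= e'.
    move=> k; near=> y; split; first by near: y; exact: df.
    rewrite distrC; near: y; exact: ((cvgrPdist_le _ _).1 (dc k) _ e'0).
  move=> /filter_forall/nbhs_ballP[d /= d0 H].
  have H1 k y : `|y - x| < d -> derivable f y 'e_k /\
      `|partial k f y - partial k f x| <= e'.
    by move=> yx; apply: H; rewrite -ball_normE /= distrC.
  near=> h.
  have hd : `|h| < d by near: h; apply/nbhs_ballP; exists d => //= y; rewrite -ball_normE /= sub0r normrN.
  rewrite -[X in `|X|]/(f (h + x) - (f x + lincomb (partial^~ f ^~ x) h)) opprD addrA addrC.
  rewrite [h + x]addrC addrC.
  apply: (le_trans (@C1_increment f x e' d d0 _ _ h hd)).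
  - by move=> k y /(H1 k)[].
  - by move=> k y /(H1 k)[].
  - apply: ler_wpM2r => //; rewrite /e' mulrCA ger_pMr //.
    by rewrite ler_pdivrMr ?mul1r ?lerDl // ltr_wpDl.
have cl := @continuous_lincomb (partial^~ f ^~ x).
have dE := diff_unique cl oE.
split; last by move=> v; rewrite dE.
by apply/diff_locallyP; rewrite dE; split.
Unshelve. all: by end_near. Qed.

Lemma chain_rule_curve f (c : R -> 'rV[R]_n) (t : R) (dc : 'I_n -> R) :
  (forall k, \forall y \near c t, derivable f y 'e_k) ->
  (forall k, {for c t, continuous (partial k f)}) ->
  (forall k, is_derive t 1 (fun s => c s 0 k) (dc k)) ->
  is_derive t 1 (f \o c) (\sum_k dc k * partial k f (c t)).
Proof.
move=> df cf dcP.
have [dff dfE] := C1_differentiable df cf.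
have dcv : derivable c t 1.
  by apply/derivable_mxP => i j; rewrite (ord1 i); exact: ex_derive.
have dct : differentiable c t by apply/derivable1_diffP.
apply: DeriveDef.
  by apply/derivable1_diffP; apply: differentiable_comp.
rewrite deriveE; last exact: differentiable_comp.
rewrite diff_comp // /= dfE; apply: eq_bigr => k _; congr (_ * _).
by rewrite -deriveE // derive_mx // mxE derive_val.
Qed.

End Calculus.

(** * Smooth functions and their closure properties *)

Section Smooth.
Context {R : realType} {n : nat}.
Implicit Types (U V : set 'rV[R]_n) (f g : 'rV[R]_n -> R) (x v : 'rV[R]_n).

Definition C0d U f : Prop :=
  forall x, U x -> {for x, continuous f} /\ forall k, derivable f x 'e_k.

(** The product and quotient rules do not preserve a condition on one fixed list of partial
    derivatives, but they do preserve the class C^N, by induction on [N]. Smoothness is membership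
    in all these classes ([smooth_onE]). *)
Fixpoint Ck (N : nat) U f : Prop :=
  C0d U f /\
  if N is N'.+1 then forall k, Ck N' U (partial k f) else True.

Lemma smooth_onP U f :
  smooth_on U f <->
  (forall x, U x -> {for x, continuous f} /\ forall k, derivable f x 'e_k) /\
  forall k, smooth_on U (partial k f).
Proof.
split=> [sf|[f0 fS] s].
  split; first exact: (sf [::]).
  by move=> k s; move: (sf (rcons s k)); rewrite /partials foldr_rcons.
by case/lastP: s => [|s k]; [exact: f0 | rewrite /partials foldr_rcons; exact: fS].
Qed.

Lemma smooth_onE U f : smooth_on U f <-> forall N, Ck N U f.
Proof.
split=> [sf N|cf s].
  elim: N f sf => [|N IH] f /smooth_onP[f0 fS]; split=> // k.
  exact: IH.
elim/last_ind: s f cf => [|s k IH] f cf; first exact: (cf 0%N).1.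
rewrite /partials foldr_rcons; apply: IH => N; exact: (cf N.+1).2.
Qed.

Lemma CkW N U f : Ck N.+1 U f -> Ck N U f.
Proof.
elim: N f => [|N IH] f [f0 fS]; split=> // k.
apply: IH; exact: fS.
Qed.

Lemma partial_near f g k x : (\near x, f x = g x) -> partial k f x = partial k g x.
Proof. exact: near_eq_derive. Qed.

Lemma eq_partial f g k x : f =1 g -> partial k f x = partial k g x.
Proof. by move=> /funext ->. Qed.

Lemma open_near U x (P : set 'rV[R]_n) : open U -> U x ->
  (forall y, U y -> P y) -> \near x, P x.
Proof. by move=> oU Ux UP; apply: filterS UP _; exact: open_nbhs_nbhs. Qed.

Lemma C0d_ext U f g : open U -> (forall x, U x -> f x = g x) -> C0d U f -> C0d U g.
Proof.
move=> oU fg f0 x Ux; have [fc fd] := f0 x Ux.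
have nfg : \near x, f x = g x by exact: (open_near oU Ux fg).
split; last by move=> k; exact: near_eq_derivable (fd k).
by rewrite /prop_for /continuous_at -(fg x Ux); apply: cvg_trans fc; exact: (near_eq_cvg nfg).
Qed.

Lemma Ck_ext N U f g : open U -> (forall x, U x -> f x = g x) ->
  Ck N U f -> Ck N U g.
Proof.
move=> oU; elim: N f g => [|N IH] f g fg [f0 fS].
  by split; [exact: C0d_ext f0|].
split; first exact: C0d_ext f0.
move=> k; apply: IH (fS k) => x Ux; apply: partial_near.
exact: (open_near oU Ux fg).
Qed.

Lemma partial_cst (c : R) (k : 'I_n) : partial k (fun=> c) = (fun=> 0 : R).
Proof. by apply/funext => x; rewrite /partial derive_cst. Qed.

Lemma partialD f g k x : derivable f x 'e_k -> derivable g x 'e_k ->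
  partial k (fun y => f y + g y) x = partial k f x + partial k g x.
Proof. by move=> df dg; rewrite /partial -deriveD. Qed.

Lemma partialN f k x : derivable f x 'e_k ->
  partial k (fun y => - f y) x = - partial k f x.
Proof. by move=> df; rewrite /partial -deriveN. Qed.

Lemma partialM f g k x : derivable f x 'e_k -> derivable g x 'e_k ->
  partial k (fun y => f y * g y) x = partial k f x * g x + f x * partial k g x.
Proof.
by move=> df dg; rewrite /partial (deriveM df dg) addrC [g x *: _]mulrC.
Qed.

Lemma partialV f k x : derivable f x 'e_k -> f x != 0 ->
  partial k (fun y => (f y)^-1) x = - ((f x)^-1 * (f x)^-1 * partial k f x).
Proof.
by move=> df f0; rewrite /partial (deriveV f0 df) [LHS]mulNr expr2 invfM.
Qed.

Lemma derivable_sumf (I : Type) (r : seq I) (F : I -> 'rV[R]_n -> R) x v :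
  (forall i, derivable (F i) x v) ->
  derivable (fun y => \sum_(i <- r) F i y) x v.
Proof.
move=> dF; elim: r => [|i r IH].
  have -> : (fun y => \sum_(i <- [::]) F i y) = cst 0.
    by apply/funext => y; rewrite big_nil.
  exact: derivable_cst.
have -> : (fun y => \sum_(i <- i :: r) F i y) = F i + (fun y => \sum_(i <- r) F i y).
  by apply/funext => y; rewrite big_cons.
exact: (derivableD (dF i) IH).
Qed.

Lemma partial_sum (I : Type) (r : seq I) (F : I -> 'rV[R]_n -> R) k x :
  (forall i, derivable (F i) x 'e_k) ->
  partial k (fun y => \sum_(i <- r) F i y) x = \sum_(i <- r) partial k (F i) x.
Proof.
move=> dF; elim: r => [|i r IH].
  have -> : (fun y => \sum_(i <- [::]) F i y) = (fun=> 0).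
    by apply/funext => y; rewrite big_nil.
  by rewrite big_nil partial_cst.
rewrite big_cons -IH -partialD //; last exact: derivable_sumf.
by apply: eq_partial => y; rewrite big_cons.
Qed.

Lemma Ck_cst N U (c : R) : Ck N U (fun=> c).
Proof.
have C0 (d : R) : C0d U (fun=> d).
  by move=> x _; split=> [|k]; [exact: (@cst_continuous _ _ d x) | exact: (derivable_cst d x)].
elim: N c => [|N IH] c; first by split; [exact: C0|].
by split; [exact: C0 | move=> k; rewrite partial_cst; exact: IH].
Qed.

Lemma CkD N U f g : open U -> Ck N U f -> Ck N U g -> Ck N U (fun x => f x + g x).
Proof.
move=> oU; have C0 f1 g1 : C0d U f1 -> C0d U g1 -> C0d U (fun x => f1 x + g1 x).
  move=> f0 g0 x Ux; have [[cf df] [cg dg]] := (f0 x Ux, g0 x Ux).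
  by split=> [|k]; [exact: (continuousD cf cg) | exact: (derivableD (df k) (dg k))].
elim: N f g => [|N IH] f g [f0 fS] [g0 gS]; first by split; [exact: C0|].
split; first exact: C0.
move=> k; apply: (Ck_ext oU _ (IH _ _ (fS k) (gS k))) => x Ux.
by rewrite partialD; [|apply (f0 x Ux).2 | apply (g0 x Ux).2].
Qed.

Lemma CkN N U f : open U -> Ck N U f -> Ck N U (fun x => - f x).
Proof.
move=> oU; have C0 f1 : C0d U f1 -> C0d U (fun x => - f1 x).
  move=> f0 x Ux; have [cf df] := f0 x Ux.
  by split=> [|k]; [exact: (continuousN cf) | exact: (derivableN (df k))].
elim: N f => [|N IH] f [f0 fS]; first by split; [exact: C0|].
split; first exact: C0.
move=> k; apply: (Ck_ext oU _ (IH _ (fS k))) => x Ux.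
by rewrite partialN; [|apply (f0 x Ux).2].
Qed.

Lemma CkM N U f g : open U -> Ck N U f -> Ck N U g -> Ck N U (fun x => f x * g x).
Proof.
move=> oU; have C0 f1 g1 : C0d U f1 -> C0d U g1 -> C0d U (fun x => f1 x * g1 x).
  move=> f0 g0 x Ux; have [[cf df] [cg dg]] := (f0 x Ux, g0 x Ux).
  by split=> [|k]; [exact: (continuousM cf cg) | exact: (derivableM (df k) (dg k))].
elim: N f g => [|N IH] f g Cf Cg; have [[f0 fS] [g0 gS]] := (Cf, Cg).
  by split; [exact: C0|].
split; first exact: C0.
move=> k; apply: (Ck_ext oU _ (CkD oU (IH _ _ (fS k) (CkW Cg)) (IH _ _ (CkW Cf) (gS k)))) => x Ux.
by rewrite partialM; [|apply (f0 x Ux).2 | apply (g0 x Ux).2].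
Qed.

Lemma CkV N U f : open U -> (forall x, U x -> f x != 0) -> Ck N U f ->
  Ck N U (fun x => (f x)^-1).
Proof.
move=> oU n0; have C0 : C0d U f -> C0d U (fun x => (f x)^-1).
  move=> f0 x Ux; have [cf df] := f0 x Ux.
  split=> [|k]; first exact: (continuousV (n0 x Ux) cf).
  exact: (derivableV (n0 x Ux) (df k)).
elim: N => [|N IH] Cf; have [f0 fS] := Cf; first by split; [exact: C0|].
split; first exact: C0.
move=> k; have IH' := IH (CkW Cf).
apply: (Ck_ext oU _ (CkN oU (CkM oU (CkM oU IH' IH') (fS k)))) => x Ux.
by rewrite partialV; [|apply (f0 x Ux).2 | exact: n0].
Qed.

Lemma smooth_cst U (c : R) : smooth_on U (fun=> c).
Proof. by apply/smooth_onE => N; exact: Ck_cst. Qed.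

Lemma smooth_ext U f g : open U -> (forall x, U x -> f x = g x) ->
  smooth_on U f -> smooth_on U g.
Proof. by move=> oU fg /smooth_onE sf; apply/smooth_onE => N; exact: Ck_ext (sf N). Qed.

Lemma smoothD U f g : open U -> smooth_on U f -> smooth_on U g ->
  smooth_on U (fun x => f x + g x).
Proof. by move=> oU /smooth_onE sf /smooth_onE sg; apply/smooth_onE => N; exact: CkD. Qed.

Lemma smoothN U f : open U -> smooth_on U f -> smooth_on U (fun x => - f x).
Proof. by move=> oU /smooth_onE sf; apply/smooth_onE => N; exact: CkN. Qed.

Lemma smoothB U f g : open U -> smooth_on U f -> smooth_on U g ->
  smooth_on U (fun x => f x - g x).
Proof. by move=> oU sf sg; exact: (smoothD oU sf (smoothN oU sg)). Qed.

Lemma smoothM U f g : open U -> smooth_on U f -> smooth_on U g ->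
  smooth_on U (fun x => f x * g x).
Proof. by move=> oU /smooth_onE sf /smooth_onE sg; apply/smooth_onE => N; exact: CkM. Qed.

Lemma smoothV U f : open U -> (forall x, U x -> f x != 0) -> smooth_on U f ->
  smooth_on U (fun x => (f x)^-1).
Proof. by move=> oU n0 /smooth_onE sf; apply/smooth_onE => N; exact: CkV. Qed.

Lemma smooth_sum U (I : Type) (r : seq I) (F : I -> 'rV[R]_n -> R) : open U ->
  (forall i, smooth_on U (F i)) -> smooth_on U (fun y => \sum_(i <- r) F i y).
Proof.
move=> oU sF; elim: r => [|i r IH].
  by refine (smooth_ext oU _ (@smooth_cst U 0)) => x _; rewrite big_nil.
by refine (smooth_ext oU _ (smoothD oU (sF i) IH)) => x _; rewrite big_cons.
Qed.

Lemma smooth_prod U (I : Type) (r : seq I) (F : I -> 'rV[R]_n -> R) : open U ->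
  (forall i, smooth_on U (F i)) -> smooth_on U (fun y => \prod_(i <- r) F i y).
Proof.
move=> oU sF; elim: r => [|i r IH].
  by refine (smooth_ext oU _ (@smooth_cst U 1)) => x _; rewrite big_nil.
by refine (smooth_ext oU _ (smoothM oU (sF i) IH)) => x _; rewrite big_cons.
Qed.

Lemma smooth_partial U f k : smooth_on U f -> smooth_on U (partial k f).
Proof. by move=> /smooth_onP[]. Qed.

Lemma smooth_continuous U f x : smooth_on U f -> U x -> {for x, continuous f}.
Proof. by move=> /smooth_onP[sf _] /sf[]. Qed.

Lemma smooth_derivable U f x k : smooth_on U f -> U x -> derivable f x 'e_k.
Proof. by move=> /smooth_onP[sf _] /sf[]. Qed.

Lemma smooth_sub U V f : V `<=` U -> smooth_on U f -> smooth_on V f.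
Proof. by move=> VU sf s x /VU; exact: sf. Qed.

Lemma is_derive_coord (j k : 'I_n) x :
  is_derive x 'e_j (fun x : 'rV[R]_n => x 0 k) (j == k)%:R.
Proof.
have dl : differentiable (fun x : 'rV[R]_n => x 0 k) x by exact: differentiable_coord.
apply: DeriveDef; first exact: diff_derivable.
have E : (fun h : R => h^-1 *: (((fun y : 'rV[R]_n => y 0 k) \o shift x) (h *: 'e_j) - x 0 k)) @ 0^'
   --> ((j == k)%:R : R).
  apply: cvg_near_cst; near=> h.
  have h0 : h != 0 by near: h; exact: nbhs_dnbhs_neq.
  rewrite /= !mxE addrK eqxx /= eq_sym; case: (j == k); rewrite ?mulr1 ?mulr0 ?scaler0 //.
  by rewrite [_ *: _]mulVf.
exact: cvg_lim E.
Unshelve. all: by end_near. Qed.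

Lemma partial_coord (j k : 'I_n) x :
  partial j (fun x : 'rV[R]_n => x 0 k) x = (j == k)%:R.
Proof. by have [_] := is_derive_coord j k x. Qed.

Lemma smooth_coord U (k : 'I_n) : open U -> smooth_on U (fun x => x 0 k).
Proof.
move=> oU; apply/smooth_onP; split.
  move=> x Ux; split=> [|j]; first exact: (@coord_continuous R 1 n 0 k x).
  exact: (@ex_derive _ _ _ _ _ _ _ (is_derive_coord j k x)).
move=> j; refine (smooth_ext oU _ (@smooth_cst U (j == k)%:R)) => x Ux.
by rewrite partial_coord.
Qed.

Lemma smooth_is_derive U f x v (s : R) : open U -> smooth_on U f -> U (x + s *: v) ->
  is_derive s 1 (fun t : R => f (x + t *: v))
    (\sum_k v 0 k * partial k f (x + s *: v)).
Proof.
move=> oU sf Us.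
apply: (@chain_rule_curve R n f (fun t : R => x + t *: v) s (fun k => v 0 k)).
- by move=> k; apply: (open_near oU Us) => y Uy; exact: smooth_derivable sf Uy.
- by move=> k; apply: smooth_continuous Us; exact: smooth_partial sf.
- move=> k.
  have -> : (fun t : R => (x + t *: v) 0 k) = (fun t : R => cst (x 0 k) t + v 0 k * t).
    by apply/funext => t; rewrite !mxE mulrC.
  by apply: is_derive_eq; rewrite add0r [_ *: _]mulr1.
Qed.

Lemma partial_comp (T : 'rV[R]_n -> 'rV[R]_n) f k x :
  (forall j, \forall y \near T x, derivable f y 'e_j) ->
  (forall j, {for T x, continuous (partial j f)}) ->
  (forall j, derivable (fun y => T y 0 j) x 'e_k) ->
  partial k (fun y => f (T y)) x =
    \sum_j partial k (fun y => T y 0 j) x * partial j f (T x).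
Proof.
move=> df cf dT.
have x0 : x + 0 *: 'e_k = x by rewrite scale0r addr0.
have H : is_derive (0 : R) 1 (f \o (fun t : R => T (x + t *: 'e_k)))
    (\sum_j partial k (fun y => T y 0 j) x * partial j f (T x)).
  have -> : T x = T (x + (0 : R) *: 'e_k) by rewrite x0.
  apply: (@chain_rule_curve R n f (fun t : R => T (x + t *: 'e_k)) 0
    (fun j => partial k (fun y => T y 0 j) x)); rewrite ?x0 //.
  move=> j; rewrite -{2}x0; apply: (@is_derive_line R n (fun y => T y 0 j)).
  by rewrite x0.
have [_ <-] := H.
rewrite /partial /derive; set F1 := fun h => _; set F2 := fun h => _.
have -> : F1 = F2; last by [].

apply/funext => h; rewrite /F1 /F2 /=.
by rewrite addr0 -[h%:A]/(h * 1) mulr1 x0 (addrC x).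
Qed.

End Smooth.

(** * Second derivatives: symmetry, and the condition at a maximum *)

Section Second.
Context {R : realType} {n : nat}.
Implicit Types (U V : set 'rV[R]_n) (f g : 'rV[R]_n -> R) (x v : 'rV[R]_n).

Lemma norm_delta (k : 'I_n) : `|'e_k : 'rV[R]_n| <= 1.
Proof.
apply: norm_le_coord => // j; rewrite mxE eqxx /=.
by case: (_ == _); rewrite ?normr1 ?normr0.
Qed.

Definition ddiff f x (i j : 'I_n) (s : R) : R :=
  f (x + s *: 'e_i + s *: 'e_j) - f (x + s *: 'e_i) - (f (x + s *: 'e_j) - f x).

Lemma ddiffC f x i j s : ddiff f x i j s = ddiff f x j i s.
Proof. by rewrite /ddiff [x + s *: 'e_j + s *: 'e_i]addrAC; ring. Qed.

Lemma is_derive_shift_arg f w x (v : 'rV[R]_n) : derivable f (x + w) v ->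
  is_derive x v (fun y => f (y + w)) ('D_v f (x + w)).
Proof.
move=> df.
have E : (fun h : R => h^-1 *: (((fun y => f (y + w)) \o shift x) (h *: v) - f (x + w)))
   = (fun h => h^-1 *: ((f \o shift (x + w)) (h *: v) - f (x + w))).
  by apply/funext => h /=; rewrite addrA.
apply: DeriveDef; first by rewrite /derivable E.
by rewrite /derive E.
Qed.

(** The mean value theorem, applied to the increment [phi] of [f] along [e_j] and then to
    [partial i f], shows that the second difference is exactly [s * s] times a mixed derivative at a
    nearby point. *)
Lemma ddiff_lim U f x i j : open U -> smooth_on U f -> U x ->
  forall e : R, 0 < e -> exists2 d : R, 0 < d &
    forall s, 0 < s < d ->
      `|ddiff f x i j s - s * s * partial j (partial i f) x| <= s * s * e.
Proof.
move=> oU sf Ux e e0.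
have sij : smooth_on U (partial j (partial i f)) by do 2 apply: smooth_partial.
have cij := smooth_continuous sij Ux.
have : \forall y \near x, U y /\ `|partial j (partial i f) y - partial j (partial i f) x| <= e.
  near=> y; split; first by near: y; exact: open_nbhs_nbhs.
  by rewrite distrC; near: y; exact: ((cvgrPdist_le _ _).1 cij _ e0).
move=> /nbhs_ballP[d /= d0 H].
have Hb y : `|y - x| < d -> U y /\ `|partial j (partial i f) y - partial j (partial i f) x| <= e.
  by move=> yx; apply: H; rewrite -ball_normE /= distrC.
exists (d / 2); first by rewrite divr_gt0.
move=> s /andP[s0 sd].
have near (a b : R) : `|a| <= `|s| -> `|b| <= `|s| -> `|(x + a *: 'e_i + b *: 'e_j) - x| < d.
  rewrite (gtr0_norm s0) => sa sb.
  rewrite addrC -addrA addKr (le_lt_trans (ler_normD _ _)) // !normrZ.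
  have /= H1 := norm_delta i; have /= H2 := norm_delta j.
  have : `|a| * `|'e_i : 'rV[R]_n| <= s * 1 by apply: ler_pM.
  have : `|b| * `|'e_j : 'rV[R]_n| <= s * 1 by apply: ler_pM.
  lra.
have s00 : `|0 : R| <= `|s| by rewrite normr0.
have near1 a : `|a| <= `|s| -> `|(x + a *: 'e_i) - x| < d.
  by move=> /near /(_ s00); rewrite scale0r addr0.
pose phi y := f (y + s *: 'e_j) - f y.
have dphi (a : R) : `|a| <= `|s| -> is_derive (x + a *: 'e_i) 'e_i phi
   (partial i f (x + a *: 'e_i + s *: 'e_j) - partial i f (x + a *: 'e_i)).
  move=> sa; apply: is_deriveB.
    apply: (@is_derive_shift_arg f (s *: 'e_j)).
    by apply: (smooth_derivable sf); apply (Hb _ (near a s sa (lexx _))).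
  apply: derivableP; apply: (smooth_derivable sf).
  by apply (Hb _ (near1 a sa)).
have [|a sa Ea] := @MVT_line R n phi x 'e_i s.
  by move=> a sa; have := dphi a sa; move=> /(@ex_derive _ _ _ _ _ _ _).
have [|b sb Eb] := @MVT_line R n (partial i f) (x + a *: 'e_i) 'e_j s.
  move=> b sb; apply: (smooth_derivable (smooth_partial i sf)).
  by apply (Hb _ (near a b sa sb)).
have -> : ddiff f x i j s = s * s * partial j (partial i f) (x + a *: 'e_i + b *: 'e_j).
  rewrite /ddiff -/(phi x) -/(phi (x + s *: 'e_i)) Ea -mulrA; congr (_ * _).
  by have := dphi a sa; move=> /(@derive_val _ _ _ _ _ _ _) ->; rewrite Eb.
have ss : 0 <= s * s by rewrite mulr_ge0 // ltW.
rewrite -mulrBr normrM (ger0_norm ss); apply: ler_wpM2l => //.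
by apply (Hb _ (near a b sa sb)).2.
Unshelve. all: by end_near. Qed.

(** The second difference is symmetric in [i] and [j], and divided by [s * s] it approximates both
    mixed derivatives. *)
Lemma clairaut U f x i j : open U -> smooth_on U f -> U x ->
  partial i (partial j f) x = partial j (partial i f) x.
Proof.
move=> oU sf Ux; apply/eqP; rewrite -subr_eq0 -normr_le0.
apply/ler_addgt0Pr => e e0; rewrite add0r.
have e2 : 0 < e / 2 by rewrite divr_gt0.
have [d1 d10 H1] := ddiff_lim i j oU sf Ux e2.
have [d2 d20 H2] := ddiff_lim j i oU sf Ux e2.
pose s := Num.min d1 d2 / 2.
have m0 : 0 < Num.min d1 d2 by rewrite lt_min d10.
have s0 : 0 < s by rewrite divr_gt0.
have sm : s < Num.min d1 d2 by rewrite /s; lra.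
have := H1 s; rewrite s0 (lt_le_trans sm) ?ge_min ?lexx // => /(_ isT) {}H1.
have := H2 s; rewrite s0 (lt_le_trans sm) ?ge_min ?lexx ?orbT // ddiffC => /(_ isT) {}H2.
have ss : 0 < s * s by rewrite mulr_gt0.
rewrite -(ler_pM2l ss) -(gtr0_norm ss) -normrM (gtr0_norm ss).
move: H1; rewrite ler_norml => /andP[A1 A2].
move: H2; rewrite ler_norml => /andP[B1 B2].
rewrite ler_norml.
move: A1 A2 B1 B2; move: (ddiff _ _ _ _ _) (partial i _ _) (partial j _ _) => D P Q.
by move=> *; apply/andP; split; lra.
Qed.

Lemma local_max_deriv U f x : open U -> smooth_on U f -> U x ->
  (\forall y \near x, f y <= f x) ->
  (forall k, partial k f x = 0) /\
  forall v, \sum_j \sum_k v 0 j * v 0 k * partial j (partial k f) x <= 0.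
Proof.
move=> oU sf Ux mx.
have : \forall y \near x, U y /\ f y <= f x.
  near=> y; split; first by near: y; exact: open_nbhs_nbhs.
  by near: y.
move=> /nbhs_ballP[d /= d0 H].
have Hb y : `|y - x| < d -> U y /\ f y <= f x.
  by move=> yx; apply: H; rewrite -ball_normE /= distrC.
pose D v (t : R) := \sum_k v 0 k * partial k f (x + t *: v).
have line v : exists2 r : R, 0 < r & forall t, `|t| < r ->
    [/\ U (x + t *: v), f (x + t *: v) <= f x &
       is_derive t 1 (fun t : R => f (x + t *: v)) (D v t)].
  exists (d / (`|v| + 1)); first by rewrite divr_gt0 // ltr_wpDl.
  move=> t; rewrite ltr_pdivlMr ?ltr_wpDl // => tr.
  have /Hb[Ut ft] : `|x + t *: v - x| < d.
    rewrite [x + _]addrC addrK normrZ; apply: le_lt_trans tr.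
    by rewrite ler_wpM2l // lerDl.
  by split=> //; exact: smooth_is_derive sf Ut.
have D0 v : D v 0 = 0.
  have [r r0 Hr] := line v.
  have inr (t : R) : t \in `]-r, r[ -> `|t| < r by rewrite in_itv /= ltr_norml.
  have r0' : (0 : R) \in `]-r, r[ by rewrite in_itv /= oppr_lt0 r0.
  have := @derive1_at_max R (fun t : R => f (x + t *: v)) (- r) r 0 _ _ r0' _.
  have [|U0 _ dv] := Hr 0; first by rewrite normr0.
  move=> mm; have {mm}mm : is_derive (0 : R) 1 (fun t : R => f (x + t *: v)) 0.
    apply: mm; first by rewrite ge0_cp // ltW.
      by move=> t /inr /Hr[_ _ dt]; exact: ex_derive.
    by move=> t /inr /Hr[_ ft _]; rewrite scale0r addr0.
  by rewrite -(@derive_val _ _ _ _ _ _ _ dv) (@derive_val _ _ _ _ _ _ _ mm).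
split=> [k|v].
  have := D0 'e_k; rewrite /D scale0r addr0 (bigD1 k) //= big1 ?addr0.
    by rewrite mxE !eqxx mul1r.
  by move=> j jk; rewrite mxE eqxx (negbTE jk) mul0r.
set c := (X in X <= 0).
(* If the second derivative along [v] were positive, then [D v], which vanishes at 0, would be
   positive just after 0, and [f] would increase along [v], against the maximum. *)
rewrite leNgt; apply/negP => c0.
have [r r0 Hr] := line v.
have dD : is_derive (0 : R) 1 (D v) c.
  have -> : c = \sum_k v 0 k * \sum_j v 0 j * partial j (partial k f) (x + (0:R) *: v).
    rewrite /c exchange_big /= scale0r addr0; apply: eq_bigr => k _; rewrite mulr_sumr.
    by apply: eq_bigr => j _; rewrite mulrCA mulrA.
  have -> : D v = \sum_(k < n) (fun t : R => v 0 k * partial k f (x + t *: v)).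
    by apply/funext => t; rewrite fct_sumE.
  apply: is_derive_sum => k.
  have -> : (fun t : R => v 0 k * partial k f (x + t *: v)) =
     v 0 k \*: (fun t : R => partial k f (x + t *: v)) by [].
  apply: is_deriveZ; apply: (smooth_is_derive oU (smooth_partial k sf)).
  by rewrite scale0r addr0.
have [cD lD] := dD.
have : \forall t \near 0^', 0 < t^-1 *: ((D v \o shift 0) (t *: 1) - D v 0).
  have cc : t^-1 *: ((D v \o shift 0) (t *: 1) - D v 0) @[t --> 0^'] --> c.
    by rewrite -lD; exact: cD.
  exact: (cvgr_gt _ cc _ c0).
move=> /nbhs_ballP[e /= e0 He].
pose t := Num.min r e / 2.
have m0 : 0 < Num.min r e by rewrite lt_min r0.
have t0 : 0 < t by rewrite divr_gt0.
have tr : t < r by rewrite /t; have := ge_min r r e; rewrite lexx /= => h; lra.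
have te : t < e by rewrite /t; have := ge_min e r e; rewrite lexx orbT /= => h; lra.
have Dpos s : 0 < s -> s <= t -> 0 < D v s.
  move=> s0 st; have := He s; rewrite /ball /= sub0r normrN gtr0_norm // => /(_ (le_lt_trans st te)).
  move=> /(_ (lt0r_neq0 s0)); rewrite D0 subr0 addr0 [s *: 1]mulr1.
  by rewrite pmulr_rgt0 // invr_gt0.
have [||s sI Es] := @MVT R (fun t : R => f (x + t *: v)) (D v) 0 t t0.
- move=> s; rewrite in_itv /= => /andP[s0 st].
  have [|//] := Hr s; by rewrite gtr0_norm // (lt_trans st).
- apply: derivable_within_continuous => s; rewrite in_itv /= => /andP[s0 st].
  have [|_ _ ds] := Hr s; first by rewrite ger0_norm // (le_lt_trans st).
  exact: ex_derive.
move: sI; rewrite in_itv /= => /andP[s0 st].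
have : f (x + t *: v) <= f x by have [|//] := Hr t; rewrite gtr0_norm.
move: Es; rewrite scale0r addr0 subr0 => Es.
have : 0 < D v s * t by rewrite mulr_gt0 // Dpos // ltW.
by rewrite -Es subr_gt0 ltNge => /negP.
Unshelve. all: by end_near. Qed.

End Second.

(** * Riemannian geometry in coordinates *)

Section MatrixCalculus.
Context {R : realType} {n : nat}.
Variable (U : set 'rV[R]_n).
Hypothesis oU : open U.
Implicit Types (x : 'rV[R]_n).

Definition dmx {p q} (k : 'I_n) (F : 'rV[R]_n -> 'M[R]_(p, q)) : 'rV[R]_n -> 'M[R]_(p, q) :=
  fun x => \matrix_(i, j) partial k (fun y => F y i j) x.

Definition smx {p q} (F : 'rV[R]_n -> 'M[R]_(p, q)) : Prop :=
  forall i j, smooth_on U (fun y => F y i j).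

Lemma smx_dmx p q k (F : 'rV[R]_n -> 'M[R]_(p, q)) : smx F -> smx (dmx k F).
Proof.
move=> sF i j; have -> : (fun y => dmx k F y i j) = partial k (fun y => F y i j).
  by apply/funext => y; rewrite mxE.
exact: smooth_partial.
Qed.

Lemma smx_ext p q (F H : 'rV[R]_n -> 'M[R]_(p, q)) :
  (forall x, U x -> F x = H x) -> smx F -> smx H.
Proof.
by move=> FH sF i j; apply: (smooth_ext oU _ (sF i j)) => x Ux; rewrite FH.
Qed.

Lemma dmx_ext p q k (F H : 'rV[R]_n -> 'M[R]_(p, q)) x :
  (forall x, U x -> F x = H x) -> U x -> dmx k F x = dmx k H x.
Proof.
move=> FH Ux; apply/matrixP => i j; rewrite !mxE; apply: partial_near.
by apply: (open_near oU Ux) => y /FH ->.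
Qed.

Lemma smxD p q (F H : 'rV[R]_n -> 'M[R]_(p, q)) :
  smx F -> smx H -> smx (fun y => F y + H y).
Proof.
move=> sF sH i j; have -> : (fun y => (F y + H y) i j) = (fun y => F y i j + H y i j).
  by apply/funext => y; rewrite mxE.
exact: smoothD.
Qed.

Lemma smxN p q (F : 'rV[R]_n -> 'M[R]_(p, q)) : smx F -> smx (fun y => - F y).
Proof.
move=> sF i j; have -> : (fun y => (- F y) i j) = (fun y => - F y i j).
  by apply/funext => y; rewrite mxE.
exact: smoothN.
Qed.

Lemma smxB p q (F H : 'rV[R]_n -> 'M[R]_(p, q)) :
  smx F -> smx H -> smx (fun y => F y - H y).
Proof. by move=> sF sH; apply: smxD => //; exact: smxN. Qed.

Lemma smxT p q (F : 'rV[R]_n -> 'M[R]_(p, q)) : smx F -> smx (fun y => (F y)^T).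
Proof.
move=> sF i j; have -> : (fun y => (F y)^T i j) = (fun y => F y j i).
  by apply/funext => y; rewrite mxE.
exact: sF.
Qed.

Lemma smxM p q r (F : 'rV[R]_n -> 'M[R]_(p, q)) (H : 'rV[R]_n -> 'M[R]_(q, r)) :
  smx F -> smx H -> smx (fun y => F y *m H y).
Proof.
move=> sF sH i j.
have -> : (fun y => (F y *m H y) i j) = (fun y => \sum_l F y i l * H y l j).
  by apply/funext => y; rewrite mxE.
by apply: smooth_sum => // l; apply: smoothM.
Qed.

Lemma dmxD p q k (F H : 'rV[R]_n -> 'M[R]_(p, q)) x : smx F -> smx H -> U x ->
  dmx k (fun y => F y + H y) x = dmx k F x + dmx k H x.
Proof.
move=> sF sH Ux; apply/matrixP => i j; rewrite !mxE -partialD.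
- by congr partial; apply/funext => y; rewrite mxE.
- exact: smooth_derivable (sF i j) Ux.
- exact: smooth_derivable (sH i j) Ux.
Qed.

Lemma dmxN p q k (F : 'rV[R]_n -> 'M[R]_(p, q)) x : smx F -> U x ->
  dmx k (fun y => - F y) x = - dmx k F x.
Proof.
move=> sF Ux; apply/matrixP => i j; rewrite !mxE -partialN.
- by congr partial; apply/funext => y; rewrite mxE.
- exact: smooth_derivable (sF i j) Ux.
Qed.

Lemma dmxB p q k (F H : 'rV[R]_n -> 'M[R]_(p, q)) x : smx F -> smx H -> U x ->
  dmx k (fun y => F y - H y) x = dmx k F x - dmx k H x.
Proof. by move=> sF sH Ux; rewrite dmxD ?dmxN //; exact: smxN. Qed.

Lemma dmxT p q k (F : 'rV[R]_n -> 'M[R]_(p, q)) x :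
  dmx k (fun y => (F y)^T) x = (dmx k F x)^T.
Proof.
apply/matrixP => i j; rewrite !mxE.
by congr partial; apply/funext => y; rewrite mxE.
Qed.

Lemma dmxM p q r k (F : 'rV[R]_n -> 'M[R]_(p, q)) (H : 'rV[R]_n -> 'M[R]_(q, r)) x :
  smx F -> smx H -> U x ->
  dmx k (fun y => F y *m H y) x = dmx k F x *m H x + F x *m dmx k H x.
Proof.
move=> sF sH Ux; apply/matrixP => i j; rewrite !mxE -big_split /=.
have -> : (fun y => (F y *m H y) i j) = (fun y => \sum_l F y i l * H y l j).
  by apply/funext => y; rewrite mxE.
rewrite partial_sum.
  apply: eq_bigr => l _; rewrite !mxE partialM //.
  - exact: smooth_derivable (sF i l) Ux.
  - exact: smooth_derivable (sH l j) Ux.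
move=> l; apply: (@derivableM R _ (fun y => F y i l) (fun y => H y l j)).
- exact: smooth_derivable (sF i l) Ux.
- exact: smooth_derivable (sH l j) Ux.
Qed.

Lemma partial_tr p k (F : 'rV[R]_n -> 'M[R]_p) x : smx F -> U x ->
  partial k (fun y => \tr (F y)) x = \tr (dmx k F x).
Proof.
move=> sF Ux; rewrite /mxtrace partial_sum; last first.
  by move=> i; exact: smooth_derivable (sF i i) Ux.
by apply: eq_bigr => i _; rewrite mxE.
Qed.

Lemma smooth_tr p (F : 'rV[R]_n -> 'M[R]_p) : smx F -> smooth_on U (fun y => \tr (F y)).
Proof. by move=> sF; apply: smooth_sum => // i. Qed.

Lemma smooth_det p (F : 'rV[R]_n -> 'M[R]_p) : smx F -> smooth_on U (fun y => \det (F y)).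
Proof.
move=> sF; apply: smooth_sum => // s; apply: smoothM => //; first exact: smooth_cst.
by apply: smooth_prod => // i.
Qed.

Lemma smx_inv p (F : 'rV[R]_n -> 'M[R]_p) : (forall x, U x -> F x \in unitmx) ->
  smx F -> smx (fun y => invmx (F y)).
Proof.
move=> uF sF.
have sA : smx (fun y => (\det (F y))^-1 *: \adj (F y)).
  move=> i j; have -> : (fun y => ((\det (F y))^-1 *: \adj (F y)) i j) =
     (fun y => (\det (F y))^-1 * ((-1) ^+ (j + i) * \det (row' j (col' i (F y))))).
    by apply/funext => y; rewrite !mxE.
  apply: smoothM => //.
    apply: smoothV => //; last exact: smooth_det.
    by move=> x Ux; rewrite -unitfE -unitmxE; exact: uF.
  apply: smoothM => //; first exact: smooth_cst.
  apply: smooth_det => a b; have -> : (fun y => row' j (col' i (F y)) a b) =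
     (fun y => F y (lift j a) (lift i b)) by apply/funext => y; rewrite !mxE.
  exact: sF.
by apply: smx_ext sA => x Ux; rewrite /invmx uF.
Qed.

Lemma dmx_cst p q k (C : 'M[R]_(p, q)) x : dmx k (fun=> C) x = 0.
Proof. by apply/matrixP => i j; rewrite !mxE partial_cst. Qed.

End MatrixCalculus.

Lemma addmxE (R : zmodType) p q (A B : 'M[R]_(p, q)) i j : (A + B) i j = A i j + B i j.
Proof. by rewrite mxE. Qed.
Lemma oppmxE (R : zmodType) p q (A : 'M[R]_(p, q)) i j : (- A) i j = - A i j.
Proof. by rewrite mxE. Qed.

Lemma dmxE (R : realType) n p q k (F : 'rV[R]_n -> 'M[R]_(p, q)) x i j :
  dmx k F x i j = partial k (fun y => F y i j) x.
Proof. by rewrite mxE. Qed.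

(** * Noncommutative identities behind the symmetries of the curvature *)

Section MatrixAlgebra.
Context {R : comRingType} {n : nat}.
Implicit Types A B C P Q g X Y : 'M[R]_n.

Let tD A B : (A + B)^T = A^T + B^T. Proof. exact: linearD. Qed.
Let tN A : (- A)^T = - A^T. Proof. exact: linearN. Qed.

(** After complete distribution and left association, each product of matrices is a single atom, so
    that an identity between noncommuting matrices becomes an additive one between entries. *)
Ltac mxring :=
  rewrite ?(tD, tN, trmx_mul);
  rewrite ?(mulmxDl, mulmxDr, mulmxN, mulNmx, mulmxA);
  apply/matrixP => ? ?; rewrite ?(addmxE, oppmxE); ring.

Lemma curv_skew_alg P Q A B g :
  (P - Q + (A *m B - B *m A)) *m g + g *m (P - Q + (A *m B - B *m A))^T =
  (P *m g - B *m (A *m g + g *m A^T) - (A *m g + g *m A^T) *m B^T + g *m P^T)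
  - (Q *m g - A *m (B *m g + g *m B^T) - (B *m g + g *m B^T) *m A^T + g *m Q^T).
Proof. mxring. Qed.

Lemma Dcurv_skew_alg X C A g :
  (X + A *m C - C *m A) *m g + g *m (X + A *m C - C *m A)^T =
  (X *m g + C *m - (A *m g + g *m A^T) + (- (A *m g + g *m A^T) *m C^T + g *m X^T))
  + (C *m g + g *m C^T) *m A^T + A *m (C *m g + g *m C^T).
Proof. mxring. Qed.

Lemma Bianchi_alg (A B C p q r ab ac ba bc ca cb : 'M[R]_n) :
  (p - q + (ab *m C + B *m ac - (ac *m B + C *m ab))
    + A *m (bc - cb + (B *m C - C *m B)) - (bc - cb + (B *m C - C *m B)) *m A)
  + (r - p + (bc *m A + C *m ba - (ba *m C + A *m bc))
    + B *m (ca - ac + (C *m A - A *m C)) - (ca - ac + (C *m A - A *m C)) *m B)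
  + (q - r + (ca *m B + A *m cb - (cb *m A + B *m ca))
    + C *m (ab - ba + (A *m B - B *m A)) - (ab - ba + (A *m B - B *m A)) *m C) = 0.
Proof.
rewrite ?(mulmxDl, mulmxDr, mulmxN, mulNmx, mulmxA).
apply/matrixP => a b; rewrite [RHS]mxE ?(addmxE, oppmxE); ring.
Qed.

Lemma trace_nab_alg A g F X :
  \tr (- (A *m g + g *m A^T) *m F + g *m X) = \tr (g *m (X - A^T *m F - F *m A)).
Proof.
have trB B C : \tr (B - C) = \tr B - \tr C by rewrite raddfB.
rewrite mulNmx mulmxDl !mulmxBr addrC -mulmxA !trB raddfD /=.
rewrite (mxtrace_mulC A) !mulmxA; ring.
Qed.

Lemma skewD g X Y : X *m g + g *m X^T = 0 -> Y *m g + g *m Y^T = 0 ->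
  (X + Y) *m g + g *m (X + Y)^T = 0.
Proof. by move=> E1 E2; rewrite tD mulmxDl mulmxDr addrACA E1 E2 addr0. Qed.

Lemma skewN g X : X *m g + g *m X^T = 0 -> (- X) *m g + g *m (- X)^T = 0.
Proof. by move=> E; rewrite tN mulNmx mulmxN -opprD E oppr0. Qed.

Lemma skew_lincomb (I : Type) (r : seq I) (c : I -> R) (X : I -> 'M[R]_n) g :
  (forall i, X i *m g + g *m (X i)^T = 0) ->
  (\sum_(i <- r) c i *: X i) *m g + g *m (\sum_(i <- r) c i *: X i)^T = 0.
Proof.
move=> E; elim: r => [|i r IH]; first by rewrite big_nil mul0mx trmx0 mulmx0 addr0.
rewrite big_cons; apply: skewD IH.
have -> : (c i *: X i)^T = c i *: (X i)^T by apply/matrixP => a b; rewrite !mxE.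
by rewrite -scalemxAl -scalemxAr -scalerDr E scaler0.
Qed.

End MatrixAlgebra.

(** * The Levi-Civita connection and its curvature *)

Section Levi_Civita.
Context {R : realType} {n : nat}.
Variables (U : set 'rV[R]_n) (G : 'rV[R]_n -> 'M[R]_n).
Hypothesis oU : open U.
Hypothesis sG : smx U G.
Hypothesis symG : forall x, U x -> (G x)^T = G x.
Hypothesis uG : forall x, U x -> G x \in unitmx.
Implicit Types (x : 'rV[R]_n) (i j k l : 'I_n).

Definition Ginv x := invmx (G x).
(* The matrix of the connection along d_k in the coordinate frame; the curvature endomorphism
   R(d_i, d_j) is then d_i A_j - d_j A_i + [A_i, A_j] with A = cmx. *)
Definition cmx k x : 'M[R]_n := \matrix_(l, j) christoffel G l k j x.

Lemma smooth_Ginv : smx U Ginv.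
Proof. exact: smx_inv. Qed.

Lemma GinvT x : U x -> (Ginv x)^T = Ginv x.
Proof. by move=> Ux; rewrite /Ginv trmx_inv symG. Qed.

Lemma partial_Gsym k i j x : U x ->
  partial k (fun y => G y i j) x = partial k (fun y => G y j i) x.
Proof.
move=> Ux; apply: partial_near; apply: (open_near oU Ux) => y Uy.
by rewrite -{1}(symG Uy) mxE.
Qed.

Lemma christoffelC l i j x : U x -> christoffel G l i j x = christoffel G l j i x.
Proof.
move=> Ux; congr (_ * _); apply: eq_bigr => p _.
by rewrite (partial_Gsym p i j Ux) [X in _ * (X - _)]addrC.
Qed.

Lemma smooth_cmx k : smx U (cmx k).
Proof.
move=> l j; have -> : (fun y => cmx k y l j) = christoffel G l k j.
  by apply/funext => y; rewrite mxE.
apply: smoothM oU _ _; first exact: smooth_cst.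
apply: smooth_sum oU _ => p; apply: smoothM oU (smooth_Ginv l p) _.
by apply: smoothB oU (smoothD oU _ _) _; apply: smooth_partial.
Qed.

Lemma G_cmx k x i j : U x -> (G x *m cmx k x) i j =
  2^-1 * (partial k (fun y => G y j i) x + partial j (fun y => G y k i) x
     - partial i (fun y => G y k j) x).
Proof.
move=> Ux; pose b : 'cV[R]_n := \col_l (partial k (fun y => G y j l) x
  + partial j (fun y => G y k l) x - partial l (fun y => G y k j) x).
have -> : (G x *m cmx k x) i j = (G x *m (2^-1 *: (invmx (G x) *m b))) i 0.
  rewrite !mxE; apply: eq_bigr => l _; rewrite !mxE; congr (_ * (_ * _)).
  by apply: eq_bigr => p _; rewrite mxE.
by rewrite -scalemxAr mulKVmx ?uG // !mxE.
Qed.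

Lemma dG k x : U x -> dmx k G x = (cmx k x)^T *m G x + G x *m cmx k x.
Proof.
move=> Ux; have -> : (cmx k x)^T *m G x = (G x *m cmx k x)^T by rewrite trmx_mul symG.
apply/matrixP => i j; rewrite addmxE [X in _ = X + _]mxE !G_cmx // mxE.
rewrite (partial_Gsym k j i Ux).
move: (partial k _ _) (partial j _ _) (partial i _ _) => a b c; lra.
Qed.

(** Compatibility of the connection with the metric ([dG]), carried over to the inverse metric by
    differentiating [G *m Ginv = 1]. *)
Lemma dGinv k x : U x -> dmx k Ginv x = - (cmx k x *m Ginv x + Ginv x *m (cmx k x)^T).
Proof.
move=> Ux.
have E : dmx k (fun y => G y *m Ginv y) x = 0.
  rewrite (@dmx_ext R n U oU _ _ k _ (fun=> 1%:M)) ?dmx_cst // => y Uy.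
  by rewrite mulmxV ?uG.
move: E; rewrite (dmxM k sG smooth_Ginv Ux) dG // => /eqP; rewrite addrC addr_eq0 => /eqP E.
have := congr1 (mulmx (Ginv x)) E; rewrite mulKmx ?uG // => ->.
rewrite mulmxN mulmxDl mulmxDr; congr (- _).
by rewrite addrC -!mulmxA mulmxV ?uG // mulmx1 mulKmx ?uG.
Qed.

Definition curv i j x : 'M[R]_n :=
  dmx i (cmx j) x - dmx j (cmx i) x + (cmx i x *m cmx j x - cmx j x *m cmx i x).

Lemma curvE l k i j x : curv i j x l k = riemann G l k i j x.
Proof.
have Ed a b : dmx a (cmx b) x l k = partial a (christoffel G l b k) x.
  by rewrite dmxE; apply: eq_partial => y; rewrite mxE.
have Em a b : (cmx a x *m cmx b x) l k =
    \sum_p christoffel G l a p x * christoffel G p b k x.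
  by rewrite mxE; apply: eq_bigr => p _; rewrite [cmx a x l p]mxE [cmx b x p k]mxE.
rewrite /curv addmxE.
rewrite [X in X + _ = _]addmxE [X in _ + X = _]addmxE.
rewrite !oppmxE.
rewrite /riemann sumrB.
congr (_ - _ + (_ - _)).
exact: Ed.
exact: Ed.
exact: Em.
exact: Em.
Qed.

Lemma curvN i j x : curv j i x = - curv i j x.
Proof. by rewrite /curv opprD !opprB. Qed.

Lemma smooth_curv i j : smx U (curv i j).
Proof.
have sd a b := smx_dmx a (smooth_cmx b).
have sm a b := smxM oU (smooth_cmx a) (smooth_cmx b).
exact: (smxD oU (smxB oU (sd i j) (sd j i)) (smxB oU (sm i j) (sm j i))).
Qed.

Lemma ddC p q (F : 'rV[R]_n -> 'M[R]_(p, q)) i j x : smx U F -> U x ->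
  dmx i (dmx j F) x = dmx j (dmx i F) x.
Proof.
move=> sF Ux.
apply/matrixP => a b.
have E k : (fun y => dmx k F y a b) = partial k (fun y => F y a b).
  by apply/funext => y; rewrite dmxE.
have C := clairaut i j oU (sF a b) Ux.
rewrite -(E i) in C.
rewrite -(E j) in C.
rewrite -[LHS](dmxE i) in C.
by rewrite -[RHS](dmxE j) in C.
Qed.

(** The inverse metric is parallel, so the curvature, a commutator of covariant derivatives,
    annihilates it. Concretely, the second derivatives of [Ginv] commute, and expanding them by
    [dGinv] leaves exactly the curvature terms. *)
Lemma curv_skew i j x : U x ->
  curv i j x *m Ginv x + Ginv x *m (curv i j x)^T = 0.
Proof.
move=> Ux.
have dd a b : dmx a (dmx b Ginv) x = - (dmx a (cmx b) x *m Ginv x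
    - cmx b x *m (cmx a x *m Ginv x + Ginv x *m (cmx a x)^T)
    - (cmx a x *m Ginv x + Ginv x *m (cmx a x)^T) *m (cmx b x)^T
    + Ginv x *m (dmx a (cmx b) x)^T).
  rewrite (@dmx_ext R n U oU _ _ a _ (fun y => - (cmx b y *m Ginv y + Ginv y *m (cmx b y)^T))) //;
    last by move=> y Uy; exact: dGinv.
  have s1 := smxM oU (smooth_cmx b) smooth_Ginv.
  have s2 := smxM oU smooth_Ginv (smxT (smooth_cmx b)).
  rewrite (dmxN a (smxD oU s1 s2) Ux) (dmxD a s1 s2 Ux).
  rewrite (dmxM a (smooth_cmx b) smooth_Ginv Ux) (dmxM a smooth_Ginv (smxT (smooth_cmx b)) Ux).
  by rewrite dmxT dGinv // mulmxN mulNmx; congr (- _); rewrite !addrA.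
have := ddC i j smooth_Ginv Ux; rewrite (dd i j) (dd j i) => /oppr_inj /eqP.
by rewrite -subr_eq0 => /eqP E; rewrite -[RHS]E; exact: curv_skew_alg.
Qed.

Definition Dcurv e i j x := dmx e (curv i j) x + cmx e x *m curv i j x - curv i j x *m cmx e x.

Lemma Dcurv_skew e i j x : U x ->
  Dcurv e i j x *m Ginv x + Ginv x *m (Dcurv e i j x)^T = 0.
Proof.
move=> Ux.
have E : dmx e (fun y => curv i j y *m Ginv y + Ginv y *m (curv i j y)^T) x = 0.
  by rewrite (@dmx_ext R n U oU _ _ e _ (fun=> 0)) ?dmx_cst // => y Uy; exact: curv_skew.
have sc := smooth_curv i j; have sg := smooth_Ginv.
move: E; rewrite (dmxD e (smxM oU sc sg) (smxM oU sg (smxT sc)) Ux).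
rewrite (dmxM e sc sg Ux) (dmxM e sg (smxT sc) Ux) dmxT dGinv // => E.
have K := curv_skew i j Ux.
have := Dcurv_skew_alg (dmx e (curv i j) x) (curv i j x) (cmx e x) (Ginv x).
by rewrite K E mul0mx mulmx0 !addr0.
Qed.

(** This is the structural identity dF + [A, F] = 0 for the curvature F = dA + A ^ A of a
    matrix-valued one-form. It is free of Christoffel corrections in the form indices, which would
    cancel in the cyclic sum. *)
Lemma Bianchi e i j x : U x -> Dcurv e i j x + Dcurv i j e x + Dcurv j e i x = 0.
Proof.
move=> Ux.
have dc a b c X Y : dmx a (dmx b (cmx c)) x = X -> dmx a (dmx c (cmx b)) x = Y ->
   dmx a (curv b c) x = X - Y
   + (dmx a (cmx b) x *m cmx c x + cmx b x *m dmx a (cmx c) x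
      - (dmx a (cmx c) x *m cmx b x + cmx c x *m dmx a (cmx b) x)).
  move=> <- <-; have s p q := smxM oU (smooth_cmx p) (smooth_cmx q).
  have sd p q := smx_dmx p (smooth_cmx q).
  rewrite (dmxD a (smxB oU (sd b c) (sd c b)) (smxB oU (s b c) (s c b)) Ux).
  rewrite (dmxB oU a (sd b c) (sd c b) Ux) (dmxB oU a (s b c) (s c b) Ux).
  by rewrite (dmxM a (smooth_cmx b) (smooth_cmx c) Ux) (dmxM a (smooth_cmx c) (smooth_cmx b) Ux).
(* The six second derivatives of the connection are equal in pairs; here they are expressed by three
   of them, as [Bianchi_alg] requires. *)
have E1 := dc e i j _ _ erefl erefl.
have E2 := dc i j e _ _ erefl (ddC i e (smooth_cmx j) Ux).
have E3 := dc j e i _ _ (ddC j e (smooth_cmx i) Ux) (ddC j i (smooth_cmx e) Ux).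
rewrite /Dcurv E1 E2 E3.
exact: Bianchi_alg.
Qed.

End Levi_Civita.

(** * The contracted Bianchi identity *)

Section ContractAlg.
Context {R : realType} {n : nat}.
Variables (g : 'M[R]_n) (F : 'I_n -> 'I_n -> 'I_n -> 'M[R]_n) (N : 'I_n -> 'M[R]_n).
Hypothesis gs : forall i j, g i j = g j i.

Lemma trace_sym_mul (M : 'M[R]_n) : \tr (g *m M) = \sum_i \sum_k g i k * M i k.
Proof.
rewrite /mxtrace; transitivity (\sum_k \sum_i g k i * M i k).
  by apply: eq_bigr => k _; rewrite mxE.
by rewrite exchange_big /=; apply: eq_bigr => k _; apply: eq_bigr => i _; rewrite gs.
Qed.

Hypothesis FN : forall e i j, F e j i = - F e i j.
Hypothesis FB : forall e i j, F e i j + F i j e + F j e i = 0.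
Hypothesis Fskew : forall e i j, F e i j *m g + g *m (F e i j)^T = 0.
Hypothesis Ftr : forall i j k, \sum_l F j l i l k = N j i k.

(** Here [F e i j] plays the covariant derivative of the curvature and [N j] that of Ric. One trace
    of the Bianchi identity expresses the divergence of the curvature by derivatives of Ric ([B]).
    In the second trace, taken with [g], skew symmetry turns this divergence into a further
    divergence of Ric ([E1]), whence the factor 2. *)
Lemma contract_alg j :
  \sum_i \sum_k g i k * N j i k = 2 * \sum_l \sum_k g l k * N l j k.
Proof.
have B i k : \sum_l F l i j l k - N i j k + N j i k = 0.
  rewrite -(Ftr i j k) -(Ftr j i k) -sumrB -big_split /= big1 // => l _.
  have := congr1 (fun M : 'M[R]_n => M l k) (FB l i j).
  by rewrite (FN i l j) !addmxE oppmxE [RHS]mxE.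
set D := \sum_l \sum_k g l k * N l j k.
have E1 : \sum_i \sum_k g i k * (\sum_l F l i j l k) = - D.
  have E i l : \sum_k g i k * F l i j l k = - \sum_k g l k * F l i j i k.
    have := congr1 (fun M : 'M[R]_n => M l i) (Fskew l i j).
    rewrite addmxE [RHS]mxE => /eqP; rewrite addr_eq0 => /eqP H.
    transitivity ((F l i j *m g) l i).
      by rewrite mxE; apply: eq_bigr => k _; rewrite mulrC (gs i k).
    by rewrite H mxE; congr (- _); apply: eq_bigr => k _; rewrite [_^T k i]mxE.
  transitivity (\sum_i \sum_l \sum_k g i k * F l i j l k).
    apply: eq_bigr => i _; rewrite exchange_big /=; apply: eq_bigr => k _.
    by rewrite mulr_sumr.
  rewrite exchange_big /= /D -sumrN; apply: eq_bigr => l _.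
  under eq_bigr do rewrite E.
  rewrite sumrN exchange_big /=; congr (- _); apply: eq_bigr => k _.
  by rewrite -mulr_sumr (Ftr j l k).
have : \sum_i \sum_k g i k * (\sum_l F l i j l k - N i j k + N j i k) = 0.
  by rewrite big1 // => i _; rewrite big1 // => k _; rewrite B mulr0.
have -> : \sum_i \sum_k g i k * (\sum_l F l i j l k - N i j k + N j i k)
   = - D - D + \sum_i \sum_k g i k * N j i k.
  rewrite -{1}E1 /D -sumrB -big_split /=; apply: eq_bigr => i _.
  by rewrite -sumrB -big_split /=; apply: eq_bigr => k _; ring.
by clear E1; move: (\sum_i _) D => a b E; lra.
Qed.

End ContractAlg.

Section Contraction.
Context {R : realType} {n : nat}.
Variables (U : set 'rV[R]_n) (G : 'rV[R]_n -> 'M[R]_n).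
Hypothesis oU : open U.
Hypothesis sG : smx U G.
Hypothesis symG : forall x, U x -> (G x)^T = G x.
Hypothesis uG : forall x, U x -> G x \in unitmx.
Implicit Types (x : 'rV[R]_n) (i j k l e : 'I_n).

Local Notation Ginv := (Ginv G).
Local Notation A := (cmx G).
Local Notation Rm := (curv G).

Definition ric x : 'M[R]_n := \matrix_(i, j) ricci G i j x.

Lemma ricE x i j : ric x i j = \sum_l Rm l i x l j.
Proof. by rewrite mxE; apply: eq_bigr => l _; rewrite curvE. Qed.

(** The covariant derivative of a tensor of type (0,2) along d_e. *)
Definition nab (F : 'rV[R]_n -> 'M[R]_n) e x : 'M[R]_n :=
  dmx e F x - (A e x)^T *m F x - F x *m A e x.

Lemma partial_trace F i x : smx U F -> U x ->
  partial i (fun y => \tr (Ginv y *m F y)) x = \tr (Ginv x *m nab F i x).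
Proof.
move=> sF Ux; have sg := smooth_Ginv oU sG uG.
rewrite (partial_tr i (smxM oU sg sF) Ux) (dmxM i sg sF Ux) (dGinv oU sG symG uG i Ux) /nab.
exact: trace_nab_alg.
Qed.

(* [Dcurv] is covariant in the endomorphism indices only; the two sums correct the form indices. *)
Definition nab_curv e i j x : 'M[R]_n := Dcurv G e i j x
  - \sum_p christoffel G p e i x *: Rm p j x
  - \sum_p christoffel G p e j x *: Rm i p x.

Let T a b c x : 'M[R]_n := \sum_p christoffel G p a b x *: Rm p c x.

Let TC a b c x : U x -> T a b c x = T b a c x.
Proof.
move=> Ux; rewrite /T; apply: eq_bigr => p _.
by rewrite (christoffelC oU symG p a b Ux).
Qed.

Let TN a b c x : \sum_p christoffel G p a b x *: Rm c p x = - T a b c x.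
Proof.
rewrite /T -sumrN; apply: eq_bigr => p _.
by rewrite (curvN G p c x) scalerN.
Qed.

Lemma DcurvN e i j x : U x -> Dcurv G e j i x = - Dcurv G e i j x.
Proof.
move=> Ux; have E : Rm j i = (fun y => - Rm i j y) by apply/funext => y; exact: (curvN G i j y).
rewrite /Dcurv E.
rewrite (dmxN e (smooth_curv oU sG uG i j) Ux) mulmxN mulNmx.
by rewrite !opprD !opprK.
Qed.

Lemma nab_curvE e i j x : nab_curv e i j x = Dcurv G e i j x - T e i j x + T e j i x.
Proof.
rewrite -[T e j i x]opprK.
exact: (congr1 (fun M => Dcurv G e i j x - T e i j x - M) (TN e j i x)).
Qed.

Lemma nab_curvN e i j x : U x -> nab_curv e j i x = - nab_curv e i j x.
Proof.
move=> Ux; rewrite (nab_curvE e j i) (nab_curvE e i j) (DcurvN e i j Ux).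
move: (Dcurv _ _ _ _ _) (T e i j x) (T e j i x) => D P Q.
by rewrite !opprD opprK addrAC.
Qed.

Lemma nab_curv_Bianchi e i j x : U x -> nab_curv e i j x + nab_curv i j e x + nab_curv j e i x = 0.
Proof.
move=> Ux; rewrite -[RHS](Bianchi oU sG uG e i j Ux).
rewrite (nab_curvE e i j) (nab_curvE i j e) (nab_curvE j e i).
rewrite (TC i e j Ux) (TC j i e Ux) (TC j e i Ux).
move: (Dcurv G e i j x) (Dcurv G i j e x) (Dcurv G j e i x) => D1 D2 D3.
move: (T e i j x) (T e j i x) (T i j e x) => P Q S.
apply/matrixP => a b; rewrite ?(addmxE, oppmxE); ring.
Qed.

Lemma nab_curv_skew e i j x : U x ->
  nab_curv e i j x *m Ginv x + Ginv x *m (nab_curv e i j x)^T = 0.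
Proof.
move=> Ux; have cs a b := curv_skew oU sG symG uG a b Ux.
apply: skewD; last by apply: skewN; apply: skew_lincomb => p; exact: cs.
apply: skewD; last by apply: skewN; apply: skew_lincomb => p; exact: cs.
exact: (Dcurv_skew oU sG symG uG e i j Ux).
Qed.

Lemma smooth_ric : smx U ric.
Proof.
move=> i j; have -> : (fun y => ric y i j) = (fun y => \sum_l Rm l i y l j).
  by apply/funext => y; rewrite ricE.
by apply: smooth_sum oU _ => l; exact: (smooth_curv oU sG uG l i l j).
Qed.

(** Traces commute with covariant differentiation: by [E2], the correction of the upper index
    cancels that of the form index with which it is traced. *)
Lemma nab_curv_trace i j k x : U x -> \sum_l nab_curv j l i x l k = nab ric j x i k.
Proof.
move=> Ux.
have E1 : dmx j ric x i k = \sum_l dmx j (Rm l i) x l k.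
  rewrite dmxE.
  transitivity (partial j (fun y => \sum_l Rm l i y l k) x).
    by apply: eq_partial => y; rewrite ricE.
  rewrite partial_sum; first by apply: eq_bigr => l _; rewrite dmxE.
  by move=> l; exact: smooth_derivable (smooth_curv oU sG uG l i l k) Ux.
have E2 : \sum_l (\sum_p christoffel G p j l x *: Rm p i x) l k =
          \sum_l (A j x *m Rm l i x) l k.
  under eq_bigr do rewrite summxE; under [RHS]eq_bigr do rewrite mxE.
  rewrite exchange_big /=; apply: eq_bigr => p _; apply: eq_bigr => l _.
  by rewrite mxE [A j x p l]mxE.
have E3 : \sum_l (Rm l i x *m A j x) l k = (ric x *m A j x) i k.
  under eq_bigr do rewrite mxE; rewrite exchange_big /= mxE; apply: eq_bigr => q _.
  by rewrite ricE mulr_suml.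
have E4 : \sum_l (\sum_p christoffel G p j i x *: Rm l p x) l k = ((A j x)^T *m ric x) i k.
  under eq_bigr do rewrite summxE; rewrite exchange_big /= mxE; apply: eq_bigr => p _.
  rewrite ricE mulr_sumr; apply: eq_bigr => l _.
  by rewrite mxE [(A j x)^T i p]mxE [A j x p i]mxE.
have F5 (X Y Z P Q : 'M[R]_n) a b :
    (X + Y - Z - P - Q) a b = X a b + Y a b - Z a b - P a b - Q a b.
  by rewrite !(addmxE, oppmxE).
have F3 (X Y Z : 'M[R]_n) a b : (X - Y - Z) a b = X a b - Y a b - Z a b.
  by rewrite !(addmxE, oppmxE).
have F6 (a b c d e : 'I_n -> R) : \sum_l (a l + b l - c l - d l - e l) =
    \sum_l a l + \sum_l b l - \sum_l c l - \sum_l d l - \sum_l e l.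
  by rewrite !sumrB big_split.
transitivity (\sum_l (dmx j (Rm l i) x l k + (A j x *m Rm l i x) l k - (Rm l i x *m A j x) l k
    - (\sum_p christoffel G p j l x *: Rm p i x) l k
    - (\sum_p christoffel G p j i x *: Rm l p x) l k)).
  by apply: eq_bigr => l _; exact: F5.
apply: (etrans (F6 _ _ _ _ _)); rewrite [RHS]F3.
have alg (a b c d e p q s : R) : p = a -> d = b -> c = s -> e = q ->
  a + b - c - d - e = p - q - s by move=> -> -> -> ->; ring.
exact: (alg _ _ _ _ _ _ _ _ E1 E2 E3 E4).
Qed.

Definition divg F i x : R := \sum_j \sum_k Ginv x j k * nab F j x i k.

Lemma contracted_Bianchi j x : U x ->
  partial j (fun y => \tr (Ginv y *m ric y)) x = 2 * divg ric j x.
Proof.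
move=> Ux; rewrite (partial_trace j smooth_ric Ux).
rewrite /divg.
have gs a b : Ginv x a b = Ginv x b a by rewrite -{1}(GinvT symG Ux) mxE.
have C := @contract_alg R n (Ginv x) (fun e i j => nab_curv e i j x) (fun j => nab ric j x) gs
  (fun e i j => nab_curvN e i j Ux) (fun e i j => nab_curv_Bianchi e i j Ux)
  (fun e i j => nab_curv_skew e i j Ux) (fun i j k => nab_curv_trace i j k Ux) j.
by rewrite -C; exact: trace_sym_mul.
Qed.

End Contraction.

(** * The Hessian, its divergence, and the derivatives of the gradient norm *)

Section HessianAlgebra.
Context {R : comRingType} {n : nat}.
Implicit Types A B C P Q g X Y : 'M[R]_n.
Implicit Types v h : 'cV[R]_n.

Lemma commutation_alg (d hi hj v : 'cV[R]_n) A B P Q :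
  d - P^T *m v - A^T *m (hj + B^T *m v) - B^T *m hi
  - (d - Q^T *m v - B^T *m (hi + A^T *m v) - A^T *m hj) =
  (Q - P + (A *m B - B *m A))^T *m v.
Proof.
have tD X Y : (X + Y)^T = X^T + Y^T by exact: linearD.
have tN X : (- X)^T = - X^T by exact: linearN.
rewrite ?(tD, tN, trmx_mul) ?(mulmxDl, mulmxDr, mulmxN, mulNmx, mulmxA).
apply/matrixP => ? ?; rewrite ?(addmxE, oppmxE); ring.
Qed.

Lemma gradsq_alg A g (h v : 'cV[R]_n) : g^T = g ->
  (((h + A^T *m v)^T *m g + v^T *m - (A *m g + g *m A^T)) *m v
   + v^T *m g *m (h + A^T *m v)) 0 0 = 2 * (h^T *m g *m v) 0 0.
Proof.
move=> gs; have E : (v^T *m g *m h) 0 0 = (h^T *m g *m v) 0 0.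
  have -> : v^T *m g *m h = (h^T *m g *m v)^T by rewrite !trmx_mul trmxK gs mulmxA.
  by rewrite mxE.
have tD (x y : 'cV[R]_n) : (x + y)^T = x^T + y^T by exact: linearD.
rewrite tD trmx_mul trmxK ?(mulmxDl, mulmxDr, mulmxN, mulNmx, mulmxA).
rewrite ?(addmxE, oppmxE) E; ring.
Qed.

Lemma bochner_alg A H N g (h v : 'cV[R]_n) :
  ((N + A^T *m H + H *m A) *m g + H *m - (A *m g + g *m A^T)) *m v
    + H *m g *m (h + A^T *m v) =
  N *m g *m v + A^T *m (H *m g *m v) + H *m g *m h.
Proof.
rewrite ?(mulmxDl, mulmxDr, mulmxN, mulNmx, mulmxA).
apply/matrixP => ? ?; rewrite ?(addmxE, oppmxE); ring.
Qed.

Lemma skew_trace_alg (C : 'I_n -> 'M[R]_n) g (v : 'cV[R]_n) :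
  (forall i j, g i j = g j i) ->
  (forall j, C j *m g + g *m (C j)^T = 0) ->
  \sum_j \sum_k g j k * ((C j)^T *m v) k 0 =
  - \sum_j \sum_q C j j q * (g *m v) q 0.
Proof.
move=> gs sk; rewrite -sumrN; apply: eq_bigr => j _.
transitivity ((g *m ((C j)^T *m v)) j 0); first by rewrite mxE.
rewrite mulmxA; have /eqP := sk j; rewrite addrC addr_eq0 => /eqP ->.
by rewrite mulNmx oppmxE -mulmxA mxE.
Qed.

End HessianAlgebra.

Section Hessian.
Context {R : realType} {n : nat}.
Variables (U : set 'rV[R]_n) (G : 'rV[R]_n -> 'M[R]_n) (u : 'rV[R]_n -> R).
Hypothesis oU : open U.
Hypothesis sG : smx U G.
Hypothesis symG : forall x, U x -> (G x)^T = G x.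
Hypothesis uG : forall x, U x -> G x \in unitmx.
Hypothesis su : smooth_on U u.
Implicit Types (x : 'rV[R]_n) (i j k l e : 'I_n).

Local Notation Ginv := (Ginv G).
Local Notation A := (cmx G).
Local Notation Rm := (curv G).

Definition du x : 'cV[R]_n := \col_k partial k u x.
Definition hes x : 'M[R]_n := \matrix_(i, j) hessian G u i j x.
(** The covariant derivative of the one-form du along d_i: a row of the Hessian, kept as a column so
    that the matrix calculus applies to it. *)
Definition hrow i x : 'cV[R]_n := dmx i du x - (A i x)^T *m du x.
Definition lap x : R := \tr (Ginv x *m hes x).
Definition gradsq x : R := ((du x)^T *m Ginv x *m du x) 0 0.
Definition hgrad x : 'cV[R]_n := hes x *m Ginv x *m du x.

Lemma smooth_du : smx U du.
Proof.
move=> i j; have -> : (fun y => du y i j) = partial i u by apply/funext => y; rewrite mxE.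
exact: smooth_partial su.
Qed.

Lemma hesE x i k : hes x i k = hrow i x k 0.
Proof.
rewrite /hrow addmxE oppmxE dmxE [LHS]mxE; congr (_ - _).
  by apply: eq_partial => y; rewrite mxE.
by rewrite mxE; apply: eq_bigr => p _; rewrite [_^T _ _]mxE [A i x p k]mxE [du x p 0]mxE.
Qed.

Lemma smooth_hrow i : smx U (hrow i).
Proof.
exact: (smxB oU (smx_dmx i smooth_du) (smxM oU (smxT (smooth_cmx oU sG uG i)) smooth_du)).
Qed.

Lemma smooth_hes : smx U hes.
Proof.
move=> i k; have -> : (fun y => hes y i k) = (fun y => hrow i y k 0).
  by apply/funext => y; exact: hesE.
exact: (smooth_hrow i k 0).
Qed.

Lemma hes_sym x : U x -> (hes x)^T = hes x.
Proof.
move=> Ux; apply/matrixP => i j; rewrite mxE [hes x j i]mxE [hes x i j]mxE /hessian.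
rewrite (clairaut i j oU su Ux); congr (_ - _); apply: eq_bigr => k _.
by rewrite (christoffelC oU symG k i j Ux).
Qed.

Lemma d_du i x : dmx i du x = hrow i x + (A i x)^T *m du x.
Proof. by rewrite /hrow subrK. Qed.

Lemma hrowT i x : (hrow i x)^T = row i (hes x).
Proof. by apply/rowP => k; rewrite [RHS]mxE hesE mxE. Qed.

Lemma dhes j x i k : U x -> dmx j hes x i k =
  (dmx j (dmx i du) x - (dmx j (A i) x)^T *m du x
    - (A i x)^T *m (hrow j x + (A j x)^T *m du x)) k 0.
Proof.
move=> Ux; transitivity (dmx j (hrow i) x k 0).
  by rewrite !dmxE; apply: eq_partial => y; exact: hesE.
rewrite /hrow (dmxB oU j (smx_dmx i smooth_du) (smxM oU (smxT (smooth_cmx oU sG uG i)) smooth_du) Ux).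
rewrite (dmxM j (smxT (smooth_cmx oU sG uG i)) smooth_du Ux) dmxT -(d_du j x).
by rewrite opprD addrA.
Qed.

Lemma nab_hes_entry j x i k : U x -> nab G hes j x i k =
  (dmx j (dmx i du) x - (dmx j (A i) x)^T *m du x
    - (A i x)^T *m (hrow j x + (A j x)^T *m du x) - (A j x)^T *m hrow i x) k 0
  - \sum_p christoffel G p j i x * hes x p k.
Proof.
move=> Ux; have F3 (X Y Z : 'M[R]_n) a b : (X - Y - Z) a b = X a b - Y a b - Z a b.
  by rewrite ?(addmxE, oppmxE).
have FB (X Y : 'cV[R]_n) a b : (X - Y) a b = X a b - Y a b.
  by rewrite ?(addmxE, oppmxE).
apply: (etrans (F3 _ _ _ _ _)); rewrite (dhes j i k Ux) [in RHS]FB.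
have -> : ((A j x)^T *m hes x) i k = \sum_p christoffel G p j i x * hes x p k.
  by rewrite mxE; apply: eq_bigr => p _; rewrite [_^T _ _]mxE [A j x p i]mxE.
have -> : (hes x *m A j x) i k = ((A j x)^T *m hrow i x) k 0.
  by rewrite !mxE; apply: eq_bigr => p _; rewrite hesE mulrC [_^T _ _]mxE.
by rewrite addrAC.
Qed.

(** Exchanging two covariant derivatives of the one-form du costs a curvature term. The remaining
    correction, in the index of the first derivative, is symmetric because the connection is torsion
    free. *)
Lemma Ricci_identity i j k x : U x ->
  nab G hes j x i k = nab G hes i x j k + ((Rm i j x)^T *m du x) k 0.
Proof.
move=> Ux; apply: (etrans (nab_hes_entry j i k Ux)).
apply: (etrans _ (esym (congr1 (fun t => t + ((Rm i j x)^T *m du x) k 0)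
  (nab_hes_entry i j k Ux)))).
rewrite -(commutation_alg (dmx j (dmx i du) x) (hrow i x) (hrow j x) (du x) (A i x) (A j x)).
have -> : \sum_p christoffel G p j i x * hes x p k = \sum_p christoffel G p i j x * hes x p k.
  by apply: eq_bigr => p _; rewrite (christoffelC oU symG p j i Ux).
rewrite (ddC oU j i smooth_du Ux).
have alg (X Y : 'cV[R]_n) s : X k 0 - s = Y k 0 - s + (X - Y) k 0.
  by rewrite addmxE oppmxE; ring.
exact: alg.
Qed.

(** The contraction of [Ricci_identity]: the Hessian term becomes d (Lap u) since the inverse metric
    is parallel, and skew symmetry turns the curvature term into Ric (grad u). *)
Lemma div_hes i x : U x ->
  divg G hes i x = partial i lap x + (ric G x *m Ginv x *m du x) i 0.
Proof.
move=> Ux; rewrite /divg.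
have gs a b : Ginv x a b = Ginv x b a by rewrite -{1}(GinvT symG Ux) mxE.
transitivity (\sum_j \sum_k Ginv x j k * nab G hes i x j k
   + \sum_j \sum_k Ginv x j k * ((Rm i j x)^T *m du x) k 0).
  rewrite -big_split /=; apply: eq_bigr => j _; rewrite -big_split /=; apply: eq_bigr => k _.
  exact: (etrans (congr1 (fun t => Ginv x j k * t) (Ricci_identity i j k Ux)) (mulrDr _ _ _)).
congr (_ + _).
  rewrite -(trace_sym_mul gs); apply/esym; exact: (partial_trace oU sG symG uG i smooth_hes Ux).
rewrite (skew_trace_alg (du x) gs (fun j => curv_skew oU sG symG uG i j Ux)).
rewrite -mulmxA mxE exchange_big /= -sumrN; apply: eq_bigr => q _.
rewrite ricE -mulr_suml -mulNr -sumrN; congr (_ * _); apply: eq_bigr => j _.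
by rewrite (curvN G i j x) oppmxE.
Qed.

Lemma d_gradsq i x : U x -> partial i gradsq x = 2 * hgrad x i 0.
Proof.
move=> Ux; have sg := smooth_Ginv oU sG uG.
transitivity (dmx i (fun y => (du y)^T *m Ginv y *m du y) x 0 0); first by rewrite dmxE.
rewrite (dmxM i (smxM oU (smxT smooth_du) sg) smooth_du Ux) (dmxM i (smxT smooth_du) sg Ux) dmxT.
rewrite (dGinv oU sG symG uG i Ux) (d_du i x).
apply: (etrans (gradsq_alg (A i x) (hrow i x) (du x) (GinvT symG Ux))); congr (_ * _).
by rewrite hrowT /hgrad -!mulmxA -row_mul mxE.
Qed.

Lemma smooth_hgrad : smx U hgrad.
Proof. exact: (smxM oU (smxM oU smooth_hes (smooth_Ginv oU sG uG)) smooth_du). Qed.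

(** The product rule in covariant form. The term with [(A k x)^T] is a coordinate artefact; it
    disappears at critical points of |grad u|^2, where [hgrad] vanishes. *)
Lemma d_hgrad k x : U x -> dmx k hgrad x =
  nab G hes k x *m Ginv x *m du x + (A k x)^T *m hgrad x + hes x *m Ginv x *m hrow k x.
Proof.
move=> Ux; have sg := smooth_Ginv oU sG uG.
rewrite /hgrad (dmxM k (smxM oU smooth_hes sg) smooth_du Ux) (dmxM k smooth_hes sg Ux).
rewrite (dGinv oU sG symG uG k Ux) (d_du k x) -bochner_alg.
have -> : dmx k hes x = nab G hes k x + (A k x)^T *m hes x + hes x *m A k x.
  by rewrite /nab addrAC !subrK.
by [].
Qed.

End Hessian.

(** * Positive definite matrices and signs of traces *)

Section PosDef.
Context {R : realType}.

Definition posdef {n} (P : 'M[R]_n) : Prop :=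
  forall v : 'rV[R]_n, v != 0 -> 0 < (v *m P *m v^T) 0 0.

Lemma qformE n (P : 'M[R]_n) (v : 'rV[R]_n) :
  (v *m P *m v^T) 0 0 = \sum_i \sum_j P i j * v 0 i * v 0 j.
Proof.
rewrite mxE exchange_big /=; apply: eq_bigr => j _; rewrite mxE mulr_suml.
by apply: eq_bigr => i _; rewrite [_^T _ _]mxE; ring.
Qed.

Lemma posdef_unit n (P : 'M[R]_n) : posdef P -> P \in unitmx.
Proof.
move=> pP; rewrite -row_free_unit -kermx_eq0; apply/eqP/row_matrixP => i; rewrite row0.
apply/eqP; apply: contraT => /pP.
have -> : row i (kermx P) *m P = 0 by rewrite -row_mul mulmx_ker row0.
by rewrite mul0mx mxE ltxx.
Qed.

(** Induction on the size: splitting off the first row and column leaves the Schur complement [D'],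
    which is again positive definite. *)
Lemma posdef_factor n (P : 'M[R]_n) : P^T = P -> posdef P -> exists B : 'M[R]_n, P = B *m B^T.
Proof.
elim: n P => [|n IH] P sP pP; first by exists 0; apply/matrixP => -[].
rewrite -[n.+1]/(1 + n)%N in P sP pP *.
pose a := P 0 0; pose b : 'cV[R]_n := dlsubmx P; pose D := drsubmx P.
have tb : ursubmx P = b^T by rewrite /b trmx_dlsub sP.
have ta : ulsubmx P = a%:M.
  by apply/matrixP => i j; rewrite !ord1 !mxE mulr1n; congr (P _ _); apply: val_inj.
have EP : P = block_mx a%:M b^T b D by rewrite -ta -tb submxK.
have sD : D^T = D by rewrite /D trmx_drsub sP.
have qf (t : R) (w : 'rV[R]_n) : (row_mx t%:M w *m P *m (row_mx t%:M w)^T) 0 0 =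
    t * t * a + 2 * t * (w *m b) 0 0 + (w *m D *m w^T) 0 0.
  rewrite EP mul_row_block tr_row_mx mul_row_col !tr_scalar_mx !mul_mx_scalar.
  have -> : (t%:M : 'M[R]_1) *m b^T = t *: b^T by rewrite mul_scalar_mx.
  rewrite mulmxDl -scalemxAl !mxE.
  have -> : \sum_j b^T 0 j * w^T j 0 = \sum_j w 0 j * b j 0.
    by apply: eq_bigr => j _; rewrite !mxE mulrC.
  rewrite !mulr1n; ring.
have a0 : 0 < a.
  have /pP : row_mx (1%:M : 'M[R]_1) (0 : 'rV[R]_n) != 0.
    apply/eqP => /(congr1 (fun M => lsubmx M 0 0)); rewrite row_mxKl !mxE /= => /eqP.
    by rewrite oner_eq0.
  by rewrite qf !mul0mx !mxE; lra.
pose D' := D - a^-1 *: (b *m b^T).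
have sD' : D'^T = D'.
  by apply/matrixP => i j; rewrite /D' -{1}sD !mxE; congr (_ - _ * _);
    apply: eq_bigr => k _; rewrite !mxE mulrC.
have pD' : posdef D'.
  (* This [t] minimizes the quadratic form of [P] over its first variable; the minimum is the
     quadratic form of the Schur complement at [w]. *)
  move=> w w0; pose t := - (w *m b) 0 0 / a.
  have /pP : row_mx t%:M w != 0.
    by apply: contra w0 => /eqP /(congr1 rsubmx); rewrite row_mxKr linear0 => ->.
  have -> : (w *m D' *m w^T) 0 0 = (w *m D *m w^T) 0 0 - a^-1 * ((w *m b) 0 0 * (w *m b) 0 0).
    rewrite /D' mulmxBr mulmxBl -scalemxAr -scalemxAl.
    have -> : w *m (b *m b^T) *m w^T = (w *m b) *m (w *m b)^T.
      by rewrite trmx_mul !mulmxA.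
    have FB (X Y : 'M[R]_1) : (X - a^-1 *: Y) 0 0 = X 0 0 - a^-1 * Y 0 0 by rewrite !mxE.
    by rewrite FB; congr (_ - _ * _); rewrite mxE big_ord1 [_^T _ _]mxE.
  rewrite qf /t; move: ((w *m b) 0 0) ((w *m D *m w^T) 0 0) => c d.
  by congr (_ < _); field; rewrite gt_eqF.
have [B' EB'] := IH D' sD' pD'.
have sa : Num.sqrt a * Num.sqrt a = a by rewrite -expr2 sqr_sqrtr // ltW.
have sa0 : Num.sqrt a != 0 by rewrite gt_eqF // sqrtr_gt0.
exists (block_mx (Num.sqrt a)%:M 0 ((Num.sqrt a)^-1 *: b) B').
rewrite tr_block_mx mulmx_block EP trmx0 tr_scalar_mx !mul0mx !mulmx0 !addr0.
have -> : ((Num.sqrt a)^-1 *: b)^T = (Num.sqrt a)^-1 *: b^T by apply/matrixP => i j; rewrite !mxE.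
congr block_mx.
- by rewrite -scalar_mxM sa.
- by rewrite mul_scalar_mx scalerA mulfV // scale1r.
- by rewrite mul_mx_scalar scalerA mulfV // scale1r.
- rewrite -scalemxAl -scalemxAr scalerA -invfM sa -EB' /D' addrC subrK //.
Qed.

Lemma posdef_inv n (P : 'M[R]_n) : P^T = P -> posdef P -> posdef (invmx P).
Proof.
move=> sP pP v v0; have uP := posdef_unit pP.
have w0 : v *m invmx P != 0.
  by apply: contra v0 => /eqP E; rewrite -(mulmxKV uP v) E mul0mx.
by have := pP _ w0; rewrite mulmxKV // trmx_mul trmx_inv sP mulmxA.
Qed.

(** With [P = B *m B^T] the trace is that of [B^T *m F *m B], whose diagonal entries are values of
    the quadratic form of [F]. *)
Lemma trace_posdef_le0 n (P F : 'M[R]_n) : P^T = P -> posdef P ->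
  (forall v : 'rV[R]_n, (v *m F *m v^T) 0 0 <= 0) -> \tr (P *m F) <= 0.
Proof.
move=> sP pP nF; have [B ->] := posdef_factor sP pP.
rewrite -mulmxA mxtrace_mulC; apply: sumr_le0 => i _.
have := nF (row i B^T); congr (_ <= _).
rewrite mxE [RHS]mxE; apply: eq_bigr => k _; rewrite !mxE; congr (_ * _).
by apply: eq_bigr => l _; rewrite !mxE.
Qed.

(** With [P = B *m B^T] this is the sum of the squared entries of [B^T *m H *m B]. For the inverse
    metric and the Hessian it is |Hess u|^2. *)
Lemma trace_sq_ge0 n (P H : 'M[R]_n) : P^T = P -> posdef P -> H^T = H ->
  0 <= \tr (P *m H *m P *m H).
Proof.
move=> sP pP sH; have [B ->] := posdef_factor sP pP.
have -> : \tr (B *m B^T *m H *m (B *m B^T) *m H) =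
    \tr ((B^T *m H *m B) *m (B^T *m H *m B)^T).
  rewrite !trmx_mul trmxK sH -!mulmxA mxtrace_mulC !mulmxA //.
rewrite /mxtrace; apply: sumr_ge0 => i _; rewrite mxE; apply: sumr_ge0 => j _.
by rewrite [_^T _ _]mxE -expr2 sqr_ge0.
Qed.

End PosDef.

(** * Quasi-Einstein metrics in coordinates *)

Section QuasiEinstein.
Context {R : realType} {n : nat}.
Variables (U : set 'rV[R]_n) (G : 'rV[R]_n -> 'M[R]_n) (u : 'rV[R]_n -> R) (m : R).
Hypothesis oU : open U.
Hypothesis sG : smx U G.
Hypothesis symG : forall x, U x -> (G x)^T = G x.
Hypothesis pG : forall x, U x -> posdef (G x).
Hypothesis su : smooth_on U u.
Implicit Types (x : 'rV[R]_n) (i j k l e : 'I_n).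

Local Notation Ginv := (Ginv G).
Local Notation A := (cmx G).
Local Notation hes := (hes G u).
Local Notation lap := (lap G u).
Local Notation du := (du u).
Local Notation gradsq := (gradsq G u).
Local Notation ric := (ric G).

Let uG x : U x -> G x \in unitmx.
Proof. by move=> /pG; exact: posdef_unit. Qed.

Lemma posdef_Ginv x : U x -> posdef (Ginv x).
Proof. by move=> Ux; apply: posdef_inv; [exact: symG|exact: pG]. Qed.

Lemma gradsqE x : gradsq x = ((du x)^T *m Ginv x *m (du x)^T^T) 0 0.
Proof. by rewrite trmxK. Qed.

Lemma gradsq_ge0 x : U x -> 0 <= gradsq x.
Proof.
move=> Ux; have [/eqP E|v0] := boolP ((du x)^T == 0).
  by rewrite gradsqE E !mul0mx mxE.
by rewrite gradsqE; apply/ltW/posdef_Ginv.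
Qed.

Lemma gradsq_eq0 x : U x -> gradsq x = 0 -> du x = 0.
Proof.
move=> Ux; rewrite gradsqE => E; apply: trmx_inj; rewrite trmx0; apply/eqP; apply: contraT => v0.
by have := posdef_Ginv Ux v0; rewrite E ltxx.
Qed.

Lemma max_hessian f x : smooth_on U f -> U x -> (\forall y \near x, f y <= f x) ->
  (forall k, partial k f x = 0) /\
  \sum_i \sum_k Ginv x i k * partial i (partial k f) x <= 0.
Proof.
move=> sf Ux mx; have [d0 H] := local_max_deriv oU sf Ux mx; split=> //.
pose F : 'M[R]_n := \matrix_(i, j) partial i (partial j f) x.
have gs a b : Ginv x a b = Ginv x b a by rewrite -{1}(GinvT symG Ux) mxE.
have -> : \sum_i \sum_k Ginv x i k * partial i (partial k f) x = \tr (Ginv x *m F).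
  by rewrite (trace_sym_mul gs); apply: eq_bigr => i _; apply: eq_bigr => k _; rewrite mxE.
apply: trace_posdef_le0 => [||v]; [exact: (GinvT symG Ux) | exact: (posdef_Ginv Ux) |].
rewrite qformE; apply: le_trans (H v); apply: ler_sum => i _; apply: ler_sum => j _.
by rewrite mxE -mulrA mulrC.
Qed.

Hypothesis u0 : forall x, U x -> 0 < u x.
Hypothesis m1 : 1 < m.
Hypothesis qe : forall x, U x -> forall i j, hessian G u i j x = u x / m * ricci G i j x.

Let m0 : m != 0. Proof. by rewrite gt_eqF // (lt_trans ltr01). Qed.

Lemma hes_ric x : U x -> hes x = (u x / m) *: ric x.
Proof. by move=> Ux; apply/matrixP => i j; rewrite mxE qe // !mxE. Qed.

Definition scal x : R := \tr (Ginv x *m ric x).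

Lemma smooth_scal : smooth_on U scal.
Proof. exact: (smooth_tr oU (smxM oU (smooth_Ginv oU sG uG) (smooth_ric oU sG uG))). Qed.

Lemma lap_scal x : U x -> lap x = u x / m * scal x.
Proof. by move=> Ux; rewrite /lap hes_ric // -scalemxAr linearZ. Qed.

Lemma partial_u_div_m i x : U x -> partial i (fun y => u y / m) x = partial i u x / m.
Proof.
move=> Ux; have du0 : derivable u x 'e_i by exact: smooth_derivable su Ux.
rewrite (partialM du0 (derivable_cst m^-1 x 'e_i)) partial_cst mulr0 addr0 //.
Qed.

Lemma smooth_u_div_m : smooth_on U (fun y => u y / m).
Proof. exact: (smoothM oU su (smooth_cst _)). Qed.

Lemma d_lap i x : U x ->
  partial i lap x = partial i u x / m * scal x + u x / m * partial i scal x.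
Proof.
move=> Ux; rewrite -(partial_u_div_m i Ux).
rewrite -(partialM (smooth_derivable smooth_u_div_m Ux) (smooth_derivable smooth_scal Ux)).
by apply: partial_near; apply: (open_near oU Ux) => y; exact: lap_scal.
Qed.

Lemma nab_hes_ric j x : U x ->
  nab G hes j x = (partial j u x / m) *: ric x + (u x / m) *: nab G ric j x.
Proof.
move=> Ux; have sr := smooth_ric oU sG uG.
have E : dmx j hes x = (partial j u x / m) *: ric x + (u x / m) *: dmx j ric x.
  rewrite (@dmx_ext R n U oU _ _ j hes (fun y => (u y / m) *: ric y) x hes_ric Ux).
  apply/matrixP => a b; rewrite dmxE.
  transitivity (partial j (fun y => u y / m * ric y a b) x).
    by apply: eq_partial => y; rewrite mxE.
  rewrite (partialM (smooth_derivable smooth_u_div_m Ux) (smooth_derivable (sr a b) Ux)).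
  by rewrite (partial_u_div_m j Ux) [RHS]mxE; congr (_ + _); rewrite [RHS]mxE ?dmxE.
rewrite /nab E hes_ric //; move: (dmx j ric x) (ric x) (A j x) => X Y Z.
by rewrite -scalemxAr -scalemxAl !scalerBr !addrA.
Qed.

Let X i x : R := (ric x *m Ginv x *m du x) i 0.

Lemma div_hes_ric i x : U x ->
  divg G hes i x = X i x / m + u x / m * (partial i scal x / 2).
Proof.
move=> Ux.
have <- : divg G ric i x = partial i scal x / 2.
  by rewrite (contracted_Bianchi oU sG symG uG i Ux) mulrAC mulfV ?mul1r // pnatr_eq0.
have -> : X i x / m = \sum_j \sum_k Ginv x j k * ((partial j u x / m) * ric x i k).
  rewrite /X -mulmxA mxE mulr_suml exchange_big /=; apply: eq_bigr => k _.
  rewrite [(Ginv x *m du x) k 0]mxE mulr_sumr mulr_suml; apply: eq_bigr => j _.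
  have -> : Ginv x j k = Ginv x k j by rewrite -{1}(GinvT symG Ux) mxE.
  by rewrite [du x j 0]mxE; ring.
rewrite /divg mulr_sumr -big_split /=; apply: eq_bigr => j _.
rewrite mulr_sumr -big_split /=; apply: eq_bigr => k _.
have -> : nab G hes j x i k = partial j u x / m * ric x i k + u x / m * nab G ric j x i k.
  have := congr1 (fun M : 'M[R]_n => M i k) (nab_hes_ric j Ux).
  move: (ric x) (nab G ric j x) (nab G hes j x) => P Q S ->; by rewrite !mxE.
by ring.
Qed.

Lemma hgrad_ric i x : U x -> hgrad G u x i 0 = u x / m * X i x.
Proof.
by move=> Ux; rewrite /hgrad hes_ric // -!scalemxAl mxE.
Qed.

(* The first integral of Kim and Kim. *)
Definition kim_kim x : R := u x * lap x + (m - 1) * gradsq x.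

Lemma smooth_lap : smooth_on U lap.
Proof. exact: (smooth_tr oU (smxM oU (smooth_Ginv oU sG uG) (smooth_hes oU sG uG su))). Qed.

Lemma smooth_gradsq : smooth_on U gradsq.
Proof.
have H := smxM oU (smxM oU (smxT (smooth_du su)) (smooth_Ginv oU sG uG)) (smooth_du su).
exact: (H 0 0).
Qed.

Lemma smooth_kim_kim : smooth_on U kim_kim.
Proof.
exact: (smoothD oU (smoothM oU su smooth_lap) (smoothM oU (smooth_cst _) smooth_gradsq)).
Qed.

Lemma partial_kim_kim i x : U x -> partial i kim_kim x = 0.
Proof.
move=> Ux; have dl := @smooth_derivable _ _ _ _ _ i smooth_lap Ux.
have dg := @smooth_derivable _ _ _ _ _ i smooth_gradsq Ux.
have dux := @smooth_derivable _ _ _ _ _ i su Ux.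
have dc : derivable (fun=> m - 1) x 'e_i by exact: (derivable_cst (m - 1) x 'e_i).
rewrite /kim_kim (partialD (derivableM dux dl) (derivableM dc dg)).
rewrite (partialM dux dl) (partialM dc dg) partial_cst mul0r add0r.
rewrite (d_gradsq oU sG symG uG su i Ux) (hgrad_ric i Ux) (d_lap i Ux) (lap_scal Ux).
(* The divergence of Hess u is known in two ways: by commutation it is d (Lap u) + Ric (grad u); by
   Hess u = u Ric / m and the contracted Bianchi identity it is Ric (grad u) / m + u d scal / (2 m).
   The differential of [kim_kim] is 2 u times the first expression minus the second. *)
have := div_hes oU sG symG uG su i Ux.
rewrite (div_hes_ric i Ux) (d_lap i Ux) -/(X i x) => E.
move: E; move: (X i x) (scal x) (u x) (partial i u x) (partial i scal x) => a b c d e E.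
have E1 : a + c * (e / 2) - (d * b + c * e + m * a) = 0.
  transitivity (m * (a / m + c / m * (e / 2) - (d / m * b + c / m * e + a))).
    by field; exact: m0.
  by rewrite E subrr mulr0.
transitivity (- (2 * c / m) * (a + c * (e / 2) - (d * b + c * e + m * a))).
  by field; exact: m0.
by rewrite E1 mulr0.
Qed.

(* Bochner's formula at a critical point of w = |grad u|^2 reads
   Lap w = 2 |Hess u|^2 + 2 <grad u, div Hess u>, where div Hess u = d (Lap u) because Ric (grad u)
   is a multiple of d w; with Lap u = - (m - 1) w / u, the last term is 2 (m - 1) w^2 / u^2. *)
Lemma gradsq_eq0_local_max x : U x -> (forall y, U y -> kim_kim y = 0) ->
  (\forall y \near x, gradsq y <= gradsq x) -> gradsq x = 0.
Proof.
move=> Ux k0 mx.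
have gs a b : Ginv x a b = Ginv x b a by rewrite -{1}(GinvT symG Ux) mxE.
have [d0 H] := max_hessian smooth_gradsq Ux mx.
have ux := u0 Ux.
have h0 : hgrad G u x = 0.
  apply/matrixP => k j; rewrite ord1 [RHS]mxE.
  have := d0 k; rewrite (d_gradsq oU sG symG uG su k Ux) => /eqP.
  by rewrite mulf_eq0 pnatr_eq0 /= => /eqP.
have X0 i : X i x = 0.
  have := hgrad_ric i Ux; rewrite h0 mxE => /esym/eqP; rewrite mulf_eq0 => /orP[|/eqP //].
  by rewrite mulf_eq0 invr_eq0 (negbTE m0) gt_eqF.
pose z := Ginv x *m du x.
have dlE i : partial i lap x = (m - 1) * gradsq x / u x / u x * partial i u x.
  have -> : partial i lap x = partial i (fun y => - ((m - 1) * gradsq y * (u y)^-1)) x.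
    apply: partial_near; apply: (open_near oU Ux) => y Uy.
    have := k0 y Uy; rewrite /kim_kim => /eqP; rewrite addr_eq0 => /eqP E.
    have uy : u y != 0 by rewrite gt_eqF // u0.
    by rewrite -[lap y](mulKf uy) E mulrC mulNr.
  have dg := @smooth_derivable _ _ _ _ _ i smooth_gradsq Ux.
  have dux := @smooth_derivable _ _ _ _ _ i su Ux.
  have dc : derivable (fun=> m - 1) x 'e_i by exact: (derivable_cst (m - 1) x 'e_i).
  have ux0 : u x != 0 by rewrite gt_eqF.
  have dV := derivableV ux0 dux.
  rewrite (partialN (derivableM (derivableM dc dg) dV)) (partialM (derivableM dc dg) dV).
  rewrite (partialM dc dg) (d0 i) partial_cst (partialV dux ux0).
  rewrite -[((fun=> m - 1) * gradsq) x]/((m - 1) * gradsq x).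
  move: (gradsq x) (u x) (partial i u x) ux0 => a b c b0.
  by field.
have dv i : divg G hes i x = (m - 1) * gradsq x / u x / u x * partial i u x.
  by rewrite (div_hes oU sG symG uG su i Ux) -/(X i x) X0 addr0 dlE.
have nsym k : (nab G hes k x)^T = nab G hes k x.
  have hs := hes_sym oU symG su.
  have dsym : (dmx k hes x)^T = dmx k hes x.
    by rewrite -dmxT; exact: (@dmx_ext R n U oU _ _ k _ _ x hs Ux).
  rewrite /nab; have tB (M N : 'M[R]_n) : (M - N)^T = M^T - N^T by exact: linearB.
  by rewrite !tB !trmx_mul trmxK dsym (hs x Ux) addrAC.
have dd i k : partial i (partial k gradsq) x =
    2 * ((nab G hes i x *m z) k 0 + (hes x *m Ginv x *m hes x) k i).
  have -> : partial i (partial k gradsq) x = partial i (fun y => 2 * hgrad G u y k 0) x.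
    apply: partial_near; apply: (open_near oU Ux) => y Uy.
    exact: (d_gradsq oU sG symG uG su k Uy).
  have dh := @smooth_derivable _ _ _ _ _ i (smooth_hgrad oU sG uG su k 0) Ux.
  have d2 : derivable (fun=> 2 : R) x 'e_i by exact: (derivable_cst (2 : R) x 'e_i).
  rewrite (partialM d2 dh) partial_cst mul0r add0r; congr (_ * _).
  rewrite -(dmxE i (hgrad G u)) (d_hgrad oU sG symG uG su i Ux) h0 mulmx0 addr0 addmxE.
  rewrite -mulmxA; congr (_ + _).
  rewrite -[hrow G u i x]trmxK (hrowT G u i x) tr_row (hes_sym oU symG su Ux).
  by rewrite [LHS]mxE [RHS]mxE; apply: eq_bigr => p _; rewrite [col _ _ _ _]mxE.
(* Each covariant derivative of Hess u is symmetric ([nsym]), so contracting its derivative index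
   with either tensor index gives the divergence; the sum is <grad u, div Hess u>. *)
have S1 : \sum_i \sum_k Ginv x i k * (nab G hes i x *m z) k 0 =
    (m - 1) * gradsq x / u x / u x * gradsq x.
  transitivity (\sum_j z j 0 * divg G hes j x).
    under [RHS]eq_bigr do rewrite /divg mulr_sumr.
    rewrite [RHS]exchange_big /=; apply: eq_bigr => i _.
    under [RHS]eq_bigr do rewrite mulr_sumr.
    rewrite [RHS]exchange_big /=; apply: eq_bigr => k _.
    rewrite mxE mulr_sumr; apply: eq_bigr => j _.
    by rewrite -{1}(nsym i) [_^T _ _]mxE; ring.
  transitivity (\sum_j (m - 1) * gradsq x / u x / u x * (partial j u x * z j 0)).
    by apply: eq_bigr => j _; rewrite dv; ring.
  rewrite -mulr_sumr; congr (_ * _); rewrite /gradsq -mulmxA mxE.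
  by apply: eq_bigr => j _; rewrite [_^T _ _]mxE [du x j 0]mxE.
have S2 : \sum_i \sum_k Ginv x i k * (hes x *m Ginv x *m hes x) k i =
   \tr (Ginv x *m hes x *m Ginv x *m hes x).
  by rewrite -!mulmxA /mxtrace; apply: eq_bigr => i _; rewrite mxE !mulmxA.
have S2p : 0 <= \tr (Ginv x *m hes x *m Ginv x *m hes x).
  by apply: trace_sq_ge0; [exact: (GinvT symG Ux) | exact: (posdef_Ginv Ux) | exact: (hes_sym oU symG su Ux)].
have : 2 * ((m - 1) * gradsq x / u x / u x * gradsq x +
    \tr (Ginv x *m hes x *m Ginv x *m hes x)) <= 0.
  rewrite -S1 -S2 -big_split /= mulr_sumr; apply: le_trans H; apply: ler_sum => i _.
  rewrite -big_split /= mulr_sumr; apply: ler_sum => k _.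
  by rewrite dd; move: (Ginv x i k) ((nab G hes i x *m z) k 0) (_ k i) => a b c; lra.
have g0 := gradsq_ge0 Ux.
move: S2p; move: (\tr _) => t t0 E.
apply/eqP; apply: contraT => gn0.
have gp : 0 < gradsq x by rewrite lt_neqAle eq_sym gn0.
have : 0 < (m - 1) * gradsq x / u x / u x * gradsq x.
  by rewrite mulr_gt0 // !divr_gt0 // mulr_gt0 // subr_gt0.
by move: (_ * gradsq x) E => s E s0; lra.
Qed.

Lemma kim_kim_le0_local_max x : U x -> (\forall y \near x, u y <= u x) -> kim_kim x <= 0.
Proof.
move=> Ux mx; have [d0 H] := max_hessian su Ux mx.
have v0 : du x = 0 by apply/matrixP => i j; rewrite !mxE.
have g0 : gradsq x = 0 by rewrite /gradsq v0 mulmx0 mxE.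
have gs a b : Ginv x a b = Ginv x b a by rewrite -{1}(GinvT symG Ux) mxE.
rewrite /kim_kim g0 mulr0 addr0 pmulr_rle0 ?u0 // /lap (trace_sym_mul gs).
apply: le_trans H; apply: ler_sum => i _; apply: ler_sum => k _.
rewrite [hes x i k]mxE /hessian big1 ?subr0 // => p _.
by rewrite (d0 p) mulr0.
Qed.

Lemma kim_kim_ge0_local_min x : U x -> (\forall y \near x, u x <= u y) -> 0 <= kim_kim x.
Proof.
move=> Ux mn.
have mx : \forall y \near x, - u y <= - u x by apply: filterS mn => y; rewrite lerN2.
have [d0 H] := max_hessian (smoothN oU su) Ux mx.
have dN k y : U y -> partial k (fun y => - u y) y = - partial k u y.
  by move=> Uy; exact: (partialN (smooth_derivable su Uy)).
have {}d0 k : partial k u x = 0.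
  by apply/eqP; rewrite -oppr_eq0 -(dN k x Ux); apply/eqP; exact: d0.
have v0 : du x = 0 by apply/matrixP => i j; rewrite !mxE.
have g0 : gradsq x = 0 by rewrite /gradsq v0 mulmx0 mxE.
have gs a b : Ginv x a b = Ginv x b a by rewrite -{1}(GinvT symG Ux) mxE.
rewrite /kim_kim g0 mulr0 addr0 pmulr_rge0 ?u0 // /lap (trace_sym_mul gs) -oppr_le0 -sumrN.
apply: le_trans H; apply: ler_sum => i _; rewrite -sumrN; apply: ler_sum => k _.
rewrite [hes x i k]mxE /hessian big1 ?subr0; last by move=> p _; rewrite (d0 p) mulr0.
have -> : partial i (partial k (fun y => - u y)) x = - partial i (partial k u) x.
  have -> : partial i (partial k (fun y => - u y)) x = partial i (fun y => - partial k u y) x.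
    apply: partial_near; apply: (open_near oU Ux) => y; exact: dN.
  exact: (partialN (smooth_derivable (smooth_partial k su) Ux)).
by rewrite mulrN.
Qed.

End QuasiEinstein.

(** * Coordinate invariance of the gradient norm and the Laplacian *)

Section InnerProduct.
Context {R : realType} {n : nat}.
Variables (U : set 'rV[R]_n) (G : 'rV[R]_n -> 'M[R]_n).
Hypothesis oU : open U.
Hypothesis sG : smx U G.
Hypothesis symG : forall x, U x -> (G x)^T = G x.
Hypothesis uG : forall x, U x -> G x \in unitmx.
Implicit Types (a b u : 'rV[R]_n -> R) (x : 'rV[R]_n).

Local Notation Ginv := (Ginv G).

Definition ip a b x : R := ((du a x)^T *m Ginv x *m du b x) 0 0.

Lemma smooth_ip a b : smooth_on U a -> smooth_on U b -> smooth_on U (ip a b).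
Proof.
move=> sa sb; exact: (smxM oU (smxM oU (smxT (smooth_du sa)) (smooth_Ginv oU sG uG)) (smooth_du sb) 0 0).
Qed.

Lemma d_ip a b x : smooth_on U a -> smooth_on U b -> U x ->
  du (ip a b) x = hes G a x *m Ginv x *m du b x + hes G b x *m Ginv x *m du a x.
Proof.
move=> sa sb Ux; have sg := smooth_Ginv oU sG uG.
have [da db] := (smooth_du sa, smooth_du sb).
apply/colP => i; rewrite [LHS]mxE.
transitivity (dmx i (fun y => (du a y)^T *m Ginv y *m du b y) x 0 0); first by rewrite dmxE.
rewrite (dmxM i (smxM oU (smxT da) sg) db Ux) (dmxM i (smxT da) sg Ux) dmxT.
rewrite (dGinv oU sG symG uG i Ux) (d_du G a i x) (d_du G b i x).
have -> : (hes G a x *m Ginv x *m du b x + hes G b x *m Ginv x *m du a x) i 0 =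
    ((hrow G a i x)^T *m Ginv x *m du b x) 0 0 + ((hrow G b i x)^T *m Ginv x *m du a x) 0 0.
  have re (M g : 'M[R]_n) (v : 'cV[R]_n) : (row i M *m g *m v) 0 0 = (M *m g *m v) i 0.
    by rewrite -!row_mul mxE.
  by rewrite addmxE (hrowT G a i x) (hrowT G b i x) !re.
have gs := GinvT symG Ux.
move: (hrow G a i x) (hrow G b i x) (du a x) (du b x) (cmx G i x) (Ginv x) gs => h k v w C g gs.
have tD (p q : 'cV[R]_n) : (p + q)^T = p^T + q^T by exact: linearD.
rewrite tD trmx_mul trmxK ?(mulmxDl, mulmxDr, mulmxN, mulNmx, mulmxA).
have -> : k^T *m g *m v = (v^T *m g *m k)^T by rewrite !trmx_mul trmxK gs mulmxA.
rewrite [(_^T) 0 0 in RHS]mxE ?(addmxE, oppmxE).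
ring.
Qed.

(* Hess u (grad a, grad b) in terms of inner products of gradients, hence independent of the
   coordinates. *)
Definition koszul u a b x : R := 2^-1 * (ip a (ip u b) x + ip b (ip u a) x - ip u (ip a b) x).

(** By [d_ip], each derivative of an inner product is a sum of two Hessian terms. In the Koszul
    combination those of [a] and [b] cancel by symmetry and those of [u] occur twice. *)
Lemma koszulE u a b x : smooth_on U u -> smooth_on U a -> smooth_on U b -> U x ->
  koszul u a b x = ((Ginv x *m du a x)^T *m hes G u x *m (Ginv x *m du b x)) 0 0.
Proof.
move=> ss sa sb Ux; rewrite /koszul {1 3 5}/ip.
rewrite (d_ip ss sb Ux) (d_ip ss sa Ux) (d_ip sa sb Ux).
have gs := GinvT symG Ux.
have [Hu [Ha Hb]] := (hes_sym oU symG ss Ux, (hes_sym oU symG sa Ux, hes_sym oU symG sb Ux)).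
move: (du u x) (du a x) (du b x) (hes G u x) (hes G a x) (hes G b x) (Ginv x) gs Hu Ha Hb
  => v p q H K L g gs Hu Ha Hb.
have sw (M : 'M[R]_n) (y z : 'cV[R]_n) : M^T = M ->
    (y^T *m g *m M *m g *m z) 0 0 = (z^T *m g *m M *m g *m y) 0 0.
  move=> sM; have -> : y^T *m g *m M *m g *m z = (z^T *m g *m M *m g *m y)^T.
    by rewrite !trmx_mul trmxK gs sM !mulmxA.
  by rewrite mxE.
rewrite trmx_mul gs ?(mulmxDr, mulmxA) !addmxE.
rewrite (sw H q p Hu) (sw K q v Ha) (sw L p v Hb).
by field.
Qed.

End InnerProduct.

Section ChangeOfCoordinates.
Context {R : realType} {n : nat}.
Variables (U V : set 'rV[R]_n) (G H : 'rV[R]_n -> 'M[R]_n) (T : 'rV[R]_n -> 'rV[R]_n).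
Hypothesis oU : open U.
Hypothesis sG : smx U G.
Hypothesis symG : forall x, U x -> (G x)^T = G x.
Hypothesis uG : forall x, U x -> G x \in unitmx.
Hypothesis oV : open V.
Hypothesis sH : smx V H.
Hypothesis symH : forall x, V x -> (H x)^T = H x.
Hypothesis uH : forall x, V x -> H x \in unitmx.
Hypothesis TV : forall x, U x -> V (T x).
Hypothesis sT : forall a, smooth_on U (fun y => T y 0 a).

Definition jac x : 'M[R]_n := \matrix_(i, a) partial i (fun y => T y 0 a) x.

Hypothesis GH : forall x, U x -> G x = jac x *m H (T x) *m (jac x)^T.
Implicit Types (f h : 'rV[R]_n -> R) (x : 'rV[R]_n).

Lemma du_trans f h x : smooth_on V f -> (forall y, U y -> h y = f (T y)) -> U x ->
  du h x = jac x *m du f (T x).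
Proof.
move=> sf hE Ux; apply/colP => k; rewrite [LHS]mxE.
have -> : partial k h x = partial k (fun y => f (T y)) x.
  by apply: partial_near; exact: (open_near oU Ux hE).
rewrite partial_comp.
- by rewrite mxE; apply: eq_bigr => j _; rewrite !mxE.
- move=> j; apply: (open_near oV (TV Ux)) => y Vy; exact: (smooth_derivable sf Vy).
- by move=> j; exact: (smooth_continuous (smooth_partial j sf) (TV Ux)).
- by move=> j; exact: (smooth_derivable (sT j) Ux).
Qed.

Lemma jac_unit x : U x -> jac x \in unitmx.
Proof.
move=> Ux; have := uG Ux; rewrite (GH Ux) unitmx_mul => /andP[+ _].
by rewrite unitmx_mul => /andP[].
Qed.

Lemma Ginv_trans x : U x -> (jac x)^T *m Ginv G x *m jac x = Ginv H (T x).
Proof.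
move=> Ux; have uJ := jac_unit Ux; have uJT : (jac x)^T \in unitmx by rewrite unitmx_tr.
have uHx := uH (TV Ux); have uGx := uG Ux.
have E : (jac x)^T *m Ginv G x *m jac x *m H (T x) *m (jac x)^T = (jac x)^T.
  by rewrite -!mulmxA (mulmxA (jac x)) -(GH Ux) mulVmx // mulmx1.
have {}E : (jac x)^T *m Ginv G x *m jac x *m H (T x) = 1%:M.
  by rewrite -[LHS](mulmxK uJT) E mulmxV.
by rewrite -[LHS](mulmxK uHx) E mul1mx.
Qed.

Lemma ip_trans f1 h1 f2 h2 x : smooth_on V f1 -> smooth_on V f2 ->
  (forall y, U y -> h1 y = f1 (T y)) -> (forall y, U y -> h2 y = f2 (T y)) -> U x ->
  ip G h1 h2 x = ip H f1 f2 (T x).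
Proof.
move=> s1 s2 E1 E2 Ux; rewrite /ip (du_trans s1 E1 Ux) (du_trans s2 E2 Ux).
by rewrite -(Ginv_trans Ux) trmx_mul !mulmxA.
Qed.

Lemma gradsq_trans f h x : smooth_on V f -> (forall y, U y -> h y = f (T y)) -> U x ->
  gradsq G h x = gradsq H f (T x).
Proof. by move=> sf E Ux; exact: (ip_trans sf sf E E Ux). Qed.

(** The Koszul expression is built from invariant inner products. Applied to the coordinate
    functions [X a] of the target and their pullbacks [Y a], it identifies the Hessians with both
    indices raised, and a trace against [H] gives the Laplacians. *)
Lemma lap_trans f h x : smooth_on V f -> smooth_on U h ->
  (forall y, U y -> h y = f (T y)) -> U x -> lap G h x = lap H f (T x).
Proof.
move=> sf sh hE Ux.
pose X (a : 'I_n) (y : 'rV[R]_n) : R := y 0 a.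
pose Y (a : 'I_n) (y : 'rV[R]_n) : R := T y 0 a.
have sX a : smooth_on V (X a) by exact: smooth_coord.
have YX a y : U y -> Y a y = X a (T y) by [].
have K a b : koszul G h (Y a) (Y b) x = koszul H f (X a) (X b) (T x).
  have E1 : ip G (Y a) (ip G h (Y b)) x = ip H (X a) (ip H f (X b)) (T x).
    apply: (ip_trans (sX a) (smooth_ip oV sH uH sf (sX b)) (YX a) _ Ux) => y Uy.
    exact: (ip_trans sf (sX b) hE (YX b) Uy).
  have E2 : ip G (Y b) (ip G h (Y a)) x = ip H (X b) (ip H f (X a)) (T x).
    apply: (ip_trans (sX b) (smooth_ip oV sH uH sf (sX a)) (YX b) _ Ux) => y Uy.
    exact: (ip_trans sf (sX a) hE (YX a) Uy).
  have E3 : ip G h (ip G (Y a) (Y b)) x = ip H f (ip H (X a) (X b)) (T x).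
    apply: (ip_trans sf (smooth_ip oV sH uH (sX a) (sX b)) hE _ Ux) => y Uy.
    exact: (ip_trans (sX a) (sX b) (YX a) (YX b) Uy).
  have alg (p q r p' q' r' : R) : p = p' -> q = q' -> r = r' ->
    2^-1 * (p + q - r) = 2^-1 * (p' + q' - r') by move=> -> -> ->.
  exact: (alg _ _ _ _ _ _ E1 E2 E3).
have dX a y : du (X a) y = delta_mx a 0.
  by apply/colP => k; rewrite [LHS]mxE partial_coord mxE eqxx andbT.
have dY a : du (Y a) x = jac x *m delta_mx a 0.
  by rewrite (du_trans (sX a) (YX a) Ux) dX.
have ent (M : 'M[R]_n) a b : ((delta_mx a 0 : 'cV_n)^T *m M *m delta_mx b (0 : 'I_1)) 0 0 = M a b.
  by rewrite trmx_delta -rowE -colE !mxE.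
pose gH := Ginv H (T x); pose gG := Ginv G x; pose J := jac x.
have KH a b : koszul H f (X a) (X b) (T x) = (gH *m hes H f (T x) *m gH) a b.
  rewrite (koszulE oV sH symH uH sf (sX a) (sX b) (TV Ux)) !dX -/gH.
  have gs : gH^T = gH := GinvT symH (TV Ux).
  by rewrite -(ent _ a b) trmx_mul gs !mulmxA.
have KG a b : koszul G h (Y a) (Y b) x = (J^T *m gG *m hes G h x *m gG *m J) a b.
  rewrite (koszulE oU sG symG uG sh (sT a) (sT b) Ux) !dY -/gG -/J.
  have gs : gG^T = gG := GinvT symG Ux.
  by rewrite -(ent _ a b) !trmx_mul gs !mulmxA.
have E : J^T *m gG *m hes G h x *m gG *m J = gH *m hes H f (T x) *m gH.
  by apply/matrixP => a b; rewrite -KG -KH K.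
have uHx := uH (TV Ux).
transitivity (\tr (H (T x) *m (J^T *m gG *m hes G h x *m gG *m J))).
  rewrite !mulmxA mxtrace_mulC !mulmxA -(GH Ux) mulmxV ?uG // mul1mx mxtrace_mulC //.
by rewrite E !mulmxA mulmxV // mul1mx mxtrace_mulC.
Qed.

End ChangeOfCoordinates.

(** * Asymptotics on an end *)

Section PowerDecay.
Context {R : realType}.
Implicit Types (r s t C e : R).

Lemma powRN_le r1 r2 s : 0 <= s -> 0 < r1 -> r1 <= r2 -> r2 `^ (- s) <= r1 `^ (- s).
Proof.
move=> s0 r10 r12; have r20 : 0 < r2 by exact: lt_le_trans r12.
rewrite !powRN lef_pV2 ?posrE ?powR_gt0 //.
by apply: ge0_ler_powR => //; rewrite nnegrE ltW.
Qed.

Lemma powRN_small s e : 0 < s -> 0 < e ->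
  exists2 r, 1 <= r & forall t, r <= t -> t `^ (- s) <= e.
Proof.
move=> s0 e0; exists (Num.max 1 (e `^ (- s^-1))); first by rewrite le_max lexx.
move=> t; rewrite ge_max => /andP[t1 te].
have p0 : 0 < e `^ (- s^-1) by rewrite powR_gt0.
apply: le_trans (powRN_le (ltW s0) p0 te) _.
by rewrite -powRrM mulNr mulrN opprK mulVf ?gt_eqF // powRr1 // ltW.
Qed.

Lemma powR_step s r : 0 < r -> r * r `^ (- (s + 1)) = r `^ (- s).
Proof.
move=> r0; rewrite -{1}(powRr1 (ltW r0)) -powRD; first by congr (_ `^ _); ring.
by rewrite (gt_eqF r0) implybT.
Qed.

End PowerDecay.

Section EuclideanNorm.
Context {R : realType} {n : nat}.
Implicit Types (x y : 'rV[R]_n).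

Lemma enorm_ge0 x : 0 <= enorm x.
Proof. exact: sqrtr_ge0. Qed.

Lemma enorm_sqr x : enorm x ^+ 2 = \sum_i x 0 i ^+ 2.
Proof. by rewrite sqr_sqrtr // sumr_ge0 // => i _; rewrite sqr_ge0. Qed.

Lemma le_enorm x y : (forall k, `|x 0 k| <= `|y 0 k|) -> enorm x <= enorm y.
Proof.
move=> xy; apply: ler_wsqrtr; apply: ler_sum => i _.
by rewrite -[x 0 i ^+ 2]real_normK ?num_real // -[y 0 i ^+ 2]real_normK ?num_real // lerXn2r // nnegrE.
Qed.

Lemma coord_le_enorm x k : `|x 0 k| <= enorm x.
Proof.
rewrite -(@ler_pXn2r _ 2) ?nnegrE ?enorm_ge0 // enorm_sqr real_normK ?num_real //.
by rewrite (bigD1 k) //= lerDl sumr_ge0 // => i _; rewrite sqr_ge0.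
Qed.

Lemma enorm_le_sum x : enorm x <= \sum_k `|x 0 k|.
Proof.
have s0 : 0 <= \sum_k `|x 0 k| by apply: sumr_ge0.
rewrite -(@ler_pXn2r _ 2) ?nnegrE ?enorm_ge0 // enorm_sqr expr2 mulr_suml.
apply: ler_sum => i _; rewrite -[x 0 i ^+ 2]real_normK ?num_real // expr2.
by apply: ler_wpM2l => //; rewrite (bigD1 i) //= lerDl sumr_ge0.
Qed.

Lemma enormZ (a : R) x : enorm (a *: x) = `|a| * enorm x.
Proof.
rewrite /enorm -sqrtr_sqr -sqrtrM ?sqr_ge0 //; congr Num.sqrt; rewrite mulr_sumr.
by apply: eq_bigr => i _; rewrite mxE exprMn.
Qed.

Lemma enorm_coord_gt x (r : R) : 0 <= r -> n%:R * r < enorm x -> exists k, r < `|x 0 k|.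
Proof.
move=> r0 nr; apply/existsP; apply: contraT; rewrite negb_exists => /forallP H.
suff : enorm x <= n%:R * r by rewrite leNgt nr.
apply: le_trans (enorm_le_sum x) _.
have <- : \sum_(k < n) r = n%:R * r by rewrite sumr_const card_ord mulr_natl.
by apply: ler_sum => k _; rewrite leNgt; exact: H.
Qed.

Lemma enorm_continuous : continuous (enorm : 'rV[R]_n -> R).
Proof.
move=> x; apply: (@continuous_comp _ _ _ (fun y : 'rV[R]_n => \sum_i y 0 i ^+ 2) Num.sqrt).
  apply: continuous_for_sum => i.
  have c : {for x, continuous (fun y : 'rV[R]_n => y 0 i)} := @coord_continuous R 1 n 0 i x.
  by have := continuousM c c.
exact: sqrt_continuous.
Qed.

Lemma open_enorm_gt (r : R) : open [set x : 'rV[R]_n | r < enorm x].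
Proof.
have -> : [set x : 'rV[R]_n | r < enorm x] = enorm @^-1` [set t | r < t] by [].
by apply: open_comp => [x _|]; [exact: enorm_continuous | exact: open_gt].
Qed.

End EuclideanNorm.

(** * Orders of decay at infinity *)

Section BigO.
Context {R : realType} {n : nat}.
Implicit Types (f h : 'rV[R]_n -> R) (x : 'rV[R]_n) (s t : R).

(** Only large radii count, so nothing is asked near the inner sphere of an end. The bound [1 <= r]
    makes powers of the radius comparable, and a negative [s] allows growth. *)
Definition bO s f : Prop := exists C r : R,
  [/\ 0 <= C, 1 <= r & forall x, r <= enorm x -> `|f x| <= C * enorm x `^ (- s)].

Lemma bO_ext r0 s f h : (forall x, r0 <= enorm x -> f x = h x) -> bO s f -> bO s h.
Proof.
move=> fh [C [r [C0 r1 H]]]; exists C, (Num.max r r0); split=> //.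
  by rewrite le_max r1.
by move=> x; rewrite ge_max => /andP[xr xr0]; rewrite -fh // H.
Qed.

Lemma bOW s t f : t <= s -> bO s f -> bO t f.
Proof.
move=> ts [C [r [C0 r1 H]]]; exists C, r; split=> // x xr.
apply: le_trans (H x xr) _; apply: ler_wpM2l => //.
by apply: ler_powR; [exact: le_trans xr | rewrite lerN2].
Qed.

Lemma bOD s f h : bO s f -> bO s h -> bO s (fun x => f x + h x).
Proof.
move=> [C [r [C0 r1 H]]] [C' [r' [C'0 r'1 H']]].
exists (C + C'), (Num.max r r'); split; [exact: addr_ge0|by rewrite le_max r1|].
move=> x; rewrite ge_max => /andP[xr xr'].
rewrite mulrDl; apply: le_trans (ler_normD _ _) _.
by apply: lerD; [exact: H|exact: H'].
Qed.

Lemma bON s f : bO s f -> bO s (fun x => - f x).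
Proof. by move=> [C [r [C0 r1 H]]]; exists C, r; split=> // x xr; rewrite normrN H. Qed.

Lemma bOB s f h : bO s f -> bO s h -> bO s (fun x => f x - h x).
Proof. by move=> Hf Hh; exact: (bOD Hf (bON Hh)). Qed.

Lemma bOM s t f h : bO s f -> bO t h -> bO (s + t) (fun x => f x * h x).
Proof.
move=> [C [r [C0 r1 H]]] [C' [r' [C'0 r'1 H']]].
exists (C * C'), (Num.max r r'); split; [exact: mulr_ge0|by rewrite le_max r1|].
move=> x; rewrite ge_max => /andP[xr xr'].
have x0 : 0 < enorm x by apply: lt_le_trans xr; exact: lt_le_trans ltr01 r1.
rewrite opprD powRD; last by rewrite (gt_eqF x0) implybT.
by rewrite normrM mulrACA; apply: ler_pM => //; [exact: H|exact: H'].
Qed.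

Lemma bO_cst (c : R) : bO 0 (fun=> c).
Proof. by exists `|c|, 1; split=> // x _; rewrite oppr0 powRr0 mulr1. Qed.

Lemma bO0 s : bO s (fun=> 0).
Proof. by exists 0, 1; split=> // x _; rewrite normr0 mul0r. Qed.

Lemma bO_scale s (c : R) f : bO s f -> bO s (fun x => c * f x).
Proof. by move=> Hf; have := bOM (bO_cst c) Hf; rewrite add0r. Qed.

Lemma bO_sum s (I : Type) (q : seq I) (F : I -> 'rV[R]_n -> R) :
  (forall i, bO s (F i)) -> bO s (fun x => \sum_(i <- q) F i x).
Proof.
move=> HF; elim: q => [|i q IH].
  by apply: (@bO_ext 0 s (fun=> 0)) (bO0 s) => x _; rewrite big_nil.
by apply: (@bO_ext 0 s _ _ _ (bOD (HF i) IH)) => x _; rewrite big_cons.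
Qed.

Lemma bO_small s f e : 0 < s -> 0 < e -> bO s f ->
  exists2 r : R, 1 <= r & forall x, r <= enorm x -> `|f x| <= e.
Proof.
move=> s0 e0 [C [r [C0 r1 H]]].
have e'0 : 0 < e / (C + 1) by rewrite divr_gt0 // ltr_wpDl.
have [r' r'1 Hr'] := powRN_small s0 e'0.
exists (Num.max r r'); first by rewrite le_max r1.
move=> x; rewrite ge_max => /andP[xr xr'].
apply: le_trans (H x xr) _; apply: le_trans (ler_wpM2l C0 (Hr' _ xr')) _.
rewrite mulrCA ger_pMr // ler_pdivrMr ?mul1r ?lerDl // ltr_wpDl //.
Qed.

(** Symbol estimates are kept to first order, which is what the Christoffel symbols need for a bound
    on the curvature. *)
Definition symbol s f := bO s f /\ forall k, bO (s + 1) (partial k f).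

Variable (rho : R).
Local Notation U := [set x : 'rV[R]_n | rho < enorm x].
Let oU : open U := @open_enorm_gt R n rho.

Lemma bO_extU s f h : (forall x, U x -> f x = h x) -> bO s f -> bO s h.
Proof.
move=> fh; apply: (@bO_ext (rho + 1)) => x xr; apply: fh => /=.
by apply: lt_le_trans xr; rewrite ltrDl.
Qed.

Lemma symbolD s f h : smooth_on U f -> smooth_on U h -> symbol s f -> symbol s h ->
  symbol s (fun x => f x + h x).
Proof.
move=> sf sh [f0 f1] [h0 h1]; split; first exact: bOD.
move=> k; apply: (bO_extU _ (bOD (f1 k) (h1 k))) => x Ux.
by rewrite (partialD (smooth_derivable sf Ux) (smooth_derivable sh Ux)).
Qed.

Lemma symbolN s f : smooth_on U f -> symbol s f -> symbol s (fun x => - f x).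
Proof.
move=> sf [f0 f1]; split; first exact: bON.
move=> k; apply: (bO_extU _ (bON (f1 k))) => x Ux.
by rewrite (partialN (smooth_derivable sf Ux)).
Qed.

Lemma symbolM s t f h : smooth_on U f -> smooth_on U h -> symbol s f -> symbol t h ->
  symbol (s + t) (fun x => f x * h x).
Proof.
move=> sf sh [f0 f1] [h0 h1]; split; first exact: bOM.
move=> k.
have H1 : bO (s + t + 1) (fun x => partial k f x * h x).
  by have := bOM (f1 k) h0; rewrite addrAC.
have H2 : bO (s + t + 1) (fun x => f x * partial k h x).
  by have := bOM f0 (h1 k); rewrite addrA.
apply: (bO_extU _ (bOD H1 H2)) => x Ux.
by rewrite (partialM (smooth_derivable sf Ux) (smooth_derivable sh Ux)).
Qed.

Lemma symbol_cst (c : R) : symbol 0 (fun=> c).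
Proof.
split; first exact: bO_cst.
by move=> k; rewrite partial_cst; exact: bO0.
Qed.

Lemma symbol0 s : symbol s (fun=> 0).
Proof. by split; [exact: bO0 | move=> k; rewrite partial_cst; exact: bO0]. Qed.

Lemma symbol_ext s f h : (forall x, U x -> f x = h x) -> symbol s f -> symbol s h.
Proof.
move=> fh [f0 f1]; split; first exact: bO_extU f0.
move=> k; apply: (bO_extU _ (f1 k)) => x Ux; apply: partial_near.
exact: (open_near oU Ux fh).
Qed.

Lemma symbol_sum s (I : Type) (q : seq I) (F : I -> 'rV[R]_n -> R) :
  (forall i, smooth_on U (F i)) -> (forall i, symbol s (F i)) ->
  symbol s (fun x => \sum_(i <- q) F i x).
Proof.
move=> sF HF; elim: q => [|i q IH].
  by apply: (symbol_ext _ (symbol0 s)) => x _; rewrite big_nil.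
apply: (symbol_ext _ (symbolD (sF i) (smooth_sum q oU sF) (HF i) IH)) => x _.
by rewrite big_cons.
Qed.

End BigO.

Lemma mx_entry_le_norm (R : realType) p q (M : 'M[R]_(p, q)) i j : `|M i j| <= `|M|.
Proof.
rewrite [leRHS]/Num.Def.normr /= mx_normrE.
exact: (le_bigmax _ (fun ij => `|M ij.1 ij.2|) (i, j)).
Qed.

Lemma mx_norm_le (R : realType) p q (M : 'M[R]_(p, q)) (r : R) :
  0 <= r -> (forall i j, `|M i j| <= r) -> `|M| <= r.
Proof.
by move=> r0 H; rewrite /Num.Def.normr /= mx_normrE; apply: bigmax_le.
Qed.

Lemma mulmx_entry_le (R : realType) n (M N : 'M[R]_n) (a b : R) i j :
  (forall i j, `|M i j| <= a) -> (forall i j, `|N i j| <= b) ->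
  `|(M *m N) i j| <= n%:R * (a * b).
Proof.
move=> Ma Nb; rewrite mxE; apply: le_trans (ler_norm_sum _ _ _) _.
have <- : \sum_(k < n) (a * b) = n%:R * (a * b) by rewrite sumr_const card_ord mulr_natl.
by apply: ler_sum => k _; rewrite normrM; apply: ler_pM.
Qed.

(** A bootstrap on [M^-1 - 1 = - (M - 1) M^-1]. As [n * d <= 1/2], the norm [N] of the inverse
    satisfies [N <= 1 + N / 2], hence [N <= 2]; then the right-hand side is at most
    [2 * n * d <= e]. *)
Lemma inverse_near_identity (R : realType) n (M : 'M[R]_n) (e : R) :
  0 < e <= 1 -> M \in unitmx ->
  (forall i j, `|M i j - (i == j)%:R| <= e / (2 * (n%:R + 1))) ->
  forall i j, `|invmx M i j - (i == j)%:R| <= e.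
Proof.
move=> /andP[e0 e1] uM; set d := e / _ => H.
have n0 : 0 <= n%:R :> R by exact: ler0n.
have dE : d * (2 * (n%:R + 1)) = e by rewrite /d divfK // gt_eqF // mulr_gt0 // ltr_wpDl.
have d0 : 0 < d by rewrite /d divr_gt0 // mulr_gt0 // ltr_wpDl.
have E i j : invmx M i j - (i == j)%:R = - ((M - 1%:M) *m invmx M) i j.
  have -> : (M - 1%:M) *m invmx M = 1%:M - invmx M by rewrite mulmxBl mulmxV // mul1mx.
  by rewrite !mxE opprB.
have Hd i j : `|(M - 1%:M) i j| <= d by rewrite !mxE; exact: H.
pose N := `|invmx M|.
have N0 : 0 <= N by exact: normr_ge0.
have B i j : `|invmx M i j - (i == j)%:R| <= n%:R * (d * N).
  by rewrite E normrN; apply: mulmx_entry_le => // a b; exact: mx_entry_le_norm.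
have N2 : N <= 2.
  have : N <= 1 + n%:R * (d * N).
    apply: mx_norm_le => [|i j]; first by rewrite addr_ge0 // mulr_ge0 // mulr_ge0 // ltW.
    rewrite -[invmx M i j](subrK (i == j)%:R) addrC; apply: le_trans (ler_normD _ _) _.
    by apply: lerD => //; case: (i == j); rewrite ?normr1 ?normr0.
  have : n%:R * d <= 2^-1 by nra.
  by nra.
by move=> i j; apply: le_trans (B i j) _; nra.
Qed.

(** * Curvature decay of an asymptotically Euclidean metric *)

Section AsymptoticMetric.
Context {R : realType} {n : nat}.
Variables (rho tau : R) (G : 'rV[R]_n -> 'M[R]_n).
Local Notation U := [set x : 'rV[R]_n | rho < enorm x].
Hypothesis tau0 : 0 < tau.
Hypothesis sG : smx U G.
Hypothesis symG : forall x, U x -> (G x)^T = G x.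
Hypothesis pG : forall x, U x -> posdef (G x).
Hypothesis dG_decay : forall i j, bigO_derivs 2 tau U (fun x => G x i j - (i == j)%:R).
Implicit Types (x : 'rV[R]_n) (i j k l : 'I_n).

Let oU : open U := @open_enorm_gt R n rho.
Let uG x : U x -> G x \in unitmx.
Proof. by move=> /pG; exact: posdef_unit. Qed.
Local Notation Ginv := (Ginv G).

Lemma bO_partials (s : seq 'I_n) i j : (size s <= 2)%N ->
  bO (tau + (size s)%:R) (partials s (fun x => G x i j - (i == j)%:R)).
Proof.
move=> s2; have [C C0 H] := dG_decay i j.
exists C, (Num.max 1 (rho + 1)); split; [exact: ltW|by rewrite le_max lexx|].
move=> x; rewrite ge_max => /andP[_ xr]; rewrite opprD; apply: H => //=.
by apply: lt_le_trans xr; rewrite ltrDl.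
Qed.

Lemma bO_dev i j : bO tau (fun x => G x i j - (i == j)%:R).
Proof. by have := @bO_partials [::] i j isT; rewrite addr0. Qed.

Let sd i j : smooth_on U (fun x => G x i j - (i == j)%:R).
Proof. exact: (smoothB oU (sG i j) (smooth_cst _)). Qed.

Let pdev k i j x : U x ->
  partial k (fun x => G x i j - (i == j)%:R) x = partial k (fun x => G x i j) x.
Proof.
move=> Ux; have dc : derivable (fun=> - (i == j)%:R : R) x 'e_k by exact: derivable_cst.
by rewrite (partialD (smooth_derivable (sG i j) Ux) dc) partial_cst addr0.
Qed.

Lemma symbol_dG k i j : symbol (tau + 1) (partial k (fun x => G x i j)).
Proof.
split=> [|l].
  exact: (bO_extU (pdev k i j) (@bO_partials [:: k] i j isT)).
have E x : U x -> partial l (partial k (fun x => G x i j - (i == j)%:R)) x =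
    partial l (partial k (fun x => G x i j)) x.
  move=> Ux; apply: partial_near; exact: (open_near oU Ux (pdev k i j)).
have H := bO_extU E (@bO_partials [:: l; k] i j isT).
by rewrite -addrA; exact: H.
Qed.

Lemma Ginv_near (e : R) : 0 < e <= 1 ->
  exists2 r : R, 1 <= r & forall x, r <= enorm x -> forall i j, `|Ginv x i j - (i == j)%:R| <= e.
Proof.
move=> e01; have [e0 _] := andP e01; set d := e / (2 * (n%:R + 1)).
have d0 : 0 < d by rewrite divr_gt0 // mulr_gt0 // ltr_wpDl.
have /boolp.choice[r Hr] : forall p : 'I_n * 'I_n, exists r : R, 1 <= r /\
    forall x, r <= enorm x -> `|G x p.1 p.2 - (p.1 == p.2)%:R| <= d.
  by move=> p; have [r r1 H] := bO_small tau0 d0 (bO_dev p.1 p.2); exists r.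
(* The sum of absolute values is an upper bound for the finitely many radii. *)
exists (Num.max 1 (rho + 1) + \sum_p `|r p|).
  by rewrite -[leLHS]addr0 lerD // ?le_max ?lexx // sumr_ge0.
move=> x xr i j.
have s0 : 0 <= \sum_p `|r p| by rewrite sumr_ge0.
have Ux : U x.
  have : Num.max 1 (rho + 1) <= enorm x by apply: le_trans xr; rewrite lerDl.
  by rewrite ge_max => /andP[_]; apply: lt_le_trans; rewrite ltrDl.
apply: (inverse_near_identity e01 (uG Ux)) => a b.
have [_ ->] // := Hr (a, b).
apply: le_trans xr; apply: le_trans (ler_norm _) _.
rewrite -[leLHS]add0r; apply: lerD; first by rewrite le_max ler01.
by rewrite (bigD1 (a, b)) //= lerDl sumr_ge0.
Qed.

Lemma bO_Ginv i j : bO 0 (fun x => Ginv x i j).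
Proof.
have [|r r1 H] := Ginv_near (e := 1); first by rewrite ltr01 lexx.
exists 2, r; split=> // x xr; rewrite oppr0 powRr0 mulr1.
rewrite -[Ginv x i j](subrK (i == j)%:R); apply: le_trans (ler_normD _ _) _.
rewrite -[leRHS]/(1 + 1); apply: lerD; first exact: H.
by case: (i == j); rewrite ?normr1 ?normr0.
Qed.

Lemma bO_christoffel l i j : bO (tau + 1) (christoffel G l i j).
Proof.
apply: bO_scale; apply: bO_sum => p; rewrite -[tau + 1]add0r; apply: bOM; first exact: bO_Ginv.
by apply: bOB; [apply: bOD|]; apply (symbol_dG _ _ _).1.
Qed.

(** The derivative is expressed by Christoffel symbols through [dGinv], and their decay follows
    already from the bound on [Ginv]. The true order [tau + 1] is weakened to 1. *)
Lemma symbol_Ginv i j : symbol 0 (fun x => Ginv x i j).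
Proof.
split; first exact: bO_Ginv.
move=> k.
have H : bO (tau + 1) (fun x => - (\sum_p christoffel G i k p x * Ginv x p j
    + \sum_p Ginv x i p * christoffel G j k p x)).
  apply: bON; apply: bOD; apply: bO_sum => p.
    by rewrite -[tau + 1]addr0; apply: bOM; [exact: bO_christoffel | exact: bO_Ginv].
  by rewrite -[tau + 1]add0r; apply: bOM; [exact: bO_Ginv | exact: bO_christoffel].
rewrite add0r; apply: (bOW (s := tau + 1)); first by rewrite lerDr ltW.
apply: (bO_extU (rho := rho) _ H) => x Ux.
rewrite -dmxE (dGinv oU sG symG uG k Ux) oppmxE addmxE; congr (- (_ + _)).
  by rewrite mxE; apply: eq_bigr => p _; rewrite [cmx G k x i p]mxE.
by rewrite mxE; apply: eq_bigr => p _; rewrite [_^T p j]mxE [cmx G k x j p]mxE.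
Qed.

Lemma symbol_christoffel l i j : symbol (tau + 1) (christoffel G l i j).
Proof.
have sg := smooth_Ginv oU sG uG.
have sp a b c : smooth_on U (partial a (fun y => G y b c)) by exact: smooth_partial (sG b c).
have sD a b c p q r s t w :=
  smoothB oU (smoothD oU (sp a b c) (sp p q r)) (sp s t w).
have H : symbol (0 + (0 + (tau + 1))) (fun x => 2^-1 * \sum_p Ginv x l p *
  (partial i (fun y => G y j p) x + partial j (fun y => G y i p) x
   - partial p (fun y => G y i j) x)).
  apply: (symbolM _ _ (symbol_cst _)); first exact: smooth_cst.
    by apply: smooth_sum oU _ => p; exact: (smoothM oU (sg l p) (sD _ _ _ _ _ _ _ _ _)).
  apply: symbol_sum => p; first exact: (smoothM oU (sg l p) (sD _ _ _ _ _ _ _ _ _)).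
  apply: (symbolM (sg l p) (sD _ _ _ _ _ _ _ _ _) (symbol_Ginv l p)).
  apply: (symbolD (smoothD oU (sp _ _ _) (sp _ _ _)) (smoothN oU (sp _ _ _))).
    exact: (symbolD (sp _ _ _) (sp _ _ _) (symbol_dG _ _ _) (symbol_dG _ _ _)).
  exact: (symbolN (sp _ _ _) (symbol_dG _ _ _)).
by rewrite !add0r in H.
Qed.

(** The derivatives of the Christoffel symbols dominate: the quadratic terms have order
    [2 * tau + 2]. *)
Lemma bO_ricci i j : bO (tau + 2) (ricci G i j).
Proof.
have t2 : tau + 2 = tau + 1 + 1 by ring.
apply: bO_sum => l; apply: bOD.
  by apply: bOB; rewrite t2; apply (symbol_christoffel _ _ _).2.
apply: bO_sum => p; apply: (bOW (s := (tau + 1) + (tau + 1))); first by move: tau0; lra.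
by apply: bOB; apply: bOM; exact: bO_christoffel.
Qed.

Lemma bO_scal : bO (tau + 2) (scal G).
Proof.
have H : bO (tau + 2) (fun x => \sum_i \sum_k Ginv x i k * ricci G k i x).
  apply: bO_sum => i; apply: bO_sum => k; rewrite -[tau + 2]add0r.
  by apply: bOM; [exact: bO_Ginv | exact: bO_ricci].
apply: (bO_extU (rho := rho) _ H) => x Ux; rewrite /scal /mxtrace; apply: eq_bigr => i _.
by rewrite mxE; apply: eq_bigr => k _; rewrite [ric _ _ _ _]mxE.
Qed.

(** Far out the entries of [Ginv] differ from those of the identity by at most [e]. By 2 |v_i v_j|
    <= v_i^2 + v_j^2 this changes the quadratic form by at most [e * n * S <= S / 2]. *)
Lemma Ginv_lower_bound :
  exists2 r : R, 1 <= r & forall x, r <= enorm x -> forall v : 'cV[R]_n,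
    \sum_k v k 0 ^+ 2 <= 2 * (v^T *m Ginv x *m v) 0 0.
Proof.
pose e : R := (2 * (n%:R + 1))^-1.
have n0 : 0 <= n%:R :> R by exact: ler0n.
have e0 : 0 < e by rewrite invr_gt0 mulr_gt0 // ltr_wpDl.
have eE : e * (2 * (n%:R + 1)) = 1 by rewrite mulVf // gt_eqF // mulr_gt0 // ltr_wpDl.
have e1 : e <= 1 by nra.
have [|r r1 H] := Ginv_near (e := e); first by rewrite e0.
exists r => // x xr v.
set S := \sum_k _.
have S0 : 0 <= S by apply: sumr_ge0 => k _; rewrite sqr_ge0.
have -> : (v^T *m Ginv x *m v) 0 0 =
    S + \sum_i \sum_j (Ginv x i j - (i == j)%:R) * (v i 0 * v j 0).
  have -> : (v^T *m Ginv x *m v) 0 0 = \sum_i \sum_j Ginv x i j * (v i 0 * v j 0).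
    rewrite -{2}[v]trmxK qformE; apply: eq_bigr => i _; apply: eq_bigr => j _.
    by rewrite [v^T _ _]mxE [v^T _ _]mxE mulrA.
  rewrite /S -big_split /=; apply: eq_bigr => i _.
  have -> : v i 0 ^+ 2 = \sum_j (i == j)%:R * (v i 0 * v j 0).
    rewrite (bigD1 i) //= eqxx mul1r big1 ?addr0 // => j ji.
    by rewrite eq_sym (negbTE ji) mul0r.
  by rewrite -big_split /=; apply: eq_bigr => j _; ring.
set T := \sum_i _.
suff : `|T| <= e * (n%:R * S).
  have en : e * n%:R <= 2^-1 by move: eE e0; lra.
  have enS : e * (n%:R * S) <= 2^-1 * S by rewrite mulrA; exact: ler_wpM2r.
  by rewrite ler_norml => /andP[T1 _]; move: T1 enS S0; move: (e * (n%:R * S)) => q; move: S T => s t; lra.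
have -> : e * (n%:R * S) = \sum_i \sum_(j < n) e * ((v i 0 ^+ 2 + v j 0 ^+ 2) / 2).
  have -> : n%:R * S = \sum_i \sum_(j < n) ((v i 0 ^+ 2 + v j 0 ^+ 2) / 2).
    have A1 : \sum_i \sum_(j < n) v i 0 ^+ 2 = n%:R * S.
      by rewrite mulr_sumr; apply: eq_bigr => i _; rewrite sumr_const card_ord mulr_natl.
    have A2 : \sum_(i < n) \sum_j v j 0 ^+ 2 = n%:R * S.
      by rewrite sumr_const card_ord mulr_natl.
    under [RHS]eq_bigr do rewrite -mulr_suml big_split /=.
    rewrite -mulr_suml big_split /= A1 A2; lra.
  by rewrite mulr_sumr; apply: eq_bigr => i _; rewrite mulr_sumr.
apply: le_trans (ler_norm_sum _ _ _) _; apply: ler_sum => i _.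
apply: le_trans (ler_norm_sum _ _ _) _; apply: ler_sum => j _.
rewrite normrM; apply: ler_pM => //; first exact: H.
move: (v i 0) (v j 0) => a b; have := sqr_ge0 (a + b); have := sqr_ge0 (a - b).
by rewrite ler_norml !expr2 => H1 H2; apply/andP; split; lra.
Qed.

End AsymptoticMetric.

Lemma segment_MVT (R : realType) n (U : set 'rV[R]_n) (f : 'rV[R]_n -> R) (x v : 'rV[R]_n) :
  open U -> smooth_on U f -> (forall t : R, 0 <= t <= 1 -> U (x + t *: v)) ->
  exists2 c : R, 0 <= c <= 1 & f (x + v) - f x = \sum_k v 0 k * partial k f (x + c *: v).
Proof.
move=> oU sf UU; pose h (t : R) := f (x + t *: v).
pose dh (t : R) := \sum_k v 0 k * partial k f (x + t *: v).
have dhP (t : R) : 0 <= t <= 1 -> is_derive t 1 h (dh t).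
  by move=> /UU Ut; exact: (smooth_is_derive oU sf Ut).
have [t|t|c] := @MVT_segment R h dh 0 1 ler01.
- by rewrite in_itv /= => /andP[t0 t1]; apply: dhP; rewrite !ltW.
- apply: derivable_within_continuous => s; rewrite in_itv /= => /dhP ds; exact: ex_derive.
rewrite in_itv /= => c01; rewrite /h scale1r scale0r addr0 subr0 mulr1 => E.
by exists c.
Qed.

(** * Growth of u and decay of its gradient on an end *)

Section EndDecay.
Context {R : realType} {n : nat}.
Variables (rho tau m : R) (G : 'rV[R]_n -> 'M[R]_n) (u : 'rV[R]_n -> R).
Local Notation U := [set x : 'rV[R]_n | rho < enorm x].
Hypothesis n2 : (1 < n)%N.
Hypothesis tau0 : 0 < tau.
Hypothesis sG : smx U G.
Hypothesis symG : forall x, U x -> (G x)^T = G x.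
Hypothesis pG : forall x, U x -> posdef (G x).
Hypothesis dG_decay : forall i j, bigO_derivs 2 tau U (fun x => G x i j - (i == j)%:R).
Hypothesis su : smooth_on U u.
Hypothesis u0 : forall x, U x -> 0 < u x.
Hypothesis m1 : 1 < m.
Hypothesis qe : forall x, U x -> forall i j, hessian G u i j x = u x / m * ricci G i j x.
Implicit Types (x y : 'rV[R]_n) (i j k l : 'I_n).

Let oU : open U := @open_enorm_gt R n rho.
Let uG x : U x -> G x \in unitmx.
Proof. by move=> /pG; exact: posdef_unit. Qed.
Local Notation Ginv := (Ginv G).
Let m0 : 0 < m. Proof. exact: lt_trans ltr01 m1. Qed.

Lemma other_index j : exists i, i != j.
Proof.
apply/existsP; apply: contraT; rewrite negb_exists => /forallP H.
have : (#|'I_n| <= 1)%N.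
  apply/card_le1_eqP => a b _ _.
  by have := (H a, H b); rewrite !negbK => -[/eqP-> /eqP->].
by rewrite card_ord leqNgt n2.
Qed.

(** Beyond radius [n * |rho|] some coordinate [j] exceeds [|rho|] in absolute value. All other
    coordinates are moved to [N] while [x 0 j] keeps the segment outside the ball; then coordinate
    [j] is moved to [N], another coordinate being already there. *)
Lemma const_of_partial0 (f : 'rV[R]_n -> R) : smooth_on U f ->
  (forall k x, U x -> partial k f x = 0) ->
  exists c, forall x, n%:R * `|rho| < enorm x -> f x = c.
Proof.
move=> sf f0; pose N := `|rho| + 1.
have rhoN : rho < N by rewrite /N (le_lt_trans (ler_norm _)) // ltrDl.
have N0 : 0 <= N by rewrite addr_ge0.
exists (f (\row_i N)) => x /(enorm_coord_gt (normr_ge0 rho))[j xj].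
have seg y v : (forall t : R, 0 <= t <= 1 -> U (y + t *: v)) -> f y = f (y + v).
  move=> Us; have [c c01 E] := segment_MVT oU sf Us.
  apply/esym/eqP; rewrite -subr_eq0 E big1 // => k _.
  by rewrite f0 ?mulr0 //; exact: Us.
pose x' : 'rV[R]_n := \row_i (if i == j then x 0 j else N).
have -> : f x = f x'.
  rewrite -[x'](subrK x) addrC; apply: seg => t _ /=.
  apply: le_lt_trans (ler_norm rho) _; apply: lt_le_trans xj _.
  by have := coord_le_enorm (x + t *: (x' - x)) j; rewrite !mxE eqxx subrr mulr0 addr0.
have [i ij] := other_index j.
rewrite -[\row_i N](subrK x') addrC; apply: seg => t _ /=.
apply: lt_le_trans rhoN _.
have := coord_le_enorm (x' + t *: (\row_i N - x')) i.
by rewrite !mxE (negbTE ij) subrr mulr0 addr0 ger0_norm.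
Qed.

(** Since scal decays faster than r^-2, the curvature term in the bound for |grad u|^2 is a small
    multiple of (u / r)^2 far out. The factor [1 / (2 n)] is chosen for integration along rays:
    summed over the coordinates it gives u' <= n C + u / (2 r), whose homogeneous solutions grow
    only like r^(1/2). *)
Lemma gradient_bound : exists C r : R, [/\ 0 <= C, 1 <= r, rho < r &
  forall x, r <= enorm x -> forall k, `|partial k u x| <= C + u x / (2 * n%:R * enorm x)].
Proof.
have [c Hc] := const_of_partial0 (smooth_kim_kim m oU sG pG su)
   (fun k x Ux => partial_kim_kim oU sG symG pG su m1 qe k Ux).
have [r1 r11 H1] := Ginv_lower_bound tau0 pG dG_decay.
have [D [r2 [D0 r21 H2]]] := bO_scal tau0 sG symG pG dG_decay.
have n0 : 0 < n%:R :> R by rewrite ltr0n (ltn_trans _ n2).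
(* Solving the first integral for the gradient gives 2 |grad u|^2 = a (c - u^2 scal / m). *)
pose a := 2 / (m - 1).
have a0 : 0 < a by rewrite divr_gt0 // subr_gt0.
(* The square of the factor [1 / (2 n)] in the conclusion. *)
pose e := (4 * n%:R * n%:R)^-1 : R.
have e0 : 0 < e by rewrite invr_gt0 !mulr_gt0.
have b0 : 0 <= a * D / m.
  by apply: mulr_ge0; [apply: mulr_ge0 => //; exact: ltW | rewrite invr_ge0 ltW].
have e'0 : 0 < e / (a * D / m + 1) by rewrite divr_gt0 // ltr_wpDl.
have [r3 r31 H3] := powRN_small tau0 e'0.
pose C1 := a * `|c|.
have C10 : 0 <= C1 by rewrite mulr_ge0 // ltW.
pose r := Num.max (Num.max r1 r2) (Num.max r3 (Num.max (rho + 1) (n%:R * `|rho| + 1))).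
(* Adding 1 avoids a square root: [C1 + b^2 <= (C1 + 1 + b)^2] for nonnegative [C1] and [b]. *)
exists (C1 + 1), r; split.
- exact: addr_ge0.
- by rewrite !le_max r11.
- by rewrite !lt_max [rho < rho + 1]ltrDl ltr01 !orbT.
move=> x; rewrite !ge_max => /andP[/andP[xr1 xr2] /andP[xr3 /andP[xr4 xr5]]] k.
have Ux : U x by apply: lt_le_trans xr4; rewrite ltrDl.
have E0 : 0 < enorm x by apply: lt_le_trans xr1; exact: lt_le_trans ltr01 r11.
have ux := u0 Ux.
set E := enorm x in xr1 xr2 xr3 xr4 xr5 E0 *.
have kx : kim_kim G u m x = c by apply: Hc; apply: lt_le_trans xr5; rewrite ltrDl.
have P1 : partial k u x ^+ 2 <= 2 * gradsq G u x.
  apply: le_trans (H1 x xr1 (du u x)); rewrite (bigD1 k) //= [du u x k 0]mxE lerDl.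
  by apply: sumr_ge0 => j _; rewrite sqr_ge0.
have P2 : 2 * gradsq G u x = a * (c - u x * u x / m * scal G x).
  move: kx; rewrite /kim_kim (lap_scal qe Ux) => <-.
  by rewrite /a; field; rewrite !gt_eqF ?subr_gt0.
have P3 := H2 x xr2.
have P4 := H3 E xr3.
have P5 : E `^ (- (tau + 2)) = E `^ (- tau) / (E * E).
  rewrite opprD powRD ?(gt_eqF E0) ?implybT // (powR_invn _ (ltW E0)) expr2 //.
have Q : partial k u x ^+ 2 <= C1 + (u x / (2 * n%:R * E)) ^+ 2.
  apply: le_trans P1 _; rewrite P2 mulrBr; apply: lerD.
    by rewrite /C1 ler_wpM2l ?ler_norm // ltW.
  have uum : 0 <= u x * u x / m.
    by apply: mulr_ge0; [apply: mulr_ge0; exact: ltW | rewrite invr_ge0 ltW].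
  apply: le_trans (ler_norm _) _; rewrite normrN normrM (gtr0_norm a0) normrM (ger0_norm uum).
  have S : `|scal G x| <= D * (e / (a * D / m + 1)) / (E * E).
    apply: le_trans P3 _; rewrite -/E P5 mulrA ler_wpM2r ?invr_ge0 ?mulr_ge0 ?(ltW E0) //.
    exact: ler_wpM2l.
  have S' : a * (u x * u x / m * `|scal G x|) <=
      a * (u x * u x / m * (D * (e / (a * D / m + 1)) / (E * E))).
    apply: ler_wpM2l; first exact: ltW.
    exact: ler_wpM2l S.
  apply: le_trans S' _.
  have -> : a * (u x * u x / m * (D * (e / (a * D / m + 1)) / (E * E))) =
     (a * D / m / (a * D / m + 1)) * (e * (u x * u x / (E * E))).
    field; rewrite !gt_eqF // ltr_wpDl // mulr_ge0 // ltW //.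
  have -> : (u x / (2 * n%:R * E)) ^+ 2 = e * (u x * u x / (E * E)).
    by rewrite /e expr2; field; rewrite !gt_eqF.
  rewrite ger_pMl; last by rewrite !mulr_gt0 // invr_gt0 mulr_gt0.
  by rewrite ler_pdivrMr ?ltr_wpDl // mul1r lerDl.
have b'0 : 0 <= u x / (2 * n%:R * E) by rewrite divr_ge0 ?(ltW ux) // !mulr_ge0 // ltW.
rewrite -(@ler_pXn2r _ 2) ?nnegrE ?addr_ge0 // real_normK ?num_real //.
apply: le_trans Q _; move: (u x / _) b'0 => b b'0; rewrite !expr2; nra.
Qed.

Lemma bounded_on_sphere (r : R) : rho < r -> exists B : R, forall y, enorm y = r -> u y <= B.
Proof.
move=> rr; pose S := [set y : 'rV[R]_n | enorm y = r].
have [S0|S0] := pselect (S !=set0); last first.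
  by exists 0 => y yr; case: S0; exists y.
have cS : compact S.
  apply: bounded_closed_compact.
    exists r; split; first exact: num_real.
    move=> M rM y /= yr; apply: norm_le_coord => [|k].
      by apply: le_trans (ltW rM); rewrite -yr enorm_ge0.
    by apply: le_trans (coord_le_enorm y k) _; rewrite yr ltW.
  have -> : S = enorm @^-1` [set r] by [].
  by apply: closed_comp => [y _|]; [exact: enorm_continuous | exact: closed_eq].
have cu : {within S, continuous u}.
  apply/continuous_in_subspaceT => y; rewrite inE => yr.
  by apply: (smooth_continuous su); rewrite /= yr.
have [c _ H] := EVT_max_rV S0 cS cu.
by exists (u c) => y yr; apply: H; rewrite inE.
Qed.

(* Along a ray, u s^(-1/2) - 2 n C s^(1/2) is nonincreasing in the radius s. *)
Lemma linear_growth : bO (-1) u.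
Proof.
have [C [r [C0 r1 rr H]]] := gradient_bound.
have [B HB] := bounded_on_sphere rr.
have r0 : 0 < r by exact: lt_le_trans ltr01 r1.
have n0 : 0 < n%:R :> R by rewrite ltr0n (ltn_trans _ n2).
exists (2 * n%:R * C + `|B|), r; split=> // [|x xr]; first by rewrite addr_ge0 // !mulr_ge0 // ltW.
have E0 : 0 < enorm x by exact: lt_le_trans xr.
rewrite opprK powRr1 ?(ltW E0) //.
set E := enorm x in xr E0 *.
have Ux : U x by exact: lt_le_trans xr.
rewrite (gtr0_norm (u0 Ux)).
pose th : 'rV[R]_n := E^-1 *: x.
have eth (s : R) : 0 <= s -> enorm (0 + s *: th) = s.
  move=> s0; rewrite add0r !enormZ -/E (ger0_norm s0) ger0_norm ?invr_ge0 ?(ltW E0) //.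
  by rewrite mulVf ?gt_eqF // mulr1.
have th1 k : `|th 0 k| <= 1.
  apply: le_trans (coord_le_enorm th k) _; have := eth 1 ler01.
  by rewrite scale1r add0r => ->.
pose f (s : R) := u (0 + s *: th).
pose df (s : R) := \sum_k th 0 k * partial k u (0 + s *: th).
have fU (s : R) : r <= s -> U (0 + s *: th).
  by move=> rs; rewrite /= eth ?(lt_le_trans rr) // (le_trans (ltW r0)).
have dfP (s : R) : r <= s -> is_derive s 1 f (df s).
  by move=> /fU Us; exact: (smooth_is_derive oU su Us).
have dfb (s : R) : r <= s -> df s <= n%:R * C + f s / (2 * s).
  move=> rs; have s0 : 0 < s by exact: lt_le_trans rs.
  have -> : n%:R * C + f s / (2 * s) = \sum_(k < n) (C + f s / (2 * n%:R * s)).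
    by rewrite sumr_const card_ord -mulr_natl; field; rewrite !gt_eqF.
  apply: ler_sum => k _; apply: le_trans (ler_norm _) _; rewrite normrM.
  apply: le_trans (_ : 1 * `|partial k u (0 + s *: th)| <= _); first exact: ler_wpM2r.
  rewrite mul1r; have es := eth s (ltW s0).
  by have := H (0 + s *: th); rewrite es => /(_ rs k).
pose F (s : R) := f s * (Num.sqrt s)^-1 - 2 * (n%:R * C) * Num.sqrt s.
pose dF (s : R) := (f s * (- (Num.sqrt s) ^- 2 * (2 * Num.sqrt s)^-1) + (Num.sqrt s)^-1 * df s)
   - 2 * (n%:R * C) * (2 * Num.sqrt s)^-1.
have dFP (s : R) : r <= s -> is_derive s 1 F (dF s).
  move=> rs; have s0 : 0 < s by exact: lt_le_trans rs.
  have sq0 : Num.sqrt s != 0 by rewrite gt_eqF // sqrtr_gt0.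
  have d1 := dfP s rs.
  have d2 := is_derive1_sqrt s0.
  have d3 : is_derive s 1 (fun t => (Num.sqrt t)^-1) (- (Num.sqrt s) ^- 2 * (2 * Num.sqrt s)^-1).
    have [e1 e2] := d2; apply: DeriveDef; first exact: derivableV.
    by rewrite (deriveV sq0 e1) e2.
  exact: (is_deriveB (is_deriveM d1 d3) (is_deriveZ (2 * (n%:R * C)) d2)).
have dF0 (s : R) : r <= s -> dF s <= 0.
  move=> rs; have s0 : 0 < s by exact: lt_le_trans rs.
  have ss : Num.sqrt s * Num.sqrt s = s by rewrite -expr2 sqr_sqrtr // ltW.
  have q0 : 0 < Num.sqrt s by rewrite sqrtr_gt0.
  have ab : df s <= n%:R * C + f s / (2 * (Num.sqrt s * Num.sqrt s)).
    by rewrite ss; exact: dfb.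
  rewrite /dF; move: (Num.sqrt s) q0 (f s) (df s) ab => q q0 a b ab.
  have -> : a * (- q ^- 2 * (2 * q)^-1) + q^-1 * b - 2 * (n%:R * C) * (2 * q)^-1 =
     q^-1 * (b - (n%:R * C + a / (2 * (q * q)))).
    by rewrite -exprVn; field; rewrite gt_eqF.
  by rewrite pmulr_rle0 ?invr_gt0 // subr_le0.
have FE : F E <= F r.
  have [s||c cI] := @MVT_segment R F dF r E xr.
  - by rewrite in_itv /= => /andP[rs _]; apply: dFP; exact: ltW.
  - apply: derivable_within_continuous => s; rewrite in_itv /= => /andP[rs _].
    by have ds := dFP s rs; exact: ex_derive.
  move: cI; rewrite in_itv /= => /andP[rc _] EE.
  by rewrite -subr_le0 EE mulr_le0_ge0 ?dF0 // subr_ge0.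
have fE : f E = u x by rewrite /f /th add0r scalerA mulfV ?gt_eqF // scale1r.
have fr : f r <= `|B|.
  by apply: le_trans (ler_norm B); apply: HB; rewrite eth // ltW.
move: FE; rewrite /F fE.
have qE : 0 < Num.sqrt E by rewrite sqrtr_gt0.
have qr : 1 <= Num.sqrt r by rewrite -sqrtr1 ler_wsqrtr.
have EE : Num.sqrt E * Num.sqrt E = E by rewrite -expr2 sqr_sqrtr // ltW.
have qE1 : 1 <= Num.sqrt E by rewrite -sqrtr1 ler_wsqrtr // (le_trans r1).
have K0 : 0 <= n%:R * C by rewrite mulr_ge0 // ltW.
have f1 : f r * (Num.sqrt r)^-1 <= `|B|.
  rewrite ler_pdivrMr ?(lt_le_trans ltr01) //; apply: le_trans fr _.
  by rewrite ler_peMr.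
rewrite -[X in _ -> _ <= _ * X]EE; move: (Num.sqrt r) qr f1 => p p1; move: (f r * p^-1) => w w1.
move: (Num.sqrt E) qE qE1 (u x) `|B| (normr_ge0 B) w1 => q q0 q1 v b b0 w1.
have -> : 2 * n%:R * C = 2 * (n%:R * C) by rewrite mulrA.
move: (n%:R * C) K0 => K K0 h.
have {}h : v / q <= 2 * K * q + b.
  have : 0 <= 2 * K * p by rewrite !mulr_ge0 // (le_trans ler01).
  lra.
move: h; rewrite ler_pdivrMr // => h.
have : 0 <= b * q * (q - 1) by rewrite mulr_ge0 ?subr_ge0 // mulr_ge0 // ltW.
lra.
Qed.

Lemma bO_gradient0 k : bO 0 (partial k u).
Proof.
have [C [r [C0 r1 rr H]]] := gradient_bound.
have [D [r' [D0 r'1 H']]] := linear_growth.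
have n0 : 0 < n%:R :> R by rewrite ltr0n (ltn_trans _ n2).
exists (C + D), (Num.max r r'); split; [exact: addr_ge0|by rewrite le_max r1|].
move=> x; rewrite ge_max => /andP[xr xr']; rewrite oppr0 powRr0 mulr1.
apply: le_trans (H x xr k) _; rewrite lerD2l.
have E0 : 0 < enorm x by apply: lt_le_trans xr; exact: lt_le_trans r1.
have n1' : 1 <= n%:R :> R by rewrite ler1n ltnW.
have n1 : 1 <= 2 * n%:R :> R by lra.
rewrite ler_pdivrMr ?mulr_gt0 //; have := H' x xr'; rewrite opprK powRr1 ?(ltW E0) // => h.
apply: le_trans (ler_norm _) _; apply: le_trans h _; apply: ler_wpM2l => //.
by apply: ler_peMl => //; exact: ltW.
Qed.

(** Besides Hess u = u Ric / m there is a Christoffel term, which has the same order because the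
    gradient is already known to be bounded. *)
Lemma bO_second_partials i k : bO (tau + 1) (partial i (partial k u)).
Proof.
have H1 : bO (tau + 1) (fun x => m^-1 * (u x * ricci G i k x)).
  apply: bO_scale; have -> : tau + 1 = -1 + (tau + 2) by ring.
  by apply: bOM; [exact: linear_growth | exact: (bO_ricci tau0 sG symG pG dG_decay)].
have H2 : bO (tau + 1) (fun x => \sum_p christoffel G p i k x * partial p u x).
  apply: bO_sum => p; rewrite -[tau + 1]addr0.
  by apply: bOM; [exact: (bO_christoffel tau0 sG pG dG_decay) | exact: bO_gradient0].
apply: (bO_extU (rho := rho) _ (bOD H1 H2)) => x Ux.
have := qe Ux i k; rewrite /hessian => /eqP; rewrite subr_eq => /eqP ->.
by congr (_ + _); rewrite mulrC mulrAC.
Qed.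

(* Along both coordinate rays in the direction i from a point with x_i = 0, positivity of u bounds
   the slope of u from below, so d_i u = O(r^-tau) at this point; a general point is joined to
   such a point by two moves along coordinate axes. *)
Lemma bO_gradient i : bO tau (partial i u).
Proof.
have /boolp.choice[r HA] : forall p : 'I_n * 'I_n, exists r : R, exists C : R,
    [/\ 0 <= C, 1 <= r & forall x, r <= enorm x ->
      `|partial p.1 (partial p.2 u) x| <= C * enorm x `^ (- (tau + 1))].
  by move=> p; have [C [r H]] := bO_second_partials p.1 p.2; exists r, C.
have /boolp.choice[C HC] := HA.
pose D := \sum_p `|C p|.
pose r0 := Num.max (rho + 1) 1 + \sum_p `|r p|.
have r01 : 1 <= r0.
  by rewrite -[leLHS]addr0 lerD // ?le_max ?lexx ?orbT // sumr_ge0.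
have D0 : 0 <= D by rewrite sumr_ge0.
have rr0 : rho < r0.
  apply: (@lt_le_trans _ _ (rho + 1)); first by rewrite ltrDl.
  by rewrite -[leLHS]addr0 lerD // ?le_max ?lexx // sumr_ge0.
have HD a b x : r0 <= enorm x -> `|partial a (partial b u) x| <= D * enorm x `^ (- (tau + 1)).
  move=> xr; have [C0 _ H] := HC (a, b).
  apply: le_trans (H x _) _.
    apply: le_trans xr; rewrite -[leLHS]add0r lerD //.
      by rewrite le_max ler01 orbT.
    by apply: le_trans (ler_norm _) _; rewrite (bigD1 (a, b)) //= lerDl sumr_ge0.
  apply: ler_wpM2r; first exact: powR_ge0.
  by apply: le_trans (ler_norm _) _; rewrite /D (bigD1 (a, b)) //= lerDl sumr_ge0.
have t10 : 0 <= tau + 1 by rewrite addr_ge0 // ltW.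
have UE y : r0 <= enorm y -> U y by move=> yr; exact: lt_le_trans yr.
have step (y : 'rV[R]_n) (a s : R) j : r0 <= s -> `|a| <= s ->
    (forall c : R, 0 <= c <= 1 -> s <= enorm (y + (c * a) *: 'e_j)) ->
    `|partial i u (y + a *: 'e_j) - partial i u y| <= D * s `^ (- tau).
  move=> rs sa Hs; have s0 : 0 < s by apply: lt_le_trans rs; exact: lt_le_trans r01.
  have [c c01 ->] : exists2 c : R, 0 <= c <= 1 & partial i u (y + a *: 'e_j) - partial i u y =
     \sum_k (a *: 'e_j : 'rV[R]_n) 0 k * partial k (partial i u) (y + c *: (a *: 'e_j)).
    apply: (segment_MVT oU (smooth_partial i su)) => t t01; apply: UE.
    by apply: le_trans rs _; rewrite scalerA; exact: Hs.
  rewrite (bigD1 j) //= big1 ?addr0; last first.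
    by move=> k kj; rewrite !mxE (negbTE kj) mulr0 mul0r.
  rewrite !mxE !eqxx mulr1 scalerA normrM.
  have Hc := Hs c c01; rewrite -(powR_step tau s0) mulrCA; apply: ler_pM => //.
  apply: le_trans (HD j i _ (le_trans rs Hc)) _; apply: ler_wpM2l => //.
  exact: powRN_le.
(* The value at the start of a ray, where [w 0 = s / 2], of the correction
   [2 * D / tau * (w t) ^ (- tau)] introduced below, with [s ^ (- tau)] factored out. *)
pose K := 2 * D / tau * (2^-1) `^ (- tau).
have ray (z : 'rV[R]_n) (s sg : R) j : r0 <= s -> j != i -> s <= `|z 0 j| -> z 0 i = 0 ->
    sg * sg = 1 -> - (K * s `^ (- tau)) <= sg * partial i u z.
  move=> rs ji zj zi sg1; have s0 : 0 < s by apply: lt_le_trans rs; exact: lt_le_trans r01.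
  pose v : 'rV[R]_n := sg *: 'e_i.
  have sgn : `|sg| = 1.
    by apply/eqP; rewrite -(@eqrXn2 _ 2) // expr1n real_normK ?num_real // expr2 sg1.
  have vk k : v 0 k = if k == i then sg else 0.
    by rewrite !mxE eqxx /=; case: eqP; rewrite ?mulr1 ?mulr0.
  have e1 (t : R) : s <= enorm (z + t *: v).
    apply: le_trans zj _; apply: le_trans (coord_le_enorm _ j).
    by rewrite mxE [(t *: v) 0 j]mxE vk (negbTE ji) mulr0 addr0.
  have e2 (t : R) : t <= enorm (z + t *: v).
    apply: le_trans (ler_norm t) _; apply: le_trans (coord_le_enorm _ i).
    by rewrite mxE [(t *: v) 0 i]mxE vk eqxx zi add0r normrM sgn mulr1.
  have Uz (t : R) : U (z + t *: v) by apply: UE; exact: le_trans (e1 t).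
  have sumv (F : 'I_n -> R) : \sum_k v 0 k * F k = sg * F i.
    rewrite (bigD1 i) //= big1 ?addr0 ?vk ?eqxx // => k ki.
    by rewrite vk (negbTE ki) mul0r.
  pose f (t : R) := u (z + t *: v).
  pose p (t : R) := sg * partial i u (z + t *: v).
  have fP (t : R) : is_derive t 1 f (p t).
    by have := smooth_is_derive oU su (Uz t); rewrite sumv.
  have pP (t : R) : is_derive t 1 p (partial i (partial i u) (z + t *: v)).
    have H := smooth_is_derive oU (smooth_partial i su) (Uz t); rewrite sumv in H.
    have := is_deriveZ sg H; rewrite -[_ *: (sg * _)]/(sg * (sg * _)) mulrA sg1 mul1r.
    by [].
  (* The radius along the ray is at least [s] and at least [t], hence at least their mean [w t]. The
     bound [D * (w t) ^ (- (tau + 1))] for the derivative of [p] integrates explicitly, and [P] adds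
     to [p] the term that makes it nonincreasing. *)
  pose w (t : R) := 2^-1 * (s + t).
  have wP (t : R) : is_derive t 1 w (2^-1 : R).
    have H := is_deriveZ (2^-1 : R) (is_deriveD (is_derive_cst s t 1) (is_derive_id t 1)).
    by rewrite add0r [_ *: 1]mulr1 in H.
  pose P (t : R) := p t + 2 * D / tau * (w t) `^ (- tau).
  pose dP (t : R) := partial i (partial i u) (z + t *: v)
    + 2 * D / tau * (- tau * (w t) `^ (- tau - 1) * 2^-1).
  have PP (t : R) : 0 <= t -> is_derive t 1 P (dP t).
    move=> t0; have w0 : 0 < w t by rewrite mulr_gt0 ?invr_gt0 // ltr_pwDl.
    have H := is_derive1_comp (is_derive1_powR (- tau) w0) (wP t).
    exact: (is_deriveD (pP t) (is_deriveZ (2 * D / tau) H)).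
  have dP0 (t : R) : 0 <= t -> dP t <= 0.
    move=> t0; have w0 : 0 < w t by rewrite mulr_gt0 ?invr_gt0 // ltr_pwDl.
    rewrite /dP; have -> : 2 * D / tau * (- tau * (w t) `^ (- tau - 1) * 2^-1) =
       - (D * (w t) `^ (- (tau + 1))).
      by rewrite opprD; field; rewrite gt_eqF.
    rewrite subr_le0; apply: le_trans (ler_norm _) _.
    apply: le_trans (HD i i _ (le_trans rs (e1 t))) _; apply: ler_wpM2l => //.
    apply: powRN_le => //; rewrite /w.
    by have := e1 t; have := e2 t; move: (enorm _) => E; lra.
  have Pmono (t : R) : 0 <= t -> P t <= P 0.
    move=> t0; have [q||c cI E] := @MVT_segment R P dP 0 t t0.
    - by rewrite in_itv /= => /andP[q0 _]; apply: PP; exact: ltW.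
    - apply: derivable_within_continuous => q; rewrite in_itv /= => /andP[q0 _].
      by have dq := PP q q0; exact: ex_derive.
    move: cI; rewrite in_itv /= => /andP[c0 _].
    by rewrite -subr_le0 E mulr_le0_ge0 ?dP0 // subr0.
  have pP0 (t : R) : 0 <= t -> p t <= P 0.
    move=> t0; apply: le_trans (Pmono t t0); rewrite lerDl.
    by rewrite mulr_ge0 ?powR_ge0 // divr_ge0 ?(ltW tau0) // mulr_ge0.
  have fb (t : R) : 0 <= t -> f t <= f 0 + P 0 * t.
    move=> t0; have [|c cI E] := @MVT_segment R f p 0 t t0 (fun q _ => fP q).
      by apply: derivable_within_continuous => q _; have dq := fP q; exact: ex_derive.
    move: cI; rewrite in_itv /= => /andP[c0 _].
    rewrite -lerBlDl E subr0; apply: ler_wpM2r => //; exact: pP0.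
  have fpos (t : R) : 0 < f t by apply: u0; exact: Uz.
  (* A negative [P 0] would bound the slope of [u] by a negative constant along the whole ray, and
     [u] would have to be nonpositive by the time [f 0 / - P 0]. *)
  have P00 : 0 <= P 0.
    rewrite leNgt; apply/negP => Pn.
    have t0 : 0 <= f 0 / - P 0 by rewrite divr_ge0 ?oppr_ge0 ?ltW.
    have := fb _ t0; have := fpos (f 0 / - P 0).
    have -> : f 0 + P 0 * (f 0 / - P 0) = 0 by field; rewrite lt_eqF.
    by move=> h1 h2; have := lt_le_trans h1 h2; rewrite ltxx.
  move: P00; rewrite /P /p /w scale0r !addr0 (powRM _ _ (ltW s0)) ?invr_ge0 ?ler0n //.
  rewrite /K; move: (sg * _) (s `^ _) (_ `^ _) => a b c; lra.
have [j ji] := other_index i.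
exists (K + 2 * D), r0; split=> // [|x xr].
  rewrite addr_ge0 ?mulr_ge0 // ?powR_ge0 // ?invr_ge0 ?(ltW tau0) //.
have E0 : 0 < enorm x by apply: lt_le_trans xr; exact: lt_le_trans r01.
(* The sign is chosen so that moving along [sg * e_j] increases [|x 0 j|]. After a move of length
   [enorm x], coordinate [j] alone keeps the point far out while coordinate [i] is brought to 0. *)
pose sg : R := if 0 <= x 0 j then 1 else -1.
have sgx (c : R) : 0 <= c -> `|x 0 j + c * sg| = `|x 0 j| + c.
  move=> c0; rewrite /sg; case: ifP => [x0|/negbT]; first by rewrite mulr1 !ger0_norm // addr_ge0.
  rewrite -ltNge => x0; rewrite mulrN1 ltr0_norm ?ltr0_norm //; last lra.
  by rewrite opprD opprK.
have sgn : `|sg| = 1 by rewrite /sg; case: ifP; rewrite ?normrN normr1.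
pose y := x + (enorm x * sg) *: 'e_j.
have yj : enorm x <= `|y 0 j|.
  by rewrite !mxE !eqxx mulr1 sgx ?(ltW E0) // lerDr.
have A1 : `|partial i u y - partial i u x| <= D * enorm x `^ (- tau).
  apply: step => //; first by rewrite normrM sgn mulr1 ger0_norm // ltW.
  move=> c /andP[c0 _]; apply: le_enorm => k; rewrite !mxE /=.
  have [->|kj] := eqVneq k j; last by rewrite mulr0 addr0.
  by rewrite mulr1 mulrA sgx ?mulr_ge0 ?(ltW E0) // lerDl mulr_ge0 // ltW.
have yi : y 0 i = x 0 i by rewrite !mxE eq_sym (negbTE ji) mulr0 addr0.
have mv (q : R) : (y + q *: 'e_i) 0 j = y 0 j.
  have E : (q *: 'e_i : 'rV[R]_n) 0 j = 0 by rewrite !mxE (negbTE ji) andbF mulr0.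
  by rewrite addmxE E addr0.
pose z := y + (- x 0 i) *: 'e_i.
have A2 : `|partial i u z - partial i u y| <= D * enorm x `^ (- tau).
  apply: step => //; first by rewrite normrN coord_le_enorm.
  move=> c _; apply: le_trans yj _; apply: le_trans (coord_le_enorm _ j).
  by rewrite mv.
have zi : z 0 i = 0 by rewrite mxE yi !mxE !eqxx mulr1 subrr.
have zj : enorm x <= `|z 0 j|.
  by rewrite /z mv.
(* The rays in the two opposite directions bound [partial i u z] from below and from above. *)
have B1 := ray z _ 1 j xr ji zj zi (mulr1 1).
have B2 := ray z _ (-1) j xr ji zj zi (etrans (mulrNN 1 1) (mulr1 1)).
move: A1 A2 B1 B2; rewrite mulrDl !ler_norml mul1r mulN1r.
move: (partial i u x) (partial i u y) (partial i u z) (K * _) => a b c q.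
rewrite -(mulrA 2); move: (D * _) => d.
by move=> /andP[? ?] /andP[? ?] ? ?; apply/andP; split; lra.
Qed.

Lemma gradsq_decay : bO tau (gradsq G u).
Proof.
have H : bO tau (fun x => \sum_i \sum_k Ginv x i k * (partial i u x * partial k u x)).
  apply: bO_sum => i; apply: bO_sum => k; rewrite -[tau]add0r.
  apply: bOM; first exact: (bO_Ginv tau0 pG dG_decay).
  apply: (bOW (s := tau + tau)); first by rewrite lerDl ltW.
  by apply: bOM; exact: bO_gradient.
apply: (bO_ext (r0 := 0) _ H) => x _; rewrite gradsqE qformE.
by apply: eq_bigr => i _; apply: eq_bigr => k _; rewrite !mxE mulrA.
Qed.

Lemma kim_kim_eq0_far : exists r : R, forall x, r < enorm x -> kim_kim G u m x = 0.
Proof.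
have [c Hc] := const_of_partial0 (smooth_kim_kim m oU sG pG su)
   (fun k x Ux => partial_kim_kim oU sG symG pG su m1 qe k Ux).
have H : bO tau (kim_kim G u m).
  have H1 : bO tau (fun x => m^-1 * (u x * u x * scal G x) + (m - 1) * gradsq G u x).
    apply: bOD; last exact: (bO_scale _ gradsq_decay).
    apply: bO_scale; have -> : tau = (-1 + -1) + (tau + 2) by ring.
    apply: bOM; last exact: (bO_scal tau0 sG symG pG dG_decay).
    by apply: bOM; exact: linear_growth.
  apply: (bO_extU (rho := rho) _ H1) => x Ux.
  by rewrite /kim_kim (lap_scal qe Ux); congr (_ + _); ring.
exists (n%:R * `|rho|) => x xr; rewrite (Hc x xr).
apply/eqP; rewrite -normr_le0; apply/ler_addgt0Pr => e e0; rewrite add0r.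
have [r r1 Hr] := bO_small tau0 e0 H.
pose N : R := Num.max r (n%:R * `|rho| + 1).
have [i _] := other_index (Ordinal (ltn_trans (ltn0Sn 0) n2)).
(* The diagonal vector with entries [N] supplies a point as far out as desired, at which the
   constant value is small. *)
have NE : N <= enorm (\row_(k < n) N : 'rV[R]_n).
  by apply: le_trans (ler_norm N) _; have := coord_le_enorm (\row_(k < n) N) i; rewrite mxE.
rewrite -(Hc (\row_(k < n) N)).
  by apply: Hr; apply: le_trans NE; rewrite le_max lexx.
by apply: lt_le_trans NE; rewrite lt_max [X in _ || X]ltrDl ltr01 orbT.
Qed.

Lemma gradsq_small_far (e : R) : 0 < e ->
  exists r : R, forall x, r < enorm x -> gradsq G u x < e.
Proof.
move=> e0; have e2 : 0 < e / 2 by rewrite divr_gt0.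
have [r r1 Hr] := bO_small tau0 e2 gradsq_decay.
exists r => x xr; apply: le_lt_trans (ler_norm _) _; apply: le_lt_trans (Hr x (ltW xr)) _; lra.
Qed.

End EndDecay.

(** * Functions and curves on the manifold *)

Lemma near_cst_of_partial0 (R : realType) n (U : set 'rV[R]_n) (f : 'rV[R]_n -> R) x :
  open U -> smooth_on U f -> (forall k y, U y -> partial k f y = 0) -> U x ->
  \forall y \near x, f y = f x.
Proof.
move=> oU sf f0 Ux.
have : nbhs x U by exact: open_nbhs_nbhs.
move=> /nbhs_ballP[d /= d0 H].
apply/nbhs_ballP; exists d => //= y; rewrite -ball_normE /= distrC => yx.
have Us (t : R) : 0 <= t <= 1 -> U (x + t *: (y - x)).
  move=> /andP[t0 t1]; apply: H; rewrite -ball_normE /= opprD addrA subrr sub0r normrN normrZ.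
  by apply: le_lt_trans yx; rewrite ger0_norm // ler_piMl.
have [c c01] := segment_MVT oU sf Us.
rewrite [x + (y - x)]addrC subrK => E; apply/eqP; rewrite -subr_eq0 E big1 // => k _.
by rewrite f0 ?mulr0 //; exact: Us.
Qed.

Section ManifoldFunctions.
Context {R : realType} {n : nat} {M : topologicalType}.
Variables (A : set (chart R n M)) (g : tensor2 R n M).
Hypothesis mA : smooth_manifold A.
Hypothesis gA : riemannian_metric A g.
Implicit Types (c d : chart R n M) (p q : M) (x y : 'rV[R]_n) (u : M -> R).

Lemma atlas_chart c : A c -> is_chart c.
Proof. by have [_ _ [_ H]] := mA => /H[]. Qed.

Lemma atlas_compatible c d : A c -> A d -> compatible c d.
Proof. by have [_ _ [_ H]] := mA => /H[_ K] /K. Qed.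

Lemma open_cimg c : A c -> open (cimg c).
Proof. by move=> /atlas_chart[]. Qed.

Lemma open_cdom c : A c -> open (cdom c).
Proof. by move=> /atlas_chart[]. Qed.

Lemma cpsiK c p : A c -> cdom c p -> cpsi c (cphi c p) = p.
Proof. by move=> /atlas_chart[_ _ + _ _]; exact. Qed.

Lemma cphi_cimg c p : cdom c p -> cimg c (cphi c p).
Proof. by exists p. Qed.

Lemma cpsi_cdom c x : A c -> cimg c x -> cdom c (cpsi c x).
Proof. by move=> Ac [p cp <-]; rewrite cpsiK. Qed.

Lemma cphiK c x : A c -> cimg c x -> cphi c (cpsi c x) = x.
Proof. by move=> Ac [p cp <-]; rewrite cpsiK. Qed.

Lemma cphi_continuous c p : A c -> cdom c p -> {for p, continuous (cphi c)}.
Proof.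
move=> Ac cp; have [oc _ _ + _] := atlas_chart Ac.
by rewrite (continuous_open_subspace _ oc) => H; apply: H; rewrite inE.
Qed.

Lemma cpsi_continuous c x : A c -> cimg c x -> {for x, continuous (cpsi c)}.
Proof.
move=> Ac cx; have [_ oc _ _] := atlas_chart Ac.
by rewrite (continuous_open_subspace _ oc) => H; apply: H; rewrite inE.
Qed.

Lemma overlapP c d x : A c -> overlap c d x <-> cimg c x /\ cdom d (cpsi c x).
Proof.
move=> Ac; split=> [[p [cp dp] <-]|[cx dx]].
  by split; [exact: cphi_cimg | rewrite cpsiK].
by exists (cpsi c x); [split=> //; exact: cpsi_cdom | exact: cphiK].
Qed.

Lemma open_overlap c d : A c -> A d -> open (overlap c d).
Proof.
move=> Ac Ad; rewrite openE => x /(overlapP d x Ac)[cx dx].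
have n1 : \forall y \near x, cimg c y by exact: (open_near (open_cimg Ac) cx).
have n2 : \forall y \near x, cdom d (cpsi c y).
  by apply: (cpsi_continuous Ac cx); exact: (open_nbhs_nbhs (conj (open_cdom Ad) dx)).
by apply: filterS2 n1 n2 => y cy dy; apply/(overlapP d y Ac).
Qed.

Lemma chart_at p : exists2 c, A c & cdom c p.
Proof. by have [_ _ [H _]] := mA. Qed.

Lemma smx_metric c : A c -> smx (cimg c) (g c).
Proof. by move=> Ac i j; have [H _ _ _] := gA; exact: H. Qed.

Lemma sym_metric c x : A c -> cimg c x -> (g c x)^T = g c x.
Proof. by move=> Ac; have [_ H _ _] := gA; exact: H. Qed.

Lemma posdef_metric c x : A c -> cimg c x -> posdef (g c x).
Proof. by move=> Ac cx v v0; have [_ _ H _] := gA; rewrite qformE; exact: H. Qed.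

Lemma unit_metric c x : A c -> cimg c x -> g c x \in unitmx.
Proof. by move=> Ac cx; exact: posdef_unit (posdef_metric Ac cx). Qed.

Definition tmap c d x : 'rV[R]_n := cphi d (cpsi c x).

Lemma tmap_cimg c d x : A c -> overlap c d x -> cimg d (tmap c d x).
Proof. by move=> Ac /(overlapP d x Ac)[_ dx]; exact: cphi_cimg. Qed.

Lemma cpsi_tmap c d x : A c -> A d -> overlap c d x -> cpsi d (tmap c d x) = cpsi c x.
Proof. by move=> Ac Ad /(overlapP d x Ac)[_ dx]; exact: cpsiK. Qed.

Lemma smooth_tmap c d a : A c -> A d -> smooth_on (overlap c d) (fun y => tmap c d y 0 a).
Proof. by move=> Ac Ad; apply (atlas_compatible Ac Ad a).1. Qed.

Lemma metric_trans c d x : A c -> A d -> overlap c d x ->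
  g c x = jac (tmap c d) x *m g d (tmap c d x) *m (jac (tmap c d) x)^T.
Proof.
move=> Ac Ad ox; apply/matrixP => i j; have [_ _ _ H] := gA.
rewrite (H c d Ac Ad x ox) mxE exchange_big /=; apply: eq_bigr => b _.
rewrite mxE mulr_suml; apply: eq_bigr => a _.
by rewrite [_^T b j]mxE !mxE; rewrite -!mulrA mulrCA.
Qed.

Lemma overlap_cimg c d : A c -> overlap c d `<=` cimg c.
Proof. by move=> Ac x /(overlapP d x Ac)[]. Qed.

Variable (u : M -> R).
Hypothesis su : smooth_function A u.

Lemma chart_gradsq_trans c d x : A c -> A d -> overlap c d x ->
  gradsq (g c) (u \o cpsi c) x = gradsq (g d) (u \o cpsi d) (tmap c d x).
Proof.
move=> Ac Ad ox; have oc := @overlap_cimg c d Ac.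
apply: (@gradsq_trans R n (overlap c d) (cimg d) (g c) (g d) (tmap c d)
  (open_overlap Ac Ad) _ (open_cimg Ad) _ _ _ _ (u \o cpsi d) (u \o cpsi c) x) => //.
- by move=> y /oc; exact: unit_metric.
- by move=> y; exact: unit_metric.
- by move=> y; exact: tmap_cimg.
- by move=> a; exact: smooth_tmap.
- by move=> y; exact: metric_trans.
- exact: su.
- by move=> y oy; rewrite /= (cpsi_tmap Ac Ad oy).
Qed.

Lemma chart_lap_trans c d x : A c -> A d -> overlap c d x ->
  lap (g c) (u \o cpsi c) x = lap (g d) (u \o cpsi d) (tmap c d x).
Proof.
move=> Ac Ad ox; have oc := @overlap_cimg c d Ac.
apply: (@lap_trans R n (overlap c d) (cimg d) (g c) (g d) (tmap c d)
  (open_overlap Ac Ad) _ _ _ (open_cimg Ad) _ _ _ _ _ _ (u \o cpsi d) (u \o cpsi c) x) => //.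
- by move=> i j; apply: smooth_sub oc _; exact: smx_metric.
- by move=> y /oc; exact: sym_metric.
- by move=> y /oc; exact: unit_metric.
- exact: smx_metric.
- by move=> y; exact: sym_metric.
- by move=> y; exact: unit_metric.
- by move=> y; exact: tmap_cimg.
- by move=> a; exact: smooth_tmap.
- by move=> y; exact: metric_trans.
- exact: su.
- by apply: smooth_sub oc _; exact: su.
- by move=> y oy; rewrite /= (cpsi_tmap Ac Ad oy).
Qed.

Variable (m : R).

(** A chart is chosen around every point to define the values; invariance under transition maps then
    yields the formulas in all charts. *)
Lemma global_functions : exists W Q : M -> R, forall c x, A c -> cimg c x ->
  W (cpsi c x) = gradsq (g c) (u \o cpsi c) x /\
  Q (cpsi c x) = kim_kim (g c) (u \o cpsi c) m x.
Proof.
have /boolp.choice[cc Hcc] : forall p, exists c, A c /\ cdom c p.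
  by move=> p; have [c Ac cp] := chart_at p; exists c.
exists (fun p => gradsq (g (cc p)) (u \o cpsi (cc p)) (cphi (cc p) p)).
exists (fun p => kim_kim (g (cc p)) (u \o cpsi (cc p)) m (cphi (cc p) p)).
move=> c x Ac cx; have [Ad dp] := Hcc (cpsi c x); set d := cc (cpsi c x) in Ad dp *.
have ox : overlap c d x by apply/(overlapP d x Ac).
have E := chart_gradsq_trans Ac Ad ox.
have L := chart_lap_trans Ac Ad ox.
split; first exact: esym E.
rewrite /kim_kim -/(tmap c d x) -E -L; congr (_ * _ + _).
by rewrite /= (cpsi_tmap Ac Ad ox).
Qed.

Lemma chart_continuous (F : M -> R) (f : chart R n M -> 'rV[R]_n -> R) :
  (forall c x, A c -> cimg c x -> F (cpsi c x) = f c x) ->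
  (forall c x, A c -> cimg c x -> {for x, continuous (f c)}) -> continuous F.
Proof.
move=> FE fc p; have [c Ac cp] := chart_at p.
have H : f c (cphi c q) @[q --> p] --> f c (cphi c p).
  apply: (@continuous_comp _ _ _ (cphi c) (f c) p (cphi_continuous Ac cp)).
  exact: (fc c _ Ac (cphi_cimg cp)).
have E q : cdom c q -> F q = f c (cphi c q).
  by move=> cq; rewrite -(FE c _ Ac (cphi_cimg cq)) cpsiK.
suff : F q @[q --> p] --> F p by [].
rewrite (E p cp); apply: cvg_trans H; apply: near_eq_cvg.
have : nbhs p (cdom c) by exact: (open_nbhs_nbhs (conj (open_cdom Ac) cp)).
by apply: filterS => q /E.
Qed.

Lemma near_chart (P : set M) c p : A c -> cdom c p -> (\forall q \near p, P q) ->
  \forall y \near cphi c p, P (cpsi c y).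
Proof.
move=> Ac cp nP; apply: (cpsi_continuous Ac (cphi_cimg cp)).
by rewrite cpsiK.
Qed.

Lemma near_of_chart (P : set M) c p : A c -> cdom c p ->
  (\forall y \near cphi c p, P (cpsi c y)) -> \forall q \near p, P q.
Proof.
move=> Ac cp nP.
have H : \forall q \near p, P (cpsi c (cphi c q)) := cphi_continuous Ac cp nP.
have : nbhs p (cdom c) by exact: (open_nbhs_nbhs (conj (open_cdom Ac) cp)).
by apply: filterS2 H => q Pq cq; rewrite -(cpsiK Ac cq).
Qed.

End ManifoldFunctions.

(** * Coordinate segments and their Riemannian length *)

Section Curves.
Context {R : realType} {n : nat} {M : topologicalType}.
Variables (A : set (chart R n M)) (g : tensor2 R n M).
Hypothesis mA : smooth_manifold A.
Hypothesis gA : riemannian_metric A g.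
Implicit Types (c d : chart R n M) (p q : M) (x y : 'rV[R]_n).

Variable c : chart R n M.
Hypothesis Ac : A c.

Definition segment x w : R -> M := fun t => cpsi c (x + t *: w).

Lemma line_continuous x w : continuous (fun t : R => x + t *: w).
Proof.
move=> t; apply: (@continuousD R _ _ (fun=> x) (fun t : R => t *: w)).
  exact: cst_continuous.
exact: scalel_continuous.
Qed.

Lemma segment_coord d x w (t : R) a : A d -> overlap c d (x + t *: w) ->
  [/\ \forall s \near t, derivable (coord d (segment x w) a) s 1,
      derive1 (coord d (segment x w) a) t =
        \sum_k w 0 k * partial k (fun y => tmap c d y 0 a) (x + t *: w) &
      {for t, continuous (derive1 (coord d (segment x w) a))}].
Proof.
move=> Ad ot; have oO := open_overlap mA Ac Ad.
have sT := smooth_tmap mA a Ac Ad.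
pose D (s : R) := \sum_k w 0 k * partial k (fun y => tmap c d y 0 a) (x + s *: w).
have dP s : overlap c d (x + s *: w) -> is_derive s 1 (coord d (segment x w) a) (D s).
  by move=> os; exact: (smooth_is_derive oO sT os).
have nO : \forall s \near t, overlap c d (x + s *: w).
  apply: (line_continuous (w := w) (x := x)); exact: (open_nbhs_nbhs (conj oO ot)).
have E s : overlap c d (x + s *: w) -> derive1 (coord d (segment x w) a) s = D s.
  by move=> /dP ds; rewrite derive1E; exact: derive_val.
split; [by apply: filterS nO => s /dP ds; exact: ex_derive | exact: E |].
suff : derive1 (coord d (segment x w) a) s @[s --> t] --> derive1 (coord d (segment x w) a) t by [].
have cD : D s @[s --> t] --> D t.
  apply: continuous_for_sum => k.
  apply: (@continuousM R _ (fun=> w 0 k)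
    (fun s : R => partial k (fun y => tmap c d y 0 a) (x + s *: w))).
    exact: cst_continuous.
  apply: (@continuous_comp _ _ _ (fun s : R => x + s *: w)
    (partial k (fun y => tmap c d y 0 a))); first exact: line_continuous.
  exact: (smooth_continuous (smooth_partial k sT) ot).
rewrite (E t ot); apply: cvg_trans cD; apply: near_eq_cvg.
by apply: filterS nO => s /E.
Qed.

Definition segment_speed x w : R -> R := fun t =>
  Num.sqrt (\sum_i \sum_j g c (x + t *: w) i j * w 0 i * w 0 j).

Lemma segment_C1 x w : (forall t : R, 0 <= t <= 1 -> cimg c (x + t *: w)) ->
  C1_curve A (segment x w).
Proof.
move=> H t t01; split.
  apply: (@continuous_comp _ _ _ (fun s : R => x + s *: w) (cpsi c)).
    exact: line_continuous.
  exact: (cpsi_continuous mA Ac (H t t01)).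
move=> d Ad dt a; have ot : overlap c d (x + t *: w) by apply/(overlapP mA d _ Ac); split; [exact: H|].
by have [? _ ?] := segment_coord a Ad ot.
Qed.

Lemma segment_is_speed x w : (forall t : R, 0 <= t <= 1 -> cimg c (x + t *: w)) ->
  is_speed A g (segment x w) (segment_speed x w).
Proof.
move=> H t t01 d Ad dt; have ot : overlap c d (x + t *: w).
  by apply/(overlapP mA d _ Ac); split; [exact: H|].
congr Num.sqrt.
pose J := jac (tmap c d) (x + t *: w); pose v := w *m J.
have vE i : derive1 (coord d (segment x w) i) t = v 0 i.
  have [_ -> _] := segment_coord i Ad ot.
  by rewrite mxE; apply: eq_bigr => k _; rewrite mxE.
rewrite -qformE (metric_trans gA Ac Ad ot) -/J !mulmxA -mulmxA -trmx_mul -/v qformE.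
by apply: eq_bigr => i _; apply: eq_bigr => j _; rewrite !vE.
Qed.

(** The squared speed is a sum of [n^2] terms, each at most [L * |w|^2] in the sup norm. *)
Lemma segment_length x w (L : R) : (forall t : R, 0 <= t <= 1 -> cimg c (x + t *: w)) ->
  0 <= L -> (forall y i j, cimg c y -> `|g c y i j| <= L) ->
  Rintegral lebesgue_measure `[0, 1] (segment_speed x w) <=
    n%:R * Num.sqrt L * `|w|.
Proof.
move=> H L0 HL; set B := _ * `|w|.
have cv : {within `[(0:R), 1], continuous (segment_speed x w)}.
  apply/continuous_in_subspaceT => t; rewrite inE /= in_itv /= => t01.
  apply: (@continuous_comp _ _ _ (fun t : R => \sum_i \sum_j g c (x + t *: w) i j * w 0 i * w 0 j)
    Num.sqrt); last exact: sqrt_continuous.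
  apply: continuous_for_sum => i; apply: continuous_for_sum => j.
  have c1 : {for t, continuous (fun t : R => g c (x + t *: w) i j)}.
    apply: (@continuous_comp _ _ _ (fun s : R => x + s *: w) (fun y => g c y i j)).
      exact: line_continuous.
    exact: (smooth_continuous (smx_metric gA Ac i j) (H t t01)).
  have cc (r : R) : {for t, continuous (fun _ : R => r)} by exact: cst_continuous.
  exact: (continuousM (continuousM c1 (cc (w 0 i))) (cc (w 0 j))).
have B1 : \int[lebesgue_measure]_(t in `[0, 1]) B = B.
  rewrite Rintegral_cst //= lebesgue_measure_itv /= lte_fin ltr01 -EFinB /= subr0 mulr1 //.
rewrite -[leRHS]B1; apply: le_Rintegral => //.
- exact: (continuous_compact_integrable (@segment_compact R 0 1) cv).
- apply: (continuous_compact_integrable (@segment_compact R 0 1)).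
  by apply: continuous_subspaceT => t; exact: cst_continuous.
move=> t; rewrite /= in_itv /= => t01.
rewrite /segment_speed /B -[n%:R](@ger0_norm _ n%:R) // -sqrtr_sqr.
rewrite -sqrtrM ?sqr_ge0 // -[`|w|](@ger0_norm _ `|w|) // -sqrtr_sqr -sqrtrM; last first.
  by rewrite mulr_ge0 ?sqr_ge0.
apply: ler_wsqrtr; apply: le_trans (ler_norm _) _.
have <- : \sum_(i < n) \sum_(j < n) (L * `|w| ^+ 2) = n%:R ^+ 2 * L * `|w| ^+ 2.
  have S (z : R) : \sum_(i < n) z = n%:R * z by rewrite sumr_const card_ord mulr_natl.
  by rewrite S S expr2 !mulrA.
apply: le_trans (ler_norm_sum _ _ _) _; apply: ler_sum => i _.
apply: le_trans (ler_norm_sum _ _ _) _; apply: ler_sum => j _.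
rewrite !normrM -mulrA; apply: ler_pM => //; first exact: (HL _ i j (H t t01)).
by rewrite expr2; apply: ler_pM => //; exact: coord_le_norm.
Qed.

(** Lengths are carried as upper bounds, so that several segments can be chained by repeated
    application. *)
Lemma length_segment x w q (L l : R) : (forall t : R, 0 <= t <= 1 -> cimg c (x + t *: w)) ->
  0 <= L -> (forall y i j, cimg c y -> `|g c y i j| <= L) ->
  (exists2 l', l' <= l & piecewise_C1_length A g (cpsi c (x + w)) q l') ->
  exists2 l', l' <= n%:R * Num.sqrt L * `|w| + l & piecewise_C1_length A g (cpsi c x) q l'.
Proof.
move=> H L0 HL [l' ll' P].
exists (Rintegral lebesgue_measure `[0, 1] (segment_speed x w) + l').
  by apply: lerD => //; exact: segment_length.
have -> : cpsi c x = segment x w 0 by rewrite /segment scale0r addr0.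
apply: Length_cons; [exact: segment_C1 | exact: segment_is_speed |].
by rewrite /segment scale1r.
Qed.

End Curves.

(** * Riemannian distances near the inner sphere of an end *)

Section Boundary.
Context {R : realType} {n : nat} {M : topologicalType}.
Variables (A : set (chart R n M)) (g : tensor2 R n M).
Hypothesis mA : smooth_manifold A.
Hypothesis gA : riemannian_metric A g.
Variables (c : chart R n M) (rho L : R).
Hypothesis Ac : A c.
Hypothesis rho0 : 0 < rho.
Hypothesis cE : cimg c = [set x | rho < enorm x].
Hypothesis L0 : 0 <= L.
Hypothesis HL : forall y i j, cimg c y -> `|g c y i j| <= L.

(* Near a boundary point [z] of the end, go outwards along a coordinate axis on which [z]
   does not vanish, across, and back. *)
Lemma dist_near_boundary z (e : R) : enorm z = rho -> 0 < e ->
  exists2 d : R, 0 < d & forall x y, cimg c x -> cimg c y -> `|x - z| < d -> `|y - z| < d ->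
    (riemannian_dist A g (cpsi c x) (cpsi c y) < e%:E)%E.
Proof.
move=> ez e0.
have [j zj] : exists j, z 0 j != 0.
  apply/existsP; apply: contraT; rewrite negb_exists => /forallP H.
  have z0 : z = 0 by apply/rowP => k; rewrite mxE; have := H k; rewrite negbK => /eqP.
  have : enorm z <= 0.
    rewrite /enorm z0 big1 ?sqrtr0 // => k _; rewrite mxE expr0n //.
  by rewrite ez leNgt rho0.
pose sg : R := Num.sg (z 0 j).
have sgz : sg * z 0 j = `|z 0 j| by rewrite normrEsg.
pose C := n%:R * Num.sqrt L.
have C0 : 0 <= C by rewrite mulr_ge0 ?ler0n ?sqrtr_ge0.
(* The three legs have sup norms at most [h], [2 * h] and [h], so the total length is at most
   [4 * C * h], which is below [e]. *)
pose h := e / (5 * (C + 1)).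
have h0 : 0 < h by rewrite divr_gt0 // mulr_gt0 // ltr_wpDl.
have hC : C * h * 5 < e.
  have -> : e = h * (5 * (C + 1)) by rewrite /h divfK // gt_eqF // mulr_gt0 // ltr_wpDl.
  by nra.
have sgn : `|sg| = 1 by rewrite /sg normr_sg zj.
have sgsq : sg * sg = 1 by rewrite -[sg * sg]/(sg ^+ 2) /sg sqr_sg zj.
pose v : 'rV[R]_n := h *: (sg *: 'e_j).
have vk k : v 0 k = if k == j then h * sg else 0.
  by rewrite !mxE eqxx /=; case: eqP; rewrite ?mulr1 ?mulr0 ?mulr0.
have nv : `|v| <= h.
  apply: norm_le_coord => [|k]; first exact: ltW.
  rewrite vk; case: ifP => _; last by rewrite normr0 ltW.
  by rewrite normrM sgn mulr1 gtr0_norm.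
have zv : rho < enorm (z + v).
  rewrite -(@ltr_pXn2r _ 2) ?nnegrE ?enorm_ge0 ?(ltW rho0) // -ez !enorm_sqr.
  rewrite [X in X < _](bigD1 j) //= [X in _ < X](bigD1 j) //=.
  have -> : \sum_(i < n | i != j) (z + v) 0 i ^+ 2 = \sum_(i < n | i != j) z 0 i ^+ 2.
    by apply: eq_bigr => i ij; rewrite mxE vk (negbTE ij) addr0.
  rewrite ltrD2r [(z + v) 0 j]mxE vk eqxx.
  have z0 : 0 < `|z 0 j| by rewrite normr_gt0.
  have -> : (z 0 j + h * sg) ^+ 2 = z 0 j ^+ 2 + 2 * h * `|z 0 j| + h * h.
    rewrite -sgz; have -> : h * h = h * h * (sg * sg) by rewrite sgsq mulr1.
    by ring.
  move: (`|z 0 j|) (z 0 j ^+ 2) z0 => a b a0.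
  have p1 : 0 < 2 * h * a by apply: mulr_gt0 => //; exact: mulr_gt0.
  have p2 : 0 < h * h by exact: mulr_gt0.
  by move: (2 * h * a) (h * h) p1 p2 => p q; lra.
have : nbhs (z + v) [set y : 'rV[R]_n | rho < enorm y].
  by apply: open_nbhs_nbhs; split=> //; exact: open_enorm_gt.
move=> /nbhs_ballP[d' /= d'0 Hd'].
(* The bound [d'] keeps the crossing near [z + v], hence outside the sphere; [h] bounds the length
   of the crossing; [|z 0 j|] fixes the sign of coordinate [j], so that moving along [v] leads
   outwards. *)
exists (Num.min (Num.min d' h) `|z 0 j|); first by rewrite !lt_min d'0 h0 normr_gt0.
move=> x y cx cy; rewrite !lt_min => /andP[/andP[xd xh] xz] /andP[/andP[yd yh] yz].
have out w : cimg c w -> `|w - z| < `|z 0 j| -> forall t : R, 0 <= t -> cimg c (w + t *: v).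
  rewrite cE /= => cw wz t t0; apply: lt_le_trans cw _; apply: le_enorm => k.
  rewrite mxE [(t *: v) 0 k]mxE vk; have [->|_] := eqVneq k j; last by rewrite mulr0 addr0.
  have := le_lt_trans (coord_le_norm (w - z) j) wz; rewrite !mxE => wzj.
  have sw : 0 <= sg * w 0 j.
    have : `|sg * (w 0 j - z 0 j)| < `|z 0 j| by rewrite normrM sgn mul1r.
    rewrite mulrBr sgz ltr_norml => /andP[+ _].
    by move: (sg * _) (`|z 0 j|) => a b; lra.
  have -> : `|w 0 j| = sg * w 0 j by rewrite -(ger0_norm sw) normrM sgn mul1r.
  have -> : w 0 j + t * (h * sg) = sg * (sg * w 0 j + t * h).
    by rewrite mulrDr [sg * (sg * _)]mulrA sgsq mul1r; ring.
  rewrite normrM sgn mul1r; apply: le_trans (ler_norm _).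
  by rewrite lerDl mulr_ge0 // ltW.
have mid (t : R) : 0 <= t <= 1 -> cimg c (x + v + t *: (y - x)).
  move=> /andP[t0 t1]; rewrite cE; apply: Hd'; rewrite -ball_normE /= distrC.
  have -> : x + v + t *: (y - x) - (z + v) = (1 - t) *: (x - z) + t *: (y - z).
    by apply/rowP => k; rewrite !mxE; ring.
  apply: le_lt_trans (ler_normD _ _) _; rewrite !normrZ !ger0_norm ?subr_ge0 //.
  move: xd yd; move: (`|x - z|) (`|y - z|) => a b ad bd.
  have [t00|t00] := eqVneq t 0; first by rewrite t00; lra.
  have tp : 0 < t by rewrite lt_neqAle eq_sym t00.
  have h1 : t * b < t * d' by rewrite ltr_pM2l.
  have h2 : (1 - t) * a <= (1 - t) * d' by apply: ler_wpM2l; [rewrite subr_ge0 | exact: ltW].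
  lra.
have back (t : R) : 0 <= t <= 1 -> cimg c (y + v + t *: (- v)).
  move=> /andP[t0 t1]; have -> : y + v + t *: (- v) = y + (1 - t) *: v.
    by apply/rowP => k; rewrite !mxE; ring.
  by apply: out => //; rewrite subr_ge0.
have P3 : exists2 l', l' <= C * `|- v| + 0 &
    piecewise_C1_length A g (cpsi c (y + v)) (cpsi c y) l'.
  apply: (length_segment mA gA Ac back L0 HL); exists 0 => //.
  by rewrite addrK; exact: Length_nil.
have P2 : exists2 l', l' <= C * `|y - x| + (C * `|- v| + 0) &
    piecewise_C1_length A g (cpsi c (x + v)) (cpsi c y) l'.
  apply: (length_segment mA gA Ac mid L0 HL).
  by have -> : x + v + (y - x) = y + v by apply/rowP => k; rewrite !mxE; ring.
have [l' l'le P1] : exists2 l', l' <= C * `|v| + (C * `|y - x| + (C * `|- v| + 0)) &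
    piecewise_C1_length A g (cpsi c x) (cpsi c y) l'.
  apply: (length_segment mA gA Ac _ L0 HL P2) => t /andP[t0 _]; exact: out.
apply: (@le_lt_trans _ _ l'%:E); first by apply: ereal_inf_lbound; exists l'.
rewrite lte_fin; apply: le_lt_trans l'le _; apply: le_lt_trans hC.
have yx : `|y - x| <= 2 * h.
  have -> : y - x = (y - z) - (x - z) by rewrite opprB addrA subrK.
  by apply: le_trans (ler_normB _ _) _; move: xh yh; move: (`|x - z|) (`|y - z|) => a b; lra.
rewrite normrN addr0.
have a1 := ler_wpM2l C0 nv; have a2 := ler_wpM2l C0 yx.
have ch : 0 <= C * h by rewrite mulr_ge0 // ltW.
move: a1 a2 ch; rewrite (mulrCA C 2); move: (C * _) (C * _) (C * h) => p q r; lra.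
Qed.

End Boundary.

(** * The maximum principle *)

Lemma inv_nat_lt (R : realType) (d : R) : 0 < d ->
  exists N : nat, forall k, (N <= k)%N -> k.+1%:R^-1 < d.
Proof.
move=> d0; exists (Num.bound d^-1) => k Nk.
rewrite invf_plt ?posrE //.
have dV0 : 0 <= d^-1 by rewrite invr_ge0 ltW.
apply: lt_le_trans (archi_boundP dV0) _; rewrite ler_nat; exact: leq_trans Nk (leqnSn k).
Qed.

Section Clustering.
Context {T : topologicalType}.
Implicit Types (p : nat -> T) (q : T).

(** The point [q] is a cluster point of the sequence [p], a property inherited from subsequences
    ([visits_sub]). *)
Definition visits p q : Prop :=
  forall V, nbhs q V -> forall N : nat, exists2 j : nat, (N <= j)%N & V (p j).

Lemma visits_sub p (s : nat -> nat) q : (forall k, (k <= s k)%N) -> visits (p \o s) q -> visits p q.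
Proof.
move=> ks H V qV N; have [j Nj Vj] := H V qV N.
by exists (s j) => //; exact: leq_trans Nj (ks j).
Qed.

Lemma compact_visits (K : set T) p : compact K -> (forall j, K (p j)) ->
  exists2 q, K q & visits p q.
Proof.
move=> cK Kp.
have [|q [Kq cq]] := cK (p @ \oo) _; first by exists 0%N => // j _; exact: Kp.
exists q => // V qV N.
have [||_ [[j /= Nj <-] Vj]] := cq (p @` [set j | (N <= j)%N]) V => //.
  by exists N => // j Nj; exists j.
by exists j.
Qed.

Lemma cvg_visits p q : p @ \oo --> q -> visits p q.
Proof.
move=> pq V qV N; have [N' _ H] := pq V qV.
exists (maxn N N'); first exact: leq_maxl.
by apply: H; exact: leq_maxr.
Qed.

Lemma frequent_subsequence (P : nat -> Prop) :
  (forall N : nat, exists2 j : nat, (N <= j)%N & P j) ->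
  exists2 s : nat -> nat, (forall k, (k <= s k)%N) & forall k, P (s k).
Proof.
move=> H; have /boolp.choice[s Hs] : forall N : nat, exists j : nat, (N <= j)%N /\ P j.
  by move=> N; have [j] := H N; exists j.
by exists s => k; apply (Hs k).
Qed.

Lemma attains_max (R : realType) (D : set T) (f : T -> R) :
  D !=set0 -> closed D -> continuous f ->
  (forall p, (forall j, D (p j)) -> exists q, visits p q) ->
  exists2 q, D q & forall t, D t -> f t <= f q.
Proof.
move=> D0 cD cf cl.
(* Eventually exceeding every [a] below some value of [f] describes a maximizing sequence whether or
   not [f] is bounded. In the unbounded case a sequence with [j < f (p j)] serves. *)
have [p Dp Hp] : exists2 p : nat -> T, (forall j, D (p j)) &
    forall t (a : R), D t -> a < f t -> exists N : nat, forall j, (N <= j)%N -> a < f (p j).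
  have [ub|nub] := pselect (has_ubound (f @` D)).
    have hs : has_sup (f @` D) by split=> //; exact: image_nonempty.
    have /boolp.choice[p Hp] : forall j : nat, exists q, D q /\ sup (f @` D) - j.+1%:R^-1 < f q.
      move=> j; have e0 : 0 < j.+1%:R^-1 :> R by rewrite invr_gt0.
      by have [_ [q Dq <-] H] := sup_adherent e0 hs; exists q.
    exists p => [j|t a Dt ft]; first by apply (Hp j).
    have ts : f t <= sup (f @` D) by apply: sup_upper_bound => //; exists t.
    have d0 : 0 < sup (f @` D) - a by rewrite subr_gt0 (lt_le_trans ft).
    have [N HN] := inv_nat_lt d0; exists N => j /HN h.
    by have [_ h'] := Hp j; move: h h'; move: (sup _) (_^-1) (f _) => b c e; lra.
  have /boolp.choice[p Hp] : forall j : nat, exists q, D q /\ j%:R < f q.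
    move=> j; apply: contrapT => H; apply: nub; exists j%:R => _ [q Dq <-].
    by rewrite leNgt; apply/negP => jq; apply: H; exists q.
  exists p => [j|t a Dt ft]; first by apply (Hp j).
  exists (Num.bound `|a|) => j Nj; have [_ h] := Hp j; apply: le_lt_trans h.
  apply: le_trans (ler_norm a) _; apply: le_trans (ltW (archi_boundP (normr_ge0 a))) _.
  by rewrite ler_nat.
have [q Hq] := cl p Dp.
have Dq : D q.
  by apply: cD => V /Hq /(_ 0%N)[j _ Vj]; exists (p j).
exists q => // t Dt; rewrite leNgt; apply/negP => qt.
pose a := (f q + f t) / 2.
have qa : f q < a by rewrite /a; lra.
have ta : a < f t by rewrite /a; lra.
have [N HN] := Hp t a Dt ta.
have nV : \forall y \near q, f y < a by exact: (cvgr_lt (f q) (cf q) a qa).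
by have [j /HN + Vj] := Hq _ nV N; rewrite ltNge ltW.
Qed.

End Clustering.

(** * Cluster points of sequences that stay bounded in the ends *)

Section EndClustering.
Context {R : realType} {n : nat} {M : topologicalType}.
Variables (A : set (chart R n M)) (g : tensor2 R n M).
Hypothesis mA : smooth_manifold A.
Hypothesis gA : riemannian_metric A g.
Hypothesis compl : complete_metric A g.

(* If the points accumulate on the inner sphere, which lies outside the image of the chart, then a
   subsequence is Cauchy for the Riemannian distance. *)
Lemma end_visits (c : chart R n M) (rho L r : R) (p : nat -> M) : A c -> 0 < rho ->
  cimg c = [set x | rho < enorm x] -> 0 <= L ->
  (forall y i j, cimg c y -> `|g c y i j| <= L) ->
  (forall j, cdom c (p j)) -> (forall j, enorm (cphi c (p j)) <= r) ->
  exists q, visits p q.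
Proof.
move=> Ac rho0 cE L0 HL cp pr.
pose x j := cphi c (p j).
have cx j : cimg c (x j) by exact: cphi_cimg.
have xp j : cpsi c (x j) = p j by exact: (cpsiK mA Ac (cp j)).
pose S := [set y : 'rV[R]_n | rho <= enorm y /\ enorm y <= r].
have cS : compact S.
  apply: bounded_closed_compact.
    exists r; split; first exact: num_real.
    move=> r' rr' y /= [_ yr]; apply: norm_le_coord => [|k].
      by apply: le_trans (ltW rr'); apply: le_trans yr; exact: enorm_ge0.
    by apply: le_trans (coord_le_enorm y k) _; apply: le_trans yr (ltW rr').
  have -> : S = enorm @^-1` [set t | rho <= t] `&` enorm @^-1` [set t | t <= r] by [].
  apply: closedI; apply: closed_comp => [y _|]; try exact: enorm_continuous.
    exact: closed_ge.
  exact: closed_le.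
have Sx j : S (x j) by split; [have := cx j; rewrite cE => /ltW | exact: pr].
have [z [zrho zr] vz] := compact_visits cS Sx.
have [rz|zle] := ltrP rho (enorm z).
  have cz : cimg c z by rewrite cE.
  exists (cpsi c z) => V zV N.
  have [j Nj Vj] := vz _ (cpsi_continuous mA Ac cz zV) N.
  by exists j => //; rewrite -xp.
have ez : enorm z = rho by apply/eqP; rewrite eq_le zle zrho.
have /boolp.choice[s Hs] : forall k : nat, exists j : nat, (k <= j)%N /\ `|x j - z| < k.+1%:R^-1.
  move=> k; have k0 : 0 < k.+1%:R^-1 :> R by rewrite invr_gt0.
  have nV : nbhs z [set y | `|y - z| < k.+1%:R^-1].
    by apply/nbhs_ballP; exists k.+1%:R^-1 => //= y; rewrite -ball_normE /= distrC.
  by have [j kj Vj] := vz _ nV k; exists j.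
have [|q Hq] := compl (x := p \o s).
  move=> e e0.
  have [d d0 Hd] := dist_near_boundary mA gA Ac rho0 cE L0 HL ez e0.
  have [N HN] := inv_nat_lt d0; exists N => i j Ni Nj.
  rewrite /= -(xp (s i)) -(xp (s j)); apply: Hd => //.
    by have [_ h] := Hs i; exact: lt_trans h (HN i Ni).
  by have [_ h] := Hs j; exact: lt_trans h (HN j Nj).
exists q; apply: (visits_sub (s := s)); first by move=> k; apply (Hs k).
exact: cvg_visits.
Qed.

(** The radius [r] bounds [D] within the end, and [L] bounds the metric coefficients, which turns
    coordinate lengths into bounds on Riemannian ones. *)
Definition bounded_in_end (D E : set M) : Prop := exists c (rho L r : R),
  [/\ A c /\ cdom c = E, 0 < rho /\ cimg c = [set x | rho < enorm x],
      0 <= L, (forall y i j, cimg c y -> `|g c y i j| <= L) &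
      forall p, D p -> E p -> enorm (cphi c p) <= r].

(** By the pigeonhole principle, the sequence returns infinitely often to [K] or to one of the
    finitely many ends. *)
Lemma bounded_visits (K D : set M) k (E : 'I_k -> set M) (p : nat -> M) :
  compact K -> ~` K = \bigcup_i E i -> (forall i, bounded_in_end D (E i)) ->
  (forall j, D (p j)) -> exists q, visits p q.
Proof.
move=> cK KE HE Dp.
have [fK|nK] := pselect (forall N : nat, exists2 j : nat, (N <= j)%N & K (p j)).
  have [s ks Ks] := frequent_subsequence fK.
  have [q _ vq] := compact_visits cK Ks.
  by exists q; exact: visits_sub ks vq.
have [[i fi]|nE] := pselect (exists i, forall N : nat, exists2 j : nat, (N <= j)%N & E i (p j)).
  have [s ks Es] := frequent_subsequence fi.
  have [c [rho [L [r [[Ac dE] [rho0 cE] L0 HL Hr]]]]] := HE i.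
  have [||q vq] := @end_visits c rho L r (p \o s) Ac rho0 cE L0 HL.
  - by move=> j; rewrite dE; exact: Es.
  - by move=> j; apply: Hr; [exact: Dp|exact: Es].
  by exists q; exact: visits_sub ks vq.
exfalso.
have [N HN] : exists N : nat, forall j, (N <= j)%N -> ~ K (p j).
  apply: contrapT => H; apply: nK => N; apply: contrapT => H'; apply: H; exists N => j Nj Kj.
  by apply: H'; exists j.
have /boolp.choice[F HF] : forall i, exists N : nat, forall j, (N <= j)%N -> ~ E i (p j).
  move=> i; apply: contrapT => H; apply: nE; exists i => N'; apply: contrapT => H'.
  by apply: H; exists N' => j Nj Ej; apply: H'; exists j.
pose j := maxn N (\max_i F i).
have : (~` K) (p j) by apply: HN; exact: leq_maxl.
rewrite KE => -[i _]; apply: HF; apply: leq_trans (leq_maxr _ _).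
exact: leq_bigmax.
Qed.

End EndClustering.

Lemma bigO_bounded (R : realType) n (rho tau a : R) (U : set 'rV[R]_n) (f : 'rV[R]_n -> R) :
  0 < rho -> 0 <= tau -> U `<=` [set x | rho < enorm x] ->
  bigO_derivs 2 tau U (fun x => f x - a) -> exists L, forall x, U x -> `|f x| <= L.
Proof.
move=> rho0 tau0 Urho [C C0 H]; exists (C * rho `^ (- tau) + `|a|) => x Ux.
rewrite -[f x](subrK a); apply: le_trans (ler_normD _ _) _; apply: lerD => //.
apply: le_trans (H [::] isT x Ux) _; rewrite /= subr0.
apply: ler_wpM2l; first exact: ltW.
by apply: powRN_le => //; apply: ltW; exact: Urho.
Qed.

(** A point of the closure has a neighbourhood on which [Q] is constant, and this neighbourhood
    meets the preimage. *)
Lemma closed_preimage_locally_constant (T : topologicalType) (S : Type) (Q : T -> S) (P : set S) :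
  (forall p, \forall q \near p, Q q = Q p) -> closed (Q @^-1` P).
Proof.
move=> lQ q cq; have [p [/= Pp E]] := cq _ (lQ q).
by rewrite /preimage /= -E.
Qed.

(** * Global maxima and the conclusion *)

Section QuasiEinstein.
Context {R : realType} {n : nat} {M : topologicalType}.
Variables (A : set (chart R n M)) (g : tensor2 R n M) (u : M -> R) (m : R).
Hypothesis n3 : (3 <= n)%N.
Hypothesis m1 : 1 < m.
Hypothesis mA : smooth_manifold A.
Hypothesis gA : riemannian_metric A g.
Hypothesis compl : complete_metric A g.
Hypothesis su : smooth_function A u.
Hypothesis u0 : forall p, 0 < u p.
Hypothesis qe : forall c, A c -> forall x, cimg c x -> forall i j,
  hessian (g c) (u \o cpsi c) i j x = u (cpsi c x) / m * ricci (g c) i j x.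
Hypothesis AF : asymptotically_flat A g.

Variables W Q : M -> R.
Hypothesis WE : forall c x, A c -> cimg c x -> W (cpsi c x) = gradsq (g c) (u \o cpsi c) x.
Hypothesis QE : forall c x, A c -> cimg c x -> Q (cpsi c x) = kim_kim (g c) (u \o cpsi c) m x.

Lemma u_continuous : continuous u.
Proof.
apply: (@chart_continuous R n M A mA u (fun c => u \o cpsi c)) => // c x Ac cx.
exact: (smooth_continuous (su Ac) cx).
Qed.

Lemma W_continuous : continuous W.
Proof.
apply: (@chart_continuous R n M A mA W (fun c => gradsq (g c) (u \o cpsi c))) => [|c x Ac cx].
  exact: WE.
apply: (@smooth_continuous R n (cimg c)) => //.
exact: (smooth_gradsq (open_cimg mA Ac) (smx_metric gA Ac) (fun y => posdef_metric gA Ac (x := y)) (su Ac)).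
Qed.

Lemma Q_locally_constant p : \forall q \near p, Q q = Q p.
Proof.
have [c Ac cp] := chart_at mA p; have cx := cphi_cimg cp.
have oU := open_cimg mA Ac.
have sk := smooth_kim_kim m oU (smx_metric gA Ac) (fun y => posdef_metric gA Ac (x := y)) (su Ac).
have H := near_cst_of_partial0 oU sk _ cx.
apply: (near_of_chart mA Ac cp).
have {}H : \forall y \near cphi c p, kim_kim (g c) (u \o cpsi c) m y = kim_kim (g c) (u \o cpsi c) m (cphi c p).
  apply: H => k y cy.
  exact: (partial_kim_kim oU (smx_metric gA Ac) (fun y => sym_metric gA Ac (x := y))
    (fun y => posdef_metric gA Ac (x := y)) (su Ac) m1 (qe Ac) k cy).
have nc : \forall y \near cphi c p, cimg c y by exact: (open_near oU cx).
apply: filterS2 H nc => y E cy.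
by rewrite QE // E -QE // (cpsiK mA Ac cp).
Qed.

Lemma W_ge0 p : 0 <= W p.
Proof.
have [c Ac cp] := chart_at mA p; have cx := cphi_cimg cp; rewrite -(cpsiK mA Ac cp) WE //.
exact: (@gradsq_ge0 R n (cimg c) (g c) (u \o cpsi c) (fun y => sym_metric gA Ac (x := y))
  (fun y => posdef_metric gA Ac (x := y)) _ cx).
Qed.

Lemma end_decay (E : set M) : asymptotically_flat_end A g E ->
  exists c (rho L : R),
  [/\ A c /\ cdom c = E, 0 < rho /\ cimg c = [set x | rho < enorm x],
      0 <= L /\ (forall y i j, cimg c y -> `|g c y i j| <= L),
      exists r, forall p, E p -> r < enorm (cphi c p) -> Q p = 0 &
      forall e, 0 < e -> exists r, forall p, E p -> r < enorm (cphi c p) -> W p < e].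
Proof.
move=> [c [rho [tau [Ac dE [rho0 cE] /andP[tau1 _] bO]]]].
have tau0 : 0 < tau.
  apply: le_lt_trans tau1; rewrite divr_ge0 // subr_ge0 ler_nat; exact: ltnW.
have /boolp.choice[l Hl] : forall ij : 'I_n * 'I_n, exists l : R,
    forall x, cimg c x -> `|g c x ij.1 ij.2| <= l.
  move=> [i j]; apply: (bigO_bounded rho0 (ltW tau0) _ (bO i j)).
  by rewrite cE.
have HL y i j : cimg c y -> `|g c y i j| <= \sum_ij `|l ij|.
  move=> cy; apply: le_trans (Hl (i, j) y cy) _; apply: le_trans (ler_norm _) _.
  by rewrite (bigD1 (i, j)) //= lerDl sumr_ge0.
exists c, rho, (\sum_ij `|l ij|); split => //.
- by split=> //; exact: sumr_ge0.
- have sG := smx_metric gA Ac; have symG := fun y => sym_metric gA Ac (x := y).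
  have pG := fun y => posdef_metric gA Ac (x := y); have sU := su Ac; have qE := qe Ac.
  have up y : cimg c y -> 0 < (u \o cpsi c) y by move=> _; exact: u0.
  rewrite cE in sG symG pG sU qE up bO.
  have [r Hr] := kim_kim_eq0_far (ltnW n3) tau0 sG symG pG bO sU up m1 qE.
  exists r => p Ep rp; have cp : cdom c p by rewrite dE.
  by rewrite -(cpsiK mA Ac cp) QE ?Hr //; exact: cphi_cimg.
move=> e e0.
have sG := smx_metric gA Ac; have symG := fun y => sym_metric gA Ac (x := y).
have pG := fun y => posdef_metric gA Ac (x := y); have sU := su Ac; have qE := qe Ac.
have up y : cimg c y -> 0 < (u \o cpsi c) y by move=> _; exact: u0.
rewrite cE in sG symG pG sU qE up bO.
have [r Hr] := gradsq_small_far (ltnW n3) tau0 sG symG pG bO sU up m1 qE e0.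
exists r => p Ep rp; have cp : cdom c p by rewrite dE.
by rewrite -(cpsiK mA Ac cp) WE ?Hr //; exact: cphi_cimg.
Qed.

(** Far out in the ends [Q] vanishes and [W] is below any given [e]; either alternative therefore
    confines [D] to bounded radii in each end. *)
Lemma attains_max_of_decay (D : set M) (f : M -> R) : D !=set0 -> closed D -> continuous f ->
  (forall p, D p -> Q p != 0) \/ (exists2 e : R, 0 < e & forall p, D p -> e <= W p) ->
  exists2 q, D q & forall t, D t -> f t <= f q.
Proof.
move=> D0 cD cf HD; apply: attains_max => // p Dp.
have [K [k [E [cK KE _ _ HE]]]] := AF.
apply: (bounded_visits mA gA compl cK KE _ Dp) => i.
have [c [rho [L [Hc Hrho [L0 HL] [r Hr] HW]]]] := end_decay (HE i).
case: HD => [HQ|[e e0 He]].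
  exists c, rho, L, r; split=> // q Dq Eq; rewrite leNgt; apply/negP => /(Hr q Eq) Q0.
  by have := HQ q Dq; rewrite Q0 eqxx.
have [r' Hr'] := HW e e0.
exists c, rho, L, r'; split=> // q Dq Eq; rewrite leNgt; apply/negP => /(Hr' q Eq) We.
by have := He q Dq; rewrite leNgt We.
Qed.

Lemma Q_le0_local_max p : (\forall q \near p, u q <= u p) -> Q p <= 0.
Proof.
have [c Ac cp] := chart_at mA p => /(near_chart mA Ac cp) mx.
have cx := cphi_cimg cp; rewrite -(cpsiK mA Ac cp) QE //.
apply: (kim_kim_le0_local_max m (open_cimg mA Ac) (fun y => sym_metric gA Ac (x := y))
  (fun y => posdef_metric gA Ac (x := y)) (su Ac) _ cx); first by move=> y _; exact: u0.
by apply: filterS mx => y; rewrite /= (cpsiK mA Ac cp).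
Qed.

Lemma Q_ge0_local_min p : (\forall q \near p, u p <= u q) -> 0 <= Q p.
Proof.
have [c Ac cp] := chart_at mA p => /(near_chart mA Ac cp) mn.
have cx := cphi_cimg cp; rewrite -(cpsiK mA Ac cp) QE //.
apply: (kim_kim_ge0_local_min m (open_cimg mA Ac) (fun y => sym_metric gA Ac (x := y))
  (fun y => posdef_metric gA Ac (x := y)) (su Ac) _ cx); first by move=> y _; exact: u0.
by apply: filterS mn => y; rewrite /= (cpsiK mA Ac cp).
Qed.

Lemma Q_eq0 p : Q p = 0.
Proof.
have lQ := Q_locally_constant.
apply/eqP; rewrite eq_le; apply/andP; split; rewrite leNgt; apply/negP => Qp.
  have [||||q /= Qq Hq] := @attains_max_of_decay (Q @^-1` [set t | 0 < t]) u.
  - by exists p.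
  - exact: closed_preimage_locally_constant.
  - exact: u_continuous.
  - by left=> q /= Qq; rewrite gt_eqF.
  have : Q q <= 0.
    apply: Q_le0_local_max; apply: filterS (lQ q) => t E; apply: Hq.
    by rewrite /preimage /= E.
  by rewrite leNgt Qq.
have [||||q /= Qq Hq] := @attains_max_of_decay (Q @^-1` [set t | t < 0]) (fun t => - u t).
- by exists p.
- exact: closed_preimage_locally_constant.
- by move=> t; apply: continuousN; exact: u_continuous.
- by left=> q /= Qq; rewrite lt_eqF.
have : 0 <= Q q.
  apply: Q_ge0_local_min; apply: filterS (lQ q) => t E; rewrite -lerN2; apply: Hq.
  by rewrite /preimage /= E.
by rewrite leNgt Qq.
Qed.

Lemma W_eq0 p : W p = 0.
Proof.
apply/eqP; rewrite eq_le W_ge0 andbT leNgt; apply/negP => Wp.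
(* On the superlevel set of [W p > 0] the function [W] is bounded away from 0, which keeps the set
   bounded in the ends. A maximum over this set is a maximum over all of [M]. *)
have [||||q /= Wq Hq] := @attains_max_of_decay (W @^-1` [set t | W p <= t]) W.
- by exists p => /=.
- by apply: closed_comp => [t _|]; [exact: W_continuous | exact: closed_ge].
- exact: W_continuous.
- by right; exists (W p).
have gm t : W t <= W q.
  have [pt|tp] := leP (W p) (W t); first exact: Hq.
  exact: le_trans (ltW tp) Wq.
have [c Ac cq] := chart_at mA q; have cx := cphi_cimg cq.
suff : W q = 0 by move=> E; move: Wq; rewrite E leNgt Wp.
rewrite -(cpsiK mA Ac cq) WE //.
apply: (gradsq_eq0_local_max (open_cimg mA Ac) (smx_metric gA Ac)
  (fun y => sym_metric gA Ac (x := y)) (fun y => posdef_metric gA Ac (x := y)) (su Ac)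
  _ m1 (qe Ac) cx).
- by move=> y _; exact: u0.
- by move=> y cy; rewrite -QE // Q_eq0.
have nc : \forall y \near cphi c q, cimg c y by exact: (open_near (open_cimg mA Ac) cx).
apply: filterS nc => y cy.
by rewrite -!WE // (cpsiK mA Ac cq).
Qed.

Lemma quasi_einstein_ricci_flat : ricci_flat A g.
Proof.
move=> c Ac x cx i j.
have oU := open_cimg mA Ac.
have d0 y k : cimg c y -> partial k (u \o cpsi c) y = 0.
  move=> cy; have : du (u \o cpsi c) y = 0.
    apply: (gradsq_eq0 (fun y => sym_metric gA Ac (x := y))
      (fun y => posdef_metric gA Ac (x := y)) cy).
    by rewrite -WE // W_eq0.
  by move=> /matrixP /(_ k 0); rewrite !mxE.
have H : hessian (g c) (u \o cpsi c) i j x = 0.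
  rewrite /hessian big1 => [|k _]; last by rewrite d0 // mulr0.
  rewrite subr0 (@partial_near _ _ _ (fun=> 0)) ?partial_cst //.
  have nc : \forall y \near x, cimg c y by exact: (open_near oU cx).
  by apply: filterS nc => y; exact: d0.
have m0 : m != 0 by rewrite gt_eqF // (lt_trans ltr01).
move: (qe Ac cx i j); rewrite H => /esym/eqP.
rewrite !mulf_eq0 invr_eq0 (negbTE m0) orbF gt_eqF ?u0 //= => /eqP.
exact.
Qed.

End QuasiEinstein.

Theorem theorem2 (R : realType) (n : nat) (m : R) (M : topologicalType)
    (A : set (chart R n M)) (g : tensor2 R n M) (u : M -> R) :
  (3 <= n)%N -> 1 < m ->
  smooth_manifold A -> riemannian_metric A g ->
  asymptotically_flat A g ->
  quasi_einstein A g u m 0 ->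
  ricci_flat A g.
Proof.
move=> n3 m1 mA gA AF [compl _ su u0 qe].
have [W [Q WQ]] := global_functions mA gA su m.
apply: (quasi_einstein_ricci_flat n3 m1 mA gA compl su u0 _ AF
  (fun c x Ac cx => (WQ c x Ac cx).1) (fun c x Ac cx => (WQ c x Ac cx).2)).
by move=> c Ac x cx i j; rewrite qe // mul0r subr0.
Qed.
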